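(* Let $R^\sigma$ be the curvature tensor of the Chern connection $\nabla^\sigma$ of a SODE $\sigma$ on $M$. Consider the following conditions at a point $\xi\in M^1$: (i) $R^\sigma(X^\sigma,Y)Z=0$ for all $Y,Z\in T^-_\xi(M^1)$ [equivalently, for all $Y\in T^-_\xi(M^1)$, $Z\in T^+_\xi(M^1)$]; (ii) $R^\sigma(X,Y)Z=0$ for all $X,Y,Z\in T^-_\xi(M^1)$ [equivalently, for all $X,Y\in T^-_\xi(M^1)$, $Z\in T^+_\xi(M^1)$]; (iii) $R^\sigma(X,Y)Z=0$ for all $X,Z\in T^-_\xi(M^1)$, $Y\in T^+_\xi(M^1)$ [equivalently, for all $X\in T^-_\xi(M^1)$, $Y,Z\in T^+_\xi(M^1)$]. Let $x\in M$, and let $N$ be an open neighbourhood of $x$ in $M$. In each case below the coordinate system obtained is a fibred coordinate system $(t,x'^1,\dots,x'^n)$ of $p\colon M^0\to\mathbb{R}$, defined on a neighbourhood of $(t_0,x)$ in $M^0$ ($t_0\in\mathbb{R}$ arbitrary) and centred there, i.e. $x'^i(t_0,x)=0$. (a) If (ii) and (iii) hold at all points of $J^1(\mathbb{R},N)$, then there exists such a coordinate system for which $\ddot x'^i\circ\sigma$ is a polynomial of first degree in $\dot x'^1,\dots,\dot x'^n$ (with coefficients functions on the domain in $M^0$) for every $1\le i\le n$. (b) If (i) and (iii) hold at all points of $J^1(\mathbb{R},N)$, then there exists such a coordinate system for which $\ddot x'^i\circ\sigma$ is (the pull-back of) a smooth function on the domain in $M^0$, i.e. does not depend on $\dot x'^1,\dots,\dot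 x'^n$, for every $1\le i\le n$. (c) If (iii) holds and $K^\sigma$ vanishes at all points of $J^1(\mathbb{R},N)$, then there exists such a coordinate system for which $\ddot x'^i\circ\sigma=0$ for every $1\le i\le n$.
   Context: $M$ is a connected smooth manifold of dimension $n$; $M^0=\mathbb{R}\times M$ with projection $p\colon M^0\to\mathbb{R}$; $M^r=J^r(\mathbb{R},M)$ is the manifold of $r$-jets of smooth maps $\mathbb{R}\to M$, with projections $p^{rs}\colon M^r\to M^s$. Coordinates $(x^i)$ on $M$ induce coordinates $(t,x^i,\dot x^i)$ on $M^1$ and $(t,x^i,\dot x^i,\ddot x^i)$ on $M^2$. A fibred coordinate system $(t,x'^i)$ of $p$ is a local coordinate system on $M^0$ whose first coordinate is the standard coordinate $t$ of $\mathbb{R}$ (the $x'^i$ may depend on $t$); it induces $\dot x'^i,\ddot x'^i$ by $\dot x'^i(j^1_{s}\gamma)=\frac{d}{dt}\big|_{s}x'^i(t,\gamma(t))$, $\ddot x'^i(j^2_{s}\gamma)=\frac{d^2}{dt^2}\big|_{s}x'^i(t,\gamma(t))$. The summation convention is used. A SODE on $M$ is a smooth section $\sigma\colon M^1\to M^2$ of $p^{21}$; in coordinates $F^i=\ddot x^i\circ\sigma$. Put $X^\sigma=\frac{\partial}{\partial t}+\dot x^i\frac{\partial}{\partial x^i}+F^i\frac{\partial}{\partial\dot x^i}$ (globally defined), $X^\sigma_i=\frac{\partial}{\partial x^i}+\frac12\frac{\partial F^j}{\partial\dot x^i}\frac{\partial}{\partial\dot x^j}$, $\omega^i=dx^i-\dot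 x^idt$. There is a coordinate-independent decomposition $TM^1=T^0(M^1)\oplus T^-(M^1)\oplus T^+(M^1)$ with $T^0=\langle X^\sigma\rangle$, $T^-=\langle X^\sigma_i\rangle$, $T^+=V(p^{10})=\langle\partial/\partial\dot x^i\rangle$ ($p^{10}$-vertical vectors). For $X\in TM^1$, $X^h$ and $X^v$ denote its components in $T^0\oplus T^-$ and in $V(p^{10})$, respectively. $K^\sigma$ is the curvature form of the corresponding splitting: $K^\sigma(X,Y)=[X^h,Y^h]^v$, $X,Y\in\mathfrak{X}(M^1)$. The Chern connection $\nabla^\sigma$ is the linear connection on $M^1$ given in every induced coordinate system by $\nabla^\sigma_YX^\sigma=0$ for all $Y$; $\nabla^\sigma_{X^\sigma}X^\sigma_i=-\frac12\frac{\partial F^j}{\partial\dot x^i}X^\sigma_j$, $\nabla^\sigma_{X^\sigma}\frac{\partial}{\partial\dot x^i}=-\frac12\frac{\partial F^j}{\partial\dot x^i}\frac{\partial}{\partial\dot x^j}$; $\nabla^\sigma_{X^\sigma_j}X^\sigma_i=-\frac12\frac{\partial^2F^k}{\partial\dot x^i\partial\dot x^j}X^\sigma_k$, $\nabla^\sigma_{X^\sigma_j}\frac{\partial}{\partial\dot x^i}=-\frac12\frac{\partial^2F^k}{\partial\dot x^i\partial\dot x^j}\frac{\partial}{\partial\dot x^k}$; $\nabla^\sigma_{\partial/\partial\dot x^j}X^\sigma_i=0$, $\nabla^\sigma_{\partial/\partial\dot x^j}\frac{\partial}{\partial\dot x^i}=0$. *)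

(* Defs.v *)
From HB Require Import structures.
From mathcomp Require Import all_boot all_order all_algebra.
From mathcomp Require Import all_classical all_reals all_analysis.

Set Implicit Arguments.
Unset Strict Implicit.
Unset Printing Implicit Defensive.

Import Order.TTheory GRing.Theory Num.Theory.
Import numFieldNormedType.Exports.

Local Open Scope classical_set_scope.
Local Open Scope ring_scope.

Section Smooth.
Context {R : realType} {E E' : normedModType R}.

(* Iterated directional derivatives. For open D and finite-dimensional E (the
   only case used below) this is the usual class C^k on D, since continuity of
   the first partial derivatives gives Frechet differentiability. *)
Fixpoint Ck (k : nat) (D : set E) (f : E -> E') : Prop :=
  {in D, continuous f} /\
  if k is k'.+1 then
    forall v : E, {in D, forall z, derivable f z v} /\ Ck k' D ('D_v f)
  else True.

Definition smooth_on (D : set E) (f : E -> E') : Prop := forall k, Ck k D f.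

End Smooth.

Section Charts.
Context {R : realType} {T : topologicalType} {E : normedModType R}.

Record chart := Chart { cdom : set T; cmap : T -> E; cinv : E -> T }.

Definition cim (c : chart) : set E := cmap c @` cdom c.

Definition is_chart (c : chart) : Prop :=
  [/\ open (cdom c), open (cim c),
      {in cdom c, cancel (cmap c) (cinv c)},
      {in cdom c, continuous (cmap c)}
    & {in cim c, continuous (cinv c)}].

Definition compatible (c d : chart) : Prop :=
  smooth_on (cmap c @` (cdom c `&` cdom d)) (cmap d \o cinv c) /\
  smooth_on (cmap d @` (cdom c `&` cdom d)) (cmap c \o cinv d).

Definition is_atlas (A : set chart) : Prop :=
  [/\ forall c, A c -> is_chart c,
      forall x, exists2 c, A c & cdom c x
    & forall c d, A c -> A d -> compatible c d].

(* The coordinate systems of the manifold: the members of the maximal atlas. *)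
Definition coord_system (A : set chart) (c : chart) : Prop :=
  is_chart c /\ forall d, A d -> compatible c d.

Definition smooth_fun {V : normedModType R} (A : set chart) (W : set T)
    (f : T -> V) : Prop :=
  forall c, coord_system A c ->
    smooth_on (cmap c @` (cdom c `&` W)) (f \o cinv c).

End Charts.
Arguments chart {R} T E.

Record smooth_manifold {R : realType} {n : nat} {M : topologicalType}
    (A : set (chart M 'rV[R]_n)) : Prop := SmoothManifold {
  manifold_hausdorff : hausdorff_space M;
  manifold_second_countable : @second_countable M;
  manifold_atlas : is_atlas A }.

(* The coordinate space of M^1 = J^1(R, M); its elements are
   ((t, x), v), with v for xdot. *)
Notation E1 R n := (R * 'rV[R]_n * 'rV[R]_n)%type.

(* Charts of M^0 = R x M. *)
Notation chart0 R M n := (chart (R * M)%type (R * 'rV[R]_n)%type).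

Section Jets.
Context {R : realType} {n : nat} {M : topologicalType}.
Variable A : set (chart M 'rV[R]_n).

Record curve := Curve {
  curve_fun :> R -> M;
  curve_continuous : continuous curve_fun;
  curve_smooth : forall c, coord_system A c ->
    smooth_on (curve_fun @^-1` cdom c) (cmap c \o curve_fun) }.

Definition contact (r : nat) (s : R) (g h : curve) : Prop :=
  g s = h s /\
  forall c, coord_system A c -> cdom c (g s) ->
    forall k, (k <= r)%N ->
      derive1n k (cmap c \o g) s = derive1n k (cmap c \o h) s.

Definition jet_class (r : nat) (p : R * curve) : set (R * curve) :=
  [set q | q.1 = p.1 /\ contact r p.1 p.2 q.2].

(* J^r(R, M): the classes of pairs (s, g) for contact of order r at s. *)
Record jet (r : nat) := Jet {
  jet_set : set (R * curve);
  jet_setP : exists p, jet_set = jet_class r p }.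

Definition jet_of (r : nat) (s : R) (g : curve) : jet r :=
  Jet (ex_intro _ (s, g) erefl).

Definition jet_rep (r : nat) (xi : jet r) : R * curve :=
  projT1 (cid (jet_setP xi)).

Definition jet_proj (r s : nat) (xi : jet r) : jet s :=
  jet_of s (jet_rep xi).1 (jet_rep xi).2.

Definition jet_base (r : nat) (xi : jet r) : R * M :=
  ((jet_rep xi).1, (jet_rep xi).2 (jet_rep xi).1).

Definition lift_chart (c : chart M 'rV[R]_n) : chart0 R M n :=
  Chart [set p | cdom c p.2] (fun p => (p.1, cmap c p.2))
        (fun q => (q.1, cinv c q.2)).

Definition atlas0 : set (chart0 R M n) := lift_chart @` A.

Definition fibred_coord (phi : chart0 R M n) : Prop :=
  coord_system atlas0 phi /\ {in cdom phi, forall p, (cmap phi p).1 = p.1}.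

(* The coordinates on M^r induced by fibred coordinates (t, x'): for k = 0, 1, 2
   these are x', its first and its second total derivative (for k <= r). *)
Definition jet_coord (k r : nat) (phi : chart0 R M n) (xi : jet r) :
    'rV[R]_n :=
  derive1n k (fun t => (cmap phi (t, (jet_rep xi).2 t)).2) (jet_rep xi).1.

Definition coord1 (c : chart M 'rV[R]_n) (xi : jet 1) : E1 R n :=
  ((jet_rep xi).1, jet_coord 0 (lift_chart c) xi,
   jet_coord 1 (lift_chart c) xi).

Definition jet_over (c : chart M 'rV[R]_n) (xi : jet 1) : Prop :=
  cdom c (jet_base xi).2.

(* The functions F^i = xddot^i o sigma, in the coordinates of M^1. *)
Definition local_F (sigma : jet 1 -> jet 2) (c : chart M 'rV[R]_n)
    (z : E1 R n) : 'rV[R]_n :=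
  xget 0 [set a | exists xi, [/\ jet_over c xi, coord1 c xi = z
                               & a = jet_coord 2 (lift_chart c) (sigma xi)]].

(* In the charts (t, x, v) of M^1 and (t, x, v, a) of M^2, the only nontrivial
   component of a section is [local_F]. *)
Record sode := Sode {
  sode_fun :> jet 1 -> jet 2;
  sode_section : forall xi, jet_proj 1 (sode_fun xi) = xi;
  sode_smooth : forall c, coord_system A c ->
    smooth_on [set z : E1 R n | cim c z.1.2] (local_F sode_fun c) }.

End Jets.

(* From here on we use the coordinates (t, x, v) of M^1 induced by one
   chart of M, where F = [local_F]. *)
Section Chern.
Context {R : realType} {n : nat}.
Local Notation E1 := (E1 R n).
Variable F : E1 -> 'rV[R]_n.

Definition vfield := E1 -> E1.

Definition pdot (i : 'I_n) (f : E1 -> R) : E1 -> R :=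
  'D_((0, 0, delta_mx 0 i) : E1) f.

Definition dF (i j : 'I_n) : E1 -> R := pdot i (fun z => F z 0 j).

Definition X_sigma : vfield := fun z => (1, z.2, F z).

Definition X_minus (i : 'I_n) : vfield := fun z =>
  (0, delta_mx 0 i, \row_j (2^-1 * dF i j z)).

Definition X_plus (i : 'I_n) : vfield := fun=> (0, 0, delta_mx 0 i).

(* Frame indices: None for T^0, Some (inl i) for T^-, Some (inr i) for T^+. *)
Definition frame_ix := option ('I_n + 'I_n)%type.

Definition frame (a : frame_ix) : vfield :=
  match a with
  | None => X_sigma
  | Some (inl i) => X_minus i
  | Some (inr i) => X_plus i
  end.

Definition omega (i : 'I_n) (z Z : E1) : R := Z.1.2 0 i - z.2 0 i * Z.1.1.

(* The coframe dual to [frame]. *)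
Definition coframe (a : frame_ix) (z Z : E1) : R :=
  match a with
  | None => Z.1.1
  | Some (inl i) => omega i z Z
  | Some (inr k) => Z.2 0 k - F z 0 k * Z.1.1
                    - 2^-1 * \sum_i omega i z Z * dF i k z
  end.

Definition bracket (X Y : vfield) : vfield := fun z =>
  'D_(X z) Y z - 'D_(Y z) X z.

Definition hor (X : vfield) : vfield := fun z =>
  coframe None z (X z) *: X_sigma z
  + \sum_i coframe (Some (inl i)) z (X z) *: X_minus i z.

Definition ver (X : vfield) : vfield := fun z =>
  \sum_i coframe (Some (inr i)) z (X z) *: X_plus i z.

Definition K_form (X Y : vfield) : vfield := ver (bracket (hor X) (hor Y)).

(* [chern_frame b a] is the covariant derivative of [frame a] along
   [frame b]. *)
Definition chern_frame (b a : frame_ix) : vfield := fun z =>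
  match b, a with
  | _, None => 0
  | None, Some (inl i) => - (2^-1 *: \sum_j dF i j z *: X_minus j z)
  | None, Some (inr i) => - (2^-1 *: \sum_j dF i j z *: X_plus j z)
  | Some (inl j), Some (inl i) =>
      - (2^-1 *: \sum_k pdot i (dF j k) z *: X_minus k z)
  | Some (inl j), Some (inr i) =>
      - (2^-1 *: \sum_k pdot i (dF j k) z *: X_plus k z)
  | Some (inr _), Some _ => 0
  end.

(* The linear connection with the above values on the frame: expand
   Z = \sum_a Z^a (frame a) and Y = \sum_b Y^b (frame b), and use the Leibniz
   rule in Z and linearity over functions in Y. *)
Definition nabla (Y Z : vfield) : vfield := fun z =>
  \sum_(a : frame_ix)
    ('D_(Y z) (fun w => coframe a w (Z w)) z *: frame a z
     + coframe a z (Z z) *: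
         \sum_(b : frame_ix) coframe b z (Y z) *: chern_frame b a z).

Definition curvature (X Y Z : vfield) : vfield := fun z =>
  nabla X (nabla Y Z) z - nabla Y (nabla X Z) z - nabla (bracket X Y) Z z.

(* [curvature] and [K_form] are tensorial, so their values on tangent vectors
   can be computed by extending these with constant coordinate components. *)
Definition curvature_at (z X Y Z : E1) : E1 :=
  curvature (cst X) (cst Y) (cst Z) z.

Definition K_at (z X Y : E1) : E1 := K_form (cst X) (cst Y) z.

Definition T_sigma (z : E1) : set E1 := [set X_sigma z].

Definition T_minus (z : E1) : set E1 :=
  [set X | exists a : 'I_n -> R, X = \sum_i a i *: X_minus i z].

Definition T_plus (z : E1) : set E1 :=
  [set X | exists a : 'I_n -> R, X = \sum_i a i *: X_plus i z].

End Chern.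

Section Conditions.
Context {R : realType} {n : nat} {M : topologicalType}.
Context {A : set (chart M 'rV[R]_n)}.
Variable sigma : sode A.

Definition subspaces := (E1 R n -> 'rV[R]_n) -> E1 R n -> set (E1 R n).

(* A tensor at xi vanishes when its components vanish in the coordinate systems
   of M^1 around xi induced by coordinate systems of M. *)
Definition curvature_vanishes (P Q S : subspaces) (xi : jet A 1) : Prop :=
  forall c, coord_system A c -> jet_over c xi ->
    let F := local_F sigma c in let z := coord1 c xi in
    forall X Y Z, P F z X -> Q F z Y -> S F z Z -> curvature_at F z X Y Z = 0.

Definition K_vanishes (xi : jet A 1) : Prop :=
  forall c, coord_system A c -> jet_over c xi ->
    forall X Y, K_at (local_F sigma c) (coord1 c xi) X Y = 0.

Local Notation T0 := (@T_sigma R n).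
Local Notation Tm := (@T_minus R n).
Local Notation Tp := (fun _ => @T_plus R n).

Definition cond_i := curvature_vanishes T0 Tm Tm.
Definition cond_i' := curvature_vanishes T0 Tm Tp.
Definition cond_ii := curvature_vanishes Tm Tm Tm.
Definition cond_ii' := curvature_vanishes Tm Tm Tp.
Definition cond_iii := curvature_vanishes Tm Tp Tm.
Definition cond_iii' := curvature_vanishes Tm Tp Tp.

Definition jets_in (N : set M) : set (jet A 1) :=
  [set xi | N (jet_base xi).2].

Definition centred_coord (p : R * M)
    (phi : chart0 R M n) : Prop :=
  [/\ fibred_coord A phi, cdom phi p & (cmap phi p).2 = 0].

Definition affine_in (phi : chart0 R M n) : Prop :=
  exists (a : 'I_n -> 'I_n -> R * M -> R) (b : 'I_n -> R * M -> R),
  [/\ forall i j, smooth_fun (atlas0 A) (cdom phi) (a i j),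
      forall i, smooth_fun (atlas0 A) (cdom phi) (b i)
    & forall (xi : jet A 1) (i : 'I_n), cdom phi (jet_base xi) ->
        jet_coord 2 phi (sigma xi) 0 i =
        \sum_j a i j (jet_base xi) * jet_coord 1 phi xi 0 j
        + b i (jet_base xi)].

Definition basic_in (phi : chart0 R M n) : Prop :=
  exists b : 'I_n -> R * M -> R,
  (forall i, smooth_fun (atlas0 A) (cdom phi) (b i)) /\
  forall (xi : jet A 1) (i : 'I_n), cdom phi (jet_base xi) ->
    jet_coord 2 phi (sigma xi) 0 i = b i (jet_base xi).

Definition zero_in (phi : chart0 R M n) : Prop :=
  forall (xi : jet A 1) (i : 'I_n), cdom phi (jet_base xi) ->
    jet_coord 2 phi (sigma xi) 0 i = 0.

End Conditions.
Arguments jets_in {R n M} A N.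
Arguments centred_coord {R n M} A p phi.

(* Main.v *)
Require Import Defs.
From mathcomp Require Import all_boot all_order all_algebra.
From mathcomp Require Import all_classical all_reals all_analysis.
From mathcomp Require Import ring lra.
Import Order.TTheory GRing.Theory Num.Theory.
Import numFieldNormedType.Exports.
Local Open Scope classical_set_scope.
Local Open Scope ring_scope.

Set Implicit Arguments.
Unset Strict Implicit.
Unset Printing Implicit Defensive.

(** In the coordinates (t, x, v) induced by a chart, the Chern connection leaves
    X^sigma parallel and acts on the frames of T^- and of T^+ through the same
    matrix of one-forms [theta]. Hence R(X, Y) acts on both bundles through the
    matrix dtheta + theta /\ theta evaluated at (X, Y) ([theta_curv],
    [curvatureE]), and each condition on T^- is equivalent to the one on T^+.

    Condition (iii) says that the third derivatives of F in the velocities vanish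
    ([third_derivatives_vanish]). Then F = C - 2 B v - H(v, v) with coefficients on
    R x M, the velocities cancel in [theta], and [theta] is the pull-back of the
    form [Theta] = B dt + sum_j H_j dx^j on R x M ([theta_base]). Condition (ii) now
    says that [Theta] is flat on each fibre t = const, condition (i) that it is flat,
    and K = 0 that the affine connection with linear part [Theta] and translation
    part C dt - B dx is flat ([base_flat_fibres], [base_flat], [K_flat]).

    A flat form has an invertible solution p of dp = p Theta ([frobenius]); in case
    (a) this holds along the fibres t = const only. As H is symmetric in its lower
    indices, the form p dx is closed along these fibres, so p is the Jacobian in
    the space directions of some u ([primitive_of_closed_form]), and u can be taken
    as the new space coordinates by the inverse function theorem. Differentiating u
    twice along a solution gives

      u'' = (u_tt + p C) + 2 (p_t - p B) v,     u' = u_t + p v,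

    because the quadratic term of F cancels the one coming from the derivative of p
    ([new_acceleration]). This is (a). In case (b) the equation dp = p Theta also
    holds in the t direction, so p_t = p B and the velocity disappears. In case (c)
    the form - p (C dt - B dx) is closed as well; with a primitive g of it,
    g dt + p dx is closed, and its primitive u satisfies u_tt = - p C.

    The classes C^k being defined by iterated directional derivatives, the calculus
    behind these steps (chain rule, symmetry of second derivatives, differentiation
    under the integral sign, linear differential equations with parameters, inverse
    functions) is developed for spaces with finitely many continuous coordinates.
    The passage from conditions on jets to conditions at all points (t, x, v) of a
    chart uses that every such point is the jet of a curve ([curve_through]). *)

(** * Calculus of the classes C^k *)

Lemma open_near {T : topologicalType} (D : set T) x :
  open D -> D x -> \forall y \near x, D y.
Proof. by move=> oD Dx; exact: open_nbhs_nbhs. Qed.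

Section CkBasics.
Context {R : realType} {E V : normedModType R}.
Implicit Types (D : set E) (f g : E -> V) (k : nat).

Lemma Ck_cont k D f : Ck k D f -> {in D, continuous f}.
Proof. by case: k => [|k] []. Qed.

Lemma Ck_derivable k D f v x : Ck k.+1 D f -> D x -> derivable f x v.
Proof. by move=> [_ /(_ v)[h _]] Dx; apply: h; rewrite inE. Qed.

Lemma Ck_derive k D f v : Ck k.+1 D f -> Ck k D ('D_v f).
Proof. by move=> [_ /(_ v)[]]. Qed.

Lemma CkW k D f : Ck k.+1 D f -> Ck k D f.
Proof.
elim: k f => [|k IH] f; first by move=> [].
by move=> [cf df]; split=> // v; have [dv /IH] := df v.
Qed.

Lemma Ck_local k D f :
  (forall x, D x -> exists2 D', D' x & Ck k D' f) -> Ck k D f.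
Proof.
elim: k f => [|k IH] f H.
  split=> // x; rewrite inE => /H[D' D'x [cf _]]; apply: cf; by rewrite inE.
split=> [x|v].
  by rewrite inE => /H[D' D'x [cf _]]; apply: cf; rewrite inE.
split=> [x|].
  by rewrite inE => /H[D' D'x /Ck_derivable]; apply.
by apply: IH => x /H[D' D'x /Ck_derive H']; exists D'.
Qed.

Lemma Ck_sub k D D' f : D' `<=` D -> Ck k D f -> Ck k D' f.
Proof. by move=> sD H; apply: Ck_local => x /sD Dx; exists D. Qed.

Lemma Ck_eq k D f g : open D -> {in D, f =1 g} -> Ck k D f -> Ck k D g.
Proof.
move=> oD; have nD x : D x -> \forall y \near x, D y by exact: open_near.
have nfg f' g' x : {in D, f' =1 g'} -> D x -> {near x, f' =1 g'}.
  by move=> fg /nD; apply: filterS => y Dy; apply: fg; rewrite inE.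
elim: k f g => [|k IH] f g fg.
  move=> [cf _]; split=> // x; rewrite inE => Dx.
  rewrite /continuous_at -fg ?inE//.
  by apply: cvg_trans (cf x _); [apply: near_eq_cvg; exact: nfg|rewrite inE].
move=> [cf df]; split=> [x|v].
  rewrite inE => Dx; rewrite /continuous_at -fg ?inE//.
  by apply: cvg_trans (cf x _); [apply: near_eq_cvg; exact: nfg|rewrite inE].
have [dv Cv] := df v; split=> [x|].
  rewrite inE => Dx; apply: (near_eq_derivable (nfg _ _ _ fg Dx)).
  by apply: dv; rewrite inE.
apply: IH Cv => x; rewrite inE => Dx; exact/near_eq_derive/nfg.
Qed.

Lemma Ck_cst k D (c : V) : Ck k D (cst c).
Proof.
elim: k c => [|k IH] c; first by split=> // x _; exact: cst_continuous.
split=> [x _|v]; first exact: cst_continuous.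
split=> [x _|]; first exact: derivable_cst.
by rewrite (_ : 'D_v _ = cst 0) //; apply/funext => x; rewrite derive_cst.
Qed.

Lemma Ck_add k D f g : open D -> Ck k D f -> Ck k D g -> Ck k D (f + g).
Proof.
move=> oD; elim: k f g => [|k IH] f g Cf Cg.
  split=> // x Dx; apply: continuousD; [exact: Cf.1|exact: Cg.1].
split=> [x Dx|v].
  by apply: continuousD; [exact: Cf.1|exact: Cg.1].
have [df Cdf] := Cf.2 v; have [dg Cdg] := Cg.2 v.
split=> [x Dx|]; first exact: derivableD (df x Dx) (dg x Dx).
apply: Ck_eq oD _ (IH _ _ Cdf Cdg) => x Dx.
by rewrite deriveD //; [exact: df|exact: dg].
Qed.

Lemma Ck_scale k D (c : R) f : open D -> Ck k D f -> Ck k D (c \*: f).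
Proof.
move=> oD; elim: k f => [|k IH] f Cf.
  by split=> // x Dx; apply: continuousZl_tmp; exact: Cf.1.
split=> [x Dx|v]; first by apply: continuousZl_tmp; exact: Cf.1.
have [df Cdf] := Cf.2 v.
split=> [x Dx|]; first exact: derivableZ (df x Dx).
apply: Ck_eq oD _ (IH _ Cdf) => x Dx.
by rewrite deriveZ //; exact: df.
Qed.

Lemma Ck_sum (I : Type) (r : seq I) k D (f : I -> E -> V) : open D ->
  (forall i, Ck k D (f i)) -> Ck k D (fun x => \sum_(i <- r) f i x).
Proof.
move=> oD Cf; elim: r => [|i r IH].
  apply: Ck_eq (Ck_cst k D 0) => // x _; by rewrite big_nil.
by apply: Ck_eq (Ck_add oD (Cf i) IH) => // x _; rewrite big_cons.
Qed.

End CkBasics.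

Lemma Ck_mul {R : realType} {E : normedModType R} k (D : set E) (f g : E -> R) :
  open D -> Ck k D f -> Ck k D g -> Ck k D (f * g).
Proof.
move=> oD; elim: k f g => [|k IH] f g Cf Cg.
  by split=> // x Dx; apply: continuousM; [exact: Cf.1|exact: Cg.1].
split=> [x Dx|v].
  by apply: continuousM; [exact: Cf.1|exact: Cg.1].
have [df Cdf] := Cf.2 v; have [dg Cdg] := Cg.2 v.
split=> [x Dx|]; first exact: derivableM (df x Dx) (dg x Dx).
apply: Ck_eq oD _ (Ck_add oD (IH _ _ (CkW Cf) Cdg) (IH _ _ (CkW Cg) Cdf)).
by move=> x Dx; rewrite deriveM //; [exact: df|exact: dg].
Qed.

(** * Difference quotients and mean values *)

Section EpsDelta.
Context {R : realType} {E V : normedModType R}.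
Implicit Types (f : E -> V) (x v : E).

(** Remainder estimates are easier to combine in this form than limits of difference
    quotients. *)
Lemma is_deriveP f x v d : is_derive x v f d <->
  forall e : R, 0 < e -> exists2 r : R, 0 < r &
    forall h, 0 < `|h| -> `|h| < r ->
      `|f (x + h *: v) - f x - h *: d| <= e * `|h|.
Proof.
have E1 h : h != 0 -> `|d - h^-1 *: (f (h *: v + x) - f x)| =
    `|h|^-1 * `|f (x + h *: v) - f x - h *: d|.
  move=> h0; rewrite -[in RHS]normfV -normrZ [LHS]distrC [in RHS]scalerBr scalerA.
  by rewrite mulVf// scale1r (addrC x).
split=> [[fd fdd] e e0|H].
  move: fd => /cvgrPdist_le /(_ _ e0)[r /= r0 H]; exists r => // h h0 hr.
  have hn0 : h != 0 by rewrite -normr_gt0.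
  have H1 : `|d - h^-1 *: (f (h *: v + x) - f x)| <= e.
    by rewrite -fdd; apply: H => //=; rewrite sub0r normrN.
  by move: H1; rewrite E1 // ler_pdivrMl// mulrC.
have L : (fun h => h^-1 *: ((f \o shift x) (h *: v) - f x)) @ 0^' --> d.
  apply/cvgrPdist_le => e /H[r r0 Hr].
  exists r => //= h; rewrite /= sub0r normrN => hr hn0.
  have h0 : 0 < `|h| by rewrite normr_gt0.
  by rewrite E1 // ler_pdivrMl// mulrC; exact: Hr.
by apply: DeriveDef; [apply/cvg_ex; exists d|exact: cvg_lim L].
Qed.

Lemma derivable_line f x v (t : R) :
  derivable (fun h : R => f (x + h *: v)) t 1 <-> derivable f (x + t *: v) v.
Proof.
rewrite /derivable; set g1 := fun h => h^-1 *: _; set g2 := fun h => h^-1 *: _.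
suff -> : g1 = g2 by [].
apply/funext => h; rewrite /g1 /g2 /= [_%:A]mulr1; congr (_ *: (f _ - _)).
by rewrite scalerDl [in RHS]addrC -addrA [t *: v + _]addrC.
Qed.

Lemma derive_line f x v (t : R) :
  'D_1 (fun h : R => f (x + h *: v)) t = 'D_v f (x + t *: v).
Proof.
rewrite /derive; set g1 := fun h => h^-1 *: _; set g2 := fun h => h^-1 *: _.
suff -> : g1 = g2 by [].
apply/funext => h; rewrite /g1 /g2 /= [_%:A]mulr1; congr (_ *: (f _ - _)).
by rewrite scalerDl [in RHS]addrC -addrA [t *: v + _]addrC.
Qed.

Lemma is_derive_line f x v (t : R) : derivable f (x + t *: v) v ->
  is_derive t 1 (fun h : R => f (x + h *: v)) ('D_v f (x + t *: v)).
Proof.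
by move=> d; apply: DeriveDef; [exact/derivable_line|exact: derive_line].
Qed.

Lemma is_derive_scale_dir f x v d (c : R) :
  is_derive x v f d -> is_derive x (c *: v) f (c *: d).
Proof.
move=> /is_deriveP H; apply/is_deriveP => e e0.
have [->|c0] := eqVneq c 0.
  exists 1 => // h h0 _; rewrite !scale0r !scaler0 !addr0 !subrr normr0.
  by rewrite mulr_ge0// ltW.
have c1 : 0 < `|c| by rewrite normr_gt0.
have [r r0 Hr] := H (e / `|c|) (divr_gt0 e0 c1).
exists (r / `|c|); first by rewrite divr_gt0.
move=> h h0 hr; have := Hr (h * c); rewrite normrM => /(_ (mulr_gt0 h0 c1)).
by rewrite -ltr_pdivlMr// => /(_ hr); rewrite -!scalerA [`|h| * _]mulrC mulrA divfK // gt_eqF.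
Qed.

End EpsDelta.

Lemma MVT01 {R : realType} (f df : R -> R) (s : R) : 0 <= s ->
  (forall t, 0 <= t <= s -> is_derive t 1 f (df t)) ->
  exists2 t, 0 <= t <= s & f s - f 0 = df t * s.
Proof.
move=> s0 H; have [t tI E] : exists2 c, c \in `[0, s]%R & f s - f 0 = df c * (s - 0).
  apply: MVT_segment => // [x|].
    by rewrite in_itv/= => /andP[x0 xs]; apply: H; rewrite !ltW.
  apply: derivable_within_continuous => x; rewrite in_itv/= => xI.
  exact: (@ex_derive _ _ _ _ _ _ _ (H x xI)).
by exists t; [rewrite in_itv in tI|rewrite E subr0].
Qed.

Section ScalarDirections.
Context {R : realType} {E : normedModType R}.
Implicit Types (f : E -> R) (x v w : E).

Lemma MVT_line f x v :
  (forall t : R, 0 <= t <= 1 -> derivable f (x + t *: v) v) ->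
  exists2 t : R, 0 <= t <= 1 & f (x + v) - f x = 'D_v f (x + t *: v).
Proof.
move=> H; have [t tI E1] := @MVT01 R (fun h : R => f (x + h *: v))
  (fun t => 'D_v f (x + t *: v)) 1 ler01 (fun t tI => is_derive_line (H t tI)).
by exists t; rewrite // mulr1 scale1r scale0r addr0 in E1.
Qed.

Lemma MVT_line_scale f x v (c : R) :
  (forall t : R, 0 <= t <= 1 -> derivable f (x + (t * c) *: v) v) ->
  exists2 t : R, 0 <= t <= 1 & f (x + c *: v) - f x = c * 'D_v f (x + (t * c) *: v).
Proof.
move=> H; have H' (t : R) : 0 <= t <= 1 ->
    is_derive (x + t *: (c *: v)) (c *: v) f (c *: 'D_v f (x + (t * c) *: v)).
  by move=> /H /derivableP/is_derive_scale_dir; rewrite scalerA; exact.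
have [t tI ->] := @MVT_line f x (c *: v) (fun t tI => @ex_derive _ _ _ _ _ _ _ (H' t tI)).
by exists t => //; have [_ ->] := H' t tI.
Qed.

(** Membership in C^1 only gives derivatives along each direction separately. Moving from
    a first along h w and then along h v, the second increment is controlled by the mean
    value theorem, whence the continuity of the derivative along v. *)
Lemma is_derive_add_dir f a v w dw :
  (\forall y \near a, derivable f y v) -> {for a, continuous ('D_v f)} ->
  is_derive a w f dw -> is_derive a (v + w) f ('D_v f a + dw).
Proof.
move=> nd cv /is_deriveP H; apply/is_deriveP => e e0.
have e20 : 0 < e / 2 by rewrite divr_gt0.
have [r r0 Hr] := H _ e20.
have /cvgrPdist_le/(_ _ e20) cv' := cv.
have [s /= s0 Hs] : nbhs_ball a [set y | derivable f y v /\ `|'D_v f a - 'D_v f y| <= e / 2].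
  by apply/nbhs_ballP; apply: filterS2 nd cv' => y.
pose q := s / (`|v| + `|w| + 1).
have N0 : 0 < `|v| + `|w| + 1 by rewrite ltr_pwDr// addr_ge0.
exists (Num.min r q); first by rewrite lt_min r0 divr_gt0.
move=> h h0; rewrite lt_min => /andP[hr hq].
have near_a (t : R) : 0 <= t <= 1 -> ball a s (a + h *: w + (t * h) *: v).
  move=> /andP[t0 t1]; rewrite -ball_normE /ball_/= -addrA opprD addNKr normrN.
  apply: le_lt_trans (_ : `|h| * (`|v| + `|w| + 1) < s); last first.
    by rewrite -ltr_pdivlMr.
  apply: le_trans (ler_normD _ _) _; rewrite !normrZ !mulrDr mulr1.
  have ht : `|t| * `|h| * `|v| <= `|h| * `|v|.
    by rewrite ler_wpM2r// ler_piMl// ger0_norm.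
  by rewrite [X in X <= _]addrC -[leRHS]addrA lerD// lerDl ltW.
have [t tI Et] := @MVT_line_scale f (a + h *: w) v h (fun t tI => (Hs _ (near_a t tI)).1).
have /= [_ D1] := Hs _ (near_a t tI).
have -> : a + h *: (v + w) = a + h *: w + h *: v.
  by rewrite scalerDr [h *: v + _]addrC addrA.
have -> : f (a + h *: w + h *: v) - f a - h *: ('D_v f a + dw) =
    (f (a + h *: w) - f a - h *: dw) - h * ('D_v f a - 'D_v f (a + h *: w + (t * h) *: v)).
  by rewrite mulrBr -Et /GRing.scale/=; ring.
apply: le_trans (ler_normB _ _) _; rewrite [e]splitr mulrDl lerD//; first exact: Hr.
by rewrite normrM mulrC ler_wpM2r.
Qed.

End ScalarDirections.

(** * Continuous linear maps and coordinates *)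

Section ContinuousLinear.
Context {R : realType} {E V : normedModType R}.

Definition clinear (l : E -> V) : Prop :=
  (forall (a : R) x y, l (a *: x + y) = a *: l x + l y) /\ continuous l.

Variable l : E -> V.
Hypothesis ll : clinear l.

Lemma clinD x y : l (x + y) = l x + l y.
Proof. by have := ll.1 1 x y; rewrite !scale1r. Qed.

Lemma clin0 : l 0 = 0.
Proof. by apply: (@addrI _ (l 0)); rewrite -clinD !addr0. Qed.

Lemma clinZ a x : l (a *: x) = a *: l x.
Proof. by have := ll.1 a x 0; rewrite clin0 !addr0. Qed.

Lemma clinN x : l (- x) = - l x.
Proof. by rewrite -scaleN1r clinZ scaleN1r. Qed.

Lemma clinB x y : l (x - y) = l x - l y.
Proof. by rewrite clinD clinN. Qed.

Lemma clin_sum (I : Type) (r : seq I) (f : I -> E) :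
  l (\sum_(i <- r) f i) = \sum_(i <- r) l (f i).
Proof.
elim: r => [|i r IH]; first by rewrite !big_nil clin0.
by rewrite !big_cons clinD IH.
Qed.

Lemma is_derive_clin (U : normedModType R) (f : U -> E) x v d :
  is_derive x v f d -> is_derive x v (l \o f) (l d).
Proof.
move=> [fd fdd].
have L : (fun h => h^-1 *: ((f \o shift x) (h *: v) - f x)) @ 0^' --> d.
  by rewrite -fdd; exact: fd.
have L' : (fun h => h^-1 *: (((l \o f) \o shift x) (h *: v) - (l \o f) x)) @ 0^' --> l d.
  rewrite [X in X @ _](_ : _ = l \o (fun h => h^-1 *: ((f \o shift x) (h *: v) - f x))).
    by apply: (continuous_cvg _ _ L); exact: ll.2.
  by apply/funext => h /=; rewrite clinZ clinB.
by apply: DeriveDef; [apply/cvg_ex; exists (l d)|exact: cvg_lim L'].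
Qed.

Lemma is_derive_clin_id x v : is_derive x v l (l v).
Proof. exact: (is_derive_clin (is_derive_id x v)). Qed.

Lemma derive_clin_id v : 'D_v l = cst (l v).
Proof. by apply/funext => x; case: (is_derive_clin_id x v). Qed.

Lemma Ck_clin k (D : set E) : Ck k D l.
Proof.
case: k => [|k]; first by split=> // x _; exact: ll.2.
split=> [x _|v]; first exact: ll.2.
split=> [x _|]; last by rewrite derive_clin_id; exact: Ck_cst.
by case: (is_derive_clin_id x v).
Qed.

End ContinuousLinear.

Lemma Ck_clin_comp {R : realType} {U E V : normedModType R} k (D : set U)
  (f : U -> E) (l : E -> V) :
  clinear l -> open D -> Ck k D f -> Ck k D (l \o f).
Proof.
move=> ll oD; elim: k f => [|k IH] f Cf.
  split=> // x Dx; apply: continuous_comp; [exact: Cf.1|exact: ll.2].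
split=> [x Dx|v].
  by apply: continuous_comp; [exact: Cf.1|exact: ll.2].
have [df Cdf] := Cf.2 v.
have H x : x \in D -> is_derive x v (l \o f) (l ('D_v f x)).
  by move=> /df /derivableP; exact: is_derive_clin.
split=> [x Dx|]; first by case: (H x Dx).
by apply: Ck_eq oD _ (IH _ Cdf) => x Dx; have [_ ->] := H x Dx.
Qed.

Section ClinearInstances.
Context {R : realType}.

Lemma clinear_id (E : normedModType R) : clinear (@id E).
Proof. by split=> // x; exact: cvg_id. Qed.

Lemma clinear_comp (U E V : normedModType R) (f : U -> E) (g : E -> V) :
  clinear f -> clinear g -> clinear (g \o f).
Proof.
move=> [fl fc] [gl gc]; split=> [a x y|x] /=; first by rewrite fl gl.
by apply: continuous_comp; [exact: fc|exact: gc].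
Qed.

Lemma clinear_fst (E V : normedModType R) : clinear (@fst E V).
Proof. by split=> // x; exact: cvg_fst. Qed.

Lemma clinear_snd (E V : normedModType R) : clinear (@snd E V).
Proof. by split=> // x; exact: cvg_snd. Qed.

Lemma clinear_scalel (E : normedModType R) (w : E) : clinear (fun c : R => c *: w).
Proof.
split=> [a x y|x]; first by rewrite scalerDl scalerA.
exact: scalel_continuous.
Qed.

Lemma clinear_coord m n i j : clinear (fun M : 'M[R]_(m, n) => M i j).
Proof. by split=> [a x y|x]; [rewrite !mxE|exact: coord_continuous]. Qed.

Lemma clinear_pair (U E V : normedModType R) (f : U -> E) (g : U -> V) :
  clinear f -> clinear g -> clinear (fun x => (f x, g x)).
Proof.
move=> [fl fc] [gl gc]; split=> [a x y|x]; first by rewrite fl gl.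
by apply: cvg_pair; [exact: fc|exact: gc].
Qed.

Lemma clinear0 (U E : normedModType R) : clinear (fun _ : U => 0 : E).
Proof. by split=> [a x y|x]; [rewrite scaler0 addr0|exact: cvg_cst]. Qed.

End ClinearInstances.

(** Finite dimension in the only form used below: finitely many continuous coordinate
    functionals. Unlike a basis in the usual sense, this passes to products by mere
    concatenation. *)
Record coords {R : realType} (E : normedModType R) := Coords {
  cdim : nat;
  cvec : 'I_cdim -> E;
  ccoord : 'I_cdim -> E -> R;
  ccoord_lin : forall i, clinear (ccoord i);
  ccoordE : forall x, x = \sum_i ccoord i x *: cvec i }.
Arguments cdim {R E}.
Arguments cvec {R E}.
Arguments ccoord {R E}.
Arguments ccoord_lin {R E}.
Arguments ccoordE {R E}.

Section CoordsInstances.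
Context {R : realType}.

Definition coordsR : coords R.
Proof.
refine (@Coords R R 1 (fun=> 1) (fun _ => id) _ _).
- by move=> _; exact: clinear_id.
- by move=> x; rewrite big_ord1 /GRing.scale/= mulr1.
Defined.

Definition coords_rV n : coords 'rV[R]_n.
Proof.
refine (@Coords R _ n (fun i => delta_mx 0 i) (fun i x => x 0 i) _ _).
- by move=> i; exact: clinear_coord.
- by move=> x; exact: row_sum_delta.
Defined.

Definition coords_prod (E V : normedModType R) (b : coords E) (c : coords V) :
  coords (E * V)%type.
Proof.
refine (@Coords R _ (cdim b + cdim c)
  (fun i => match fintype.split i with inl j => (cvec b j, 0) | inr j => (0, cvec c j) end)
  (fun i x => match fintype.split i with inl j => ccoord b j x.1 | inr j => ccoord c j x.2 end)
  _ _).
- move=> i; case: (fintype.split i) => j /=.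
    exact: (clinear_comp (@clinear_fst _ E V) (ccoord_lin b j)).
  exact: (clinear_comp (@clinear_snd _ E V) (ccoord_lin c j)).
- move=> x; rewrite big_split_ord/=.
  under eq_bigr do rewrite (unsplitK (inl _)).
  under [in X in _ + X]eq_bigr do rewrite (unsplitK (inr _)).
  rewrite [LHS]surjective_pairing; apply: injective_projections => /=.
    rewrite !(clin_sum (@clinear_fst _ E V))/= [X in _ + X]big1 ?addr0 => [|i _].
      exact: ccoordE.
    by rewrite scaler0.
  rewrite !(clin_sum (@clinear_snd _ E V))/= [X in X + _]big1 ?add0r => [|i _].
    exact: ccoordE.
  by rewrite scaler0.
Defined.

End CoordsInstances.

Section ByCoordinates.
Context {R : realType} {E V : normedModType R} (b : coords V).
Implicit Types (f : E -> V) (x v : E).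

Lemma is_derive_bigsum (I : Type) (r : seq I) (f : I -> E -> V) x v (d : I -> V) :
  (forall i, is_derive x v (f i) (d i)) ->
  is_derive x v (fun y => \sum_(i <- r) f i y) (\sum_(i <- r) d i).
Proof.
move=> H; elim: r => [|i r IH].
  rewrite big_nil (_ : (fun y => _) = cst 0); first exact: is_derive_cst.
  by apply/funext => y; rewrite big_nil.
rewrite big_cons (_ : (fun y => _) = f i + (fun y => \sum_(i <- r) f i y)).
  exact: is_deriveD.
by apply/funext => y; rewrite big_cons.
Qed.

Lemma is_derive_coords f x v d :
  (forall i, is_derive x v (ccoord b i \o f) (ccoord b i d)) -> is_derive x v f d.
Proof.
move=> H; rewrite (ccoordE b d).
rewrite (_ : f = fun y => \sum_i (ccoord b i \o f) y *: cvec b i).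
  apply: is_derive_bigsum => i.
  exact: (is_derive_clin (clinear_scalel (cvec b i)) (H i)).
by apply/funext => y; rewrite -ccoordE.
Qed.

Lemma Ck_coords k (D : set E) f : open D ->
  (forall i, Ck k D (ccoord b i \o f)) -> Ck k D f.
Proof.
move=> oD H; rewrite (_ : f = fun y => \sum_i (ccoord b i \o f) y *: cvec b i).
  apply: Ck_sum => // i; exact: (Ck_clin_comp (clinear_scalel (cvec b i)) oD (H i)).
by apply/funext => y; rewrite -ccoordE.
Qed.

End ByCoordinates.

(** * Strict differentiability *)

Section StrictDifferentiability.
Context {R : realType} {E : normedModType R} (b : coords E).
Implicit Types (g : E -> R) (a p v : E) (D : set E).

(** Change the coordinates one at a time and apply the mean value theorem to each step. *)
Lemma increment_along_family (I : Type) (w : I -> E) (g : E -> R) (a : E) (e r0 : R) :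
  0 <= e ->
  (forall i y, `|y - a| < r0 ->
     derivable g y (w i) /\ `|'D_(w i) g y - 'D_(w i) g a| <= e) ->
  forall (r : seq I) (c : I -> R) (p : E),
    `|p - a| + \sum_(i <- r) `|c i| * `|w i| < r0 ->
    `|g (p + \sum_(i <- r) c i *: w i) - g p - \sum_(i <- r) c i * 'D_(w i) g a|
      <= e * \sum_(i <- r) `|c i|.
Proof.
move=> e0 H; elim=> [|i r IH] c p; rewrite ?(big_nil, big_cons) => pr.
  by rewrite !addr0 !subrr normr0 mulr0.
have [|t tI Et] := @MVT_line_scale _ _ g p (w i) (c i).
  move=> t /andP[t0 t1]; apply: (H i _ _).1; apply: le_lt_trans pr.
  rewrite [_ - a]addrAC; apply: le_trans (ler_normD _ _) _; rewrite lerD2l//.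
  rewrite normrZ normrM (ger0_norm t0) -mulrA; apply: ler_wpDr.
    by apply: sumr_ge0 => j _; rewrite mulr_ge0.
  by rewrite ler_piMl// mulr_ge0.
have tr : `|p + (t * c i) *: w i - a| < r0.
  move/andP: tI => [t0 t1]; apply: le_lt_trans pr.
  rewrite [_ - a]addrAC; apply: le_trans (ler_normD _ _) _; rewrite lerD2l//.
  rewrite normrZ normrM (ger0_norm t0) -mulrA; apply: ler_wpDr.
    by apply: sumr_ge0 => j _; rewrite mulr_ge0.
  by rewrite ler_piMl// mulr_ge0.
have /(IH c) IH' : `|p + c i *: w i - a| + \sum_(j <- r) `|c j| * `|w j| < r0.
  apply: le_lt_trans pr; rewrite addrA lerD2r [_ - a]addrAC -normrZ.
  exact: ler_normD.
rewrite [p + (_ + _)]addrA.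
set S := \sum_(j <- r) c j *: w j in IH' *; set T := \sum_(j <- r) _ * _ in IH' *.
have -> : g (p + c i *: w i + S) - g p - (c i * 'D_(w i) g a + T) =
  (g (p + c i *: w i + S) - g (p + c i *: w i) - T) +
  c i * ('D_(w i) g (p + (t * c i) *: w i) - 'D_(w i) g a).
  by rewrite mulrBr -Et; ring.
apply: le_trans (ler_normD _ _) _; rewrite [leRHS]mulrDr [leRHS]addrC lerD//.
by rewrite normrM mulrC ler_wpM2r//; exact: (H i _ tr).2.
Qed.

(** The estimate is uniform in the base point p near a; this strict form of
    differentiability is what makes a map with identity derivative close to the identity. *)
Lemma strict_diff g a D : open D -> D a -> Ck 1 D g ->
  forall e : R, 0 < e -> exists2 r : R, 0 < r & forall p d,
    `|p - a| + \sum_i `|ccoord b i d| * `|cvec b i| < r ->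
    `|g (p + d) - g p - \sum_i ccoord b i d * 'D_(cvec b i) g a| <=
       e * \sum_i `|ccoord b i d|.
Proof.
move=> oD Da [_ Cg] e e0.
have [r /= r0 Hr] : nbhs_ball a [set y | forall i, derivable g y (cvec b i) /\
    `|'D_(cvec b i) g y - 'D_(cvec b i) g a| <= e].
  apply/nbhs_ballP; apply: filter_forall => i.
  have [dg [cg _]] := Cg (cvec b i).
  have /cvgrPdist_le/(_ _ e0) N2 := cg a (mem_set Da).
  apply: filterS2 N2 (open_near oD Da) => y yN Dy; split.
    by apply: dg; rewrite inE.
  by rewrite distrC.
exists r => // p d prd; have := @increment_along_family _ (cvec b) g a e r (ltW e0).
move=> /(_ _ (index_enum _) (ccoord b ^~ d) p prd); rewrite -ccoordE; apply.
by move=> i y ya; apply: Hr; rewrite -ball_normE /ball_/= distrC.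
Qed.

Lemma cvg0_bound (l : E -> R) (r : R) : clinear l -> 0 < r ->
  exists2 s : R, 0 < s & forall d, `|d| < s -> `|l d| < r.
Proof.
move=> ll r0; have /cvgrPdist_lt/(_ _ r0) := ll.2 0.
rewrite (clin0 ll) => /nbhs_ballP[s /= s0 Hs]; exists s => // d ds.
have := Hs d; rewrite -ball_normE /ball_/= !sub0r !normrN; exact.
Qed.

Lemma clinear_bounded (l : E -> R) : clinear l ->
  exists2 K : R, 0 < K & forall x, `|l x| <= K * `|x|.
Proof.
move=> ll; have [s s0 Hs] := cvg0_bound ll ltr01.
exists (2 / s); first by rewrite divr_gt0.
move=> x; have [->|x0] := eqVneq x 0; first by rewrite (clin0 ll) !normr0 mulr0.
have nx : 0 < `|x| by rewrite normr_gt0.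
pose c := s / 2 / `|x|.
have c0 : 0 < c by rewrite !divr_gt0.
have := Hs (c *: x); rewrite normrZ (gtr0_norm c0) divfK ?gt_eqF// (clinZ ll).
rewrite ltr_pdivrMr// ltr_pMr// ltr1n => /(_ isT); rewrite normrM (gtr0_norm c0).
rewrite -ltr_pdivlMl// mulr1 => /ltW/le_trans; apply.
by rewrite /c !invf_div mulrC.
Qed.

Lemma coords_bounded : exists2 K : R, 0 < K & forall x,
  \sum_i `|ccoord b i x| <= K * `|x| /\
  \sum_i `|ccoord b i x| * `|cvec b i| <= K * `|x|.
Proof.
have Ki i : {K | 0 < K & forall x, `|ccoord b i x| <= K * `|x|}.
  by apply: cid2; exact: clinear_bounded (ccoord_lin b i).
pose k i := let: exist2 K _ _ := Ki i in K.
have k0 i : 0 < k i by rewrite /k; case: (Ki i).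
have kb i x : `|ccoord b i x| <= k i * `|x| by rewrite /k; case: (Ki i).
exists (1 + \sum_i k i + \sum_i k i * `|cvec b i|).
  rewrite !ltr_pwDl// sumr_ge0// => i _; first exact: ltW.
  by rewrite mulr_ge0// ltW.
move=> x; split.
  apply: (@le_trans _ _ (\sum_i k i * `|x|)); first exact: ler_sum.
  rewrite -mulr_suml ler_wpM2r// -addrA addrCA lerDl addr_ge0// sumr_ge0// => i _.
  by rewrite mulr_ge0// ltW.
apply: (@le_trans _ _ (\sum_i k i * `|cvec b i| * `|x|)).
  by apply: ler_sum => i _; rewrite mulrAC ler_wpM2r.
rewrite -mulr_suml ler_wpM2r// lerDr addr_ge0// sumr_ge0// => i _; exact: ltW.
Qed.

Lemma norm_le_coords x : `|x| <= \sum_i `|ccoord b i x| * `|cvec b i|.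
Proof.
rewrite {1}(ccoordE b x); apply: le_trans (ler_norm_sum _ _ _) _.
by apply: ler_sum => i _; rewrite normrZ.
Qed.

(** Continuous directional derivatives imply Frechet differentiability. *)
Lemma C1_first_order g a D : open D -> D a -> Ck 1 D g ->
  forall e : R, 0 < e -> exists2 r : R, 0 < r & forall d, `|d| < r ->
    `|g (a + d) - g a - \sum_i ccoord b i d * 'D_(cvec b i) g a| <= e * `|d|.
Proof.
move=> oD Da Cg e e0; have [K K0 HK] := coords_bounded.
have [r r0 Hr] := strict_diff oD Da Cg (divr_gt0 e0 K0).
exists (r / K); first by rewrite divr_gt0.
move=> d dr; apply: le_trans (Hr a d _) _.
  rewrite subrr normr0 add0r; apply: le_lt_trans (HK d).2 _.
  by rewrite mulrC -ltr_pdivlMr.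
apply: le_trans (ler_wpM2l (ltW (divr_gt0 e0 K0)) (HK d).1) _.
by rewrite mulrA divfK// gt_eqF.
Qed.

(** The first-order expansion of g is applied to the increment of f, which is O(h) because
    f is differentiable along u. *)
Lemma is_derive_chain_coords (U : normedModType R) (f : U -> E) x u w g D :
  open D -> D (f x) -> Ck 1 D g -> is_derive x u f w ->
  is_derive x u (g \o f) (\sum_i ccoord b i w * 'D_(cvec b i) g (f x)).
Proof.
move=> oD Da Cg fw.
have fw' : forall i, is_derive x u (ccoord b i \o f) (ccoord b i w).
  move=> i; exact: (is_derive_clin (ccoord_lin b i) fw).
have lin : is_derive x u (fun y => \sum_i ccoord b i (f y) * 'D_(cvec b i) g (f x))
   (\sum_i ccoord b i w * 'D_(cvec b i) g (f x)).
  apply: is_derive_bigsum => i.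
  exact: (is_derive_clin (clinear_scalel (_ : R)) (fw' i)).
apply/is_deriveP => e e0.
pose C := `|w| + 1; have C0 : 0 < C by rewrite ltr_pwDr.
have e20 : 0 < e / 2 by rewrite divr_gt0.
have [r r0 Hr] := C1_first_order oD Da Cg (divr_gt0 e20 C0).
have /is_deriveP/(_ _ ltr01)[s s0 Hs] := fw.
have /is_deriveP/(_ _ e20)[q q0 Hq] := lin.
exists (Num.min s (Num.min q (r / C))); first by rewrite !lt_min s0 q0 divr_gt0.
move=> h h0; rewrite !lt_min => /andP[hs /andP[hq hr]].
have fb : `|f (x + h *: u) - f x| <= C * `|h|.
  rewrite -[X in `|X|](subrK (h *: w)); apply: le_trans (ler_normD _ _) _.
  by rewrite normrZ addrC /C mulrDl [`|w| * _]mulrC lerD2l; exact: Hs.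
have fr : `|f (x + h *: u) - f x| < r.
  by apply: le_lt_trans fb _; rewrite mulrC -ltr_pdivlMr.
have := Hr _ fr; rewrite [f x + _]addrC subrK => B1.
have := Hq _ h0 hq => B2.
rewrite [X in `|X|](_ : _ =
  (g (f (x + h *: u)) - g (f x) - \sum_i ccoord b i (f (x + h *: u) - f x) * 'D_(cvec b i) g (f x))
  + (\sum_i ccoord b i (f (x + h *: u)) * 'D_(cvec b i) g (f x) -
     \sum_i ccoord b i (f x) * 'D_(cvec b i) g (f x) -
     h *: \sum_i ccoord b i w * 'D_(cvec b i) g (f x))); last first.
  rewrite [X in _ = _ - X + _](_ : _ =
    \sum_i ccoord b i (f (x + h *: u)) * 'D_(cvec b i) g (f x) -
    \sum_i ccoord b i (f x) * 'D_(cvec b i) g (f x)).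
    by rewrite /=; ring.
  rewrite -sumrB; apply: eq_bigr => i _.
  by rewrite (clinB (ccoord_lin b i)) mulrBl.
apply: le_trans (ler_normD _ _) _; rewrite [e]splitr mulrDl; apply: lerD => //.
apply: le_trans B1 _; rewrite -(mulrA (e / 2)) ler_wpM2l ?(ltW e20)// ler_pdivrMl//.
Qed.

End StrictDifferentiability.

(** * Chain rule and symmetry of second derivatives *)

Section ChainRule.
Context {R : realType} {E : normedModType R} (b : coords E).
Implicit Types (a v w : E) (D : set E).

Lemma derive_coords (g : E -> R) a v D : open D -> D a -> Ck 1 D g ->
  'D_v g a = \sum_i ccoord b i v * 'D_(cvec b i) g a.
Proof.
move=> oD Da Cg.
by have [_ <-] := is_derive_chain_coords b oD Da Cg (is_derive_id a v).
Qed.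

Lemma is_derive_chain (U : normedModType R) (f : U -> E) x u w (g : E -> R) D :
  open D -> D (f x) -> Ck 1 D g -> is_derive x u f w ->
  is_derive x u (g \o f) ('D_w g (f x)).
Proof.
move=> oD Da Cg fw; rewrite (derive_coords w oD Da Cg).
exact: (is_derive_chain_coords b oD Da Cg fw).
Qed.

Lemma derive_lin (g : E -> R) a (c : R) v w D : open D -> D a -> Ck 1 D g ->
  'D_(c *: v + w) g a = c * 'D_v g a + 'D_w g a.
Proof.
move=> oD Da Cg; rewrite !(derive_coords _ oD Da Cg) mulr_sumr -big_split/=.
by apply: eq_bigr => i _; rewrite (ccoord_lin b i).1 mulrDl mulrA.
Qed.

Lemma is_derive_chainV (U V : normedModType R) (c : coords V) (f : U -> E) x u w
    (g : E -> V) D :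
  open D -> D (f x) -> Ck 1 D g -> is_derive x u f w ->
  is_derive x u (g \o f) ('D_w g (f x)).
Proof.
move=> oD Da Cg fw; apply: (is_derive_coords (b := c)) => i.
have Ci := Ck_clin_comp (ccoord_lin c i) oD Cg.
have gd : is_derive (f x) w g ('D_w g (f x)).
  by apply: derivableP; exact: Ck_derivable Cg Da.
have [_ <-] := is_derive_clin (ccoord_lin c i) gd.
exact: is_derive_chain oD Da Ci fw.
Qed.

Lemma Ck_comp_scalar (U : normedModType R) k (f : U -> E) (g : E -> R) (D' : set U) D :
  open D' -> open D -> (forall x, D' x -> D (f x)) ->
  Ck k D' f -> Ck k D g -> Ck k D' (g \o f).
Proof.
move=> oD' oD fD; elim: k f g fD => [|k IH] f g fD Cf Cg.
  split=> // x; rewrite inE => D'x.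
  apply: continuous_comp; [apply: Cf.1; exact/mem_set|].
  by apply: Cg.1; exact/mem_set/fD.
have H x u : D' x -> is_derive x u (g \o f)
    (\sum_i ccoord b i ('D_u f x) * 'D_(cvec b i) g (f x)).
  move=> D'x; apply: is_derive_chain_coords oD (fD _ D'x) _ _.
    by case: Cg => cg dg; split=> // v; have [dv /Ck_cont cv] := dg v; split=> //; split.
  by apply: derivableP; exact: Ck_derivable Cf D'x.
split=> [x|u].
  rewrite inE => D'x.
  apply: continuous_comp; [apply: Cf.1; exact/mem_set|].
  by apply: Cg.1; exact/mem_set/fD.
split=> [x|]; first by rewrite inE => D'x; case: (H x u D'x).
have C : Ck k D' (fun x => \sum_i ((ccoord b i \o 'D_u f) * ('D_(cvec b i) g \o f)) x).
  apply: Ck_sum => // i; apply: Ck_mul => //.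
    exact: (Ck_clin_comp (ccoord_lin b i) oD' (Ck_derive _ Cf)).
  exact: IH fD (CkW Cf) (Ck_derive _ Cg).
apply: Ck_eq oD' _ C => x; rewrite inE => D'x.
by have [_ ->] := H x u D'x.
Qed.

Lemma Ck_comp (U V : normedModType R) (c : coords V) k (f : U -> E) (g : E -> V) (D' : set U) D :
  open D' -> open D -> (forall x, D' x -> D (f x)) ->
  Ck k D' f -> Ck k D g -> Ck k D' (g \o f).
Proof.
move=> oD' oD fD Cf Cg; apply: (Ck_coords (b := c)) => // i.
exact: (Ck_comp_scalar oD' oD fD Cf (Ck_clin_comp (ccoord_lin c i) oD Cg)).
Qed.

End ChainRule.

Section Schwarz.
Context {R : realType} {E : normedModType R}.
Implicit Types (f : E -> R) (a v w : E) (D : set E).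

Lemma is_derive_translate (V : normedModType R) (f : E -> V) x v c d :
  is_derive (x + c) v f d -> is_derive x v (fun y => f (y + c)) d.
Proof.
move=> /is_deriveP H; apply/is_deriveP => e /H[r r0 Hr]; exists r => // h h0 hr.
by rewrite [x + _ + c]addrAC; exact: Hr.
Qed.

(** Mean value theorem along v for the increment of f in the direction w, and then along w
    for the derivative of f along v. *)
Lemma second_difference f a v w D : open D -> D a -> Ck 2 D f ->
  forall e : R, 0 < e -> exists2 r : R, 0 < r & forall h, 0 < h -> h < r ->
    `|f (a + h *: v + h *: w) - f (a + h *: v) - (f (a + h *: w) - f a)
       - h ^+ 2 * 'D_w ('D_v f) a| <= e * h ^+ 2.
Proof.
move=> oD Da Cf e e0.
have /cvgrPdist_le/(_ _ e0) c2 := Ck_cont (Ck_derive w (Ck_derive v Cf)) (mem_set Da).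
have [s /= s0 Hs] : nbhs_ball a [set y | D y /\
    `|'D_w ('D_v f) a - 'D_w ('D_v f) y| <= e].
  by apply/nbhs_ballP; apply: filterS2 (open_near oD Da) c2 => y.
have N0 : 0 < `|v| + `|w| + 1 by rewrite ltr_pwDr// addr_ge0.
exists (s / (`|v| + `|w| + 1)); first by rewrite divr_gt0.
move=> h h0; rewrite ltr_pdivlMr// => hs.
have inball (p q : R) : `|p| <= 1 -> `|q| <= 1 -> ball a s (a + (p * h) *: v + (q * h) *: w).
  move=> p1 q1; rewrite -ball_normE /ball_/= -addrA opprD addNKr normrN.
  apply: le_lt_trans hs; apply: le_trans (ler_normD _ _) _.
  rewrite !normrZ !mulrDr mulr1 (gtr0_norm h0) -!mulrA -[leLHS]addr0.
  by rewrite !lerD ?(ltW h0)// ler_piMl// mulr_ge0// ltW.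
have n01 (t : R) : 0 <= t <= 1 -> `|t| <= 1 by move=> /andP[t0 t1]; rewrite ger0_norm.
have n0 : `|0 : R| <= 1 by rewrite normr0.
have n1 : `|1 : R| <= 1 by rewrite normr1.
pose G y := f (y + h *: w) - f y.
have dG (t : R) : 0 <= t <= 1 -> is_derive (a + (t * h) *: v) v G
   ('D_v f (a + (t * h) *: v + h *: w) - 'D_v f (a + (t * h) *: v)).
  move=> /n01 t1; apply: is_deriveB.
    apply: is_derive_translate; apply: derivableP.
    apply: (Ck_derivable Cf); have [] // := Hs _ (inball t 1 t1 n1).
    by rewrite mul1r.
  apply: derivableP; apply: (Ck_derivable Cf).
  by have [] := Hs _ (inball t 0 t1 n0); rewrite mul0r scale0r addr0.
have [t tI EG] := @MVT_line_scale _ _ G a v h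
  (fun t tI => @ex_derive _ _ _ _ _ _ _ (dG t tI)).
have t1 := n01 t tI.
have [t' t'I EF] := @MVT_line_scale _ _ ('D_v f) (a + (t * h) *: v) w h
  (fun t' t'I => Ck_derivable (Ck_derive _ Cf) (Hs _ (inball t t' t1 (n01 _ t'I))).1).
have -> : f (a + h *: v + h *: w) - f (a + h *: v) - (f (a + h *: w) - f a)
    = h ^+ 2 * 'D_w ('D_v f) (a + (t * h) *: v + (t' * h) *: w).
  have [_ D1] := dG t tI; move: EG; rewrite D1 EF /G => ->.
  by rewrite mulrA expr2.
rewrite -mulrBr normrM (ger0_norm (sqr_ge0 h)) [leLHS]mulrC; apply: ler_wpM2r; first exact: sqr_ge0.
by rewrite distrC; have [] := Hs _ (inball t t' t1 (n01 _ t'I)).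
Qed.

(** Both iterated derivatives approximate the same second difference, which is symmetric in
    v and w, up to o(h^2). *)
Lemma Schwarz f a v w D : open D -> D a -> Ck 2 D f ->
  'D_v ('D_w f) a = 'D_w ('D_v f) a.
Proof.
move=> oD Da Cf; apply/eqP; rewrite -subr_eq0 -normr_le0; apply/ler_addgt0Pl => e e0.
rewrite addr0; have e20 : 0 < e / 2 by rewrite divr_gt0.
have [r r0 Hr] := second_difference v w oD Da Cf e20.
have [s s0 Hs] := second_difference w v oD Da Cf e20.
pose h := Num.min r s / 2.
have m0 : 0 < Num.min r s by rewrite lt_min r0.
have h0 : 0 < h by rewrite divr_gt0.
have hm : h < Num.min r s by rewrite /h ltr_pdivrMr// ltr_pMr// ltr1n.
move: (hm); rewrite lt_min => /andP[hr hs].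
have h2 : 0 < h ^+ 2 by rewrite exprn_gt0.
have := lerD (Hr h h0 hr) (Hs h h0 hs); rewrite -mulrDl -splitr => H.
rewrite -(ler_pM2r h2); apply: le_trans H.
rewrite -[X in _ * X](ger0_norm (ltW h2)) -normrM.
rewrite [a + h *: w + h *: v]addrAC.
set A := f _; set B := f _; set C := f _.
generalize ('D_v ('D_w f) a) ('D_w ('D_v f) a) => P Q.
rewrite [X in `|X| <= _](_ : _ = (A - B - (C - f a) - h ^+ 2 * Q) -
  (A - C - (B - f a) - h ^+ 2 * P)); last by ring.
exact: ler_normB.
Qed.

End Schwarz.

Section Directions.
Context {R : realType} {E : normedModType R}.
Implicit Types (f : E -> R) (v w : E) (D : set E).

(** Regularity in one direction at a time: by [Ck_dir_add] and [Ck_dir_scale] it suffices to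
    treat the time direction and the parameter directions of a product. *)
Definition Ck_dir k D f v := (forall x, D x -> derivable f x v) /\ Ck k D ('D_v f).

Lemma Ck_of_dirs k D f : {in D, continuous f} -> (forall v, Ck_dir k D f v) ->
  Ck k.+1 D f.
Proof.
by move=> cf H; split=> // v; have [d C] := H v; split=> // x; rewrite inE; exact: d.
Qed.

Lemma Ck_dir_add k D f v w : open D ->
  Ck_dir k D f v -> Ck_dir k D f w -> Ck_dir k D f (v + w).
Proof.
move=> oD [dv Cv] [dw Cw].
have H x : D x -> is_derive x (v + w) f ('D_v f x + 'D_w f x).
  move=> Dx; apply: is_derive_add_dir.
  - by apply: filterS (open_near oD Dx) => y; exact: dv.
  - by apply: (Ck_cont Cv); exact/mem_set.
  - exact/derivableP/dw.
split=> [x /H[]//|]; apply: Ck_eq oD _ (Ck_add oD Cv Cw) => x; rewrite inE => /H[_ ->//].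
Qed.

Lemma Ck_dir_scale k D f v (c : R) : open D -> Ck_dir k D f v -> Ck_dir k D f (c *: v).
Proof.
move=> oD [dv Cv].
have H x : D x -> is_derive x (c *: v) f (c *: 'D_v f x).
  by move=> Dx; apply: is_derive_scale_dir; exact/derivableP/dv.
split=> [x /H[]//|]; apply: Ck_eq oD _ (Ck_scale c oD Cv) => x; rewrite inE => /H[_ ->//].
Qed.

End Directions.

(** * Primitives on an interval *)

Section Primitive.
Context {R : realType}.
Implicit Types (f F G g : R -> R) (s r u : R).

(** The interval ]-2, 2[ is an open neighbourhood of [0, 1], where primitives are evaluated. *)
Definition is_prim f F := F 0 = 0 /\ forall s, `|s| < 2 -> is_derive s 1 F (f s).

Lemma MVT_from_zero F f s : (forall u, `|u| <= `|s| -> is_derive u 1 F (f u)) ->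
  exists2 u, `|u| <= `|s| & F s - F 0 = s * f u.
Proof.
move=> dF.
have tb (t : R) : 0 <= t <= 1 -> `|t * s| <= `|s|.
  by move=> /andP[t0 t1]; rewrite normrM (ger0_norm t0) ler_piMl.
have E0 (c : R) : (0 : R) + c *: (1 : R) = c by rewrite add0r [_%:A]mulr1.
have dF' (t : R) : 0 <= t <= 1 -> is_derive ((0 : R) + (t * s) *: (1 : R)) 1 F (f (t * s)).
  by move=> /tb tI; rewrite E0; exact: dF.
have [t tI] := @MVT_line_scale R R F 0 1 s (fun t tI => @ex_derive _ _ _ _ _ _ _ (dF' t tI)).
rewrite E0 => ->; exists (t * s); first exact: tb.
by have [_ ->] := dF' t tI.
Qed.

Lemma is_prim_bound f F (K : R) s : is_prim f F -> `|s| < 2 ->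
  (forall u, `|u| <= `|s| -> `|f u| <= K) -> `|F s| <= K * `|s|.
Proof.
move=> [F0 dF] s2 fK; have [|u us] := @MVT_from_zero F f s.
  by move=> u us; apply: dF; exact: le_lt_trans s2.
by rewrite F0 subr0 => ->; rewrite normrM mulrC ler_wpM2r//; exact: fK.
Qed.

Lemma is_primB f g F G : is_prim f F -> is_prim g G ->
  is_prim (fun s => f s - g s) (fun s => F s - G s).
Proof.
move=> [F0 dF] [G0 dG]; split=> [|s s2]; first by rewrite F0 G0 subr0.
by apply: is_deriveB; [exact: dF|exact: dG].
Qed.

Lemma is_prim_eq f g F G s : is_prim f F -> is_prim g G ->
  (forall u, `|u| <= `|s| -> f u = g u) -> `|s| < 2 -> F s = G s.
Proof.
move=> fF gG fg s2; have := is_prim_bound (is_primB fF gG) s2 (K := 0).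
rewrite mul0r => H; apply/eqP; rewrite -subr_eq0 -normr_le0; apply: H => u us.
by rewrite fg// subrr normr0.
Qed.

Lemma prim_exists_lt f r : 0 < r -> r < 2 -> (forall s, `|s| < 2 -> {for s, continuous f}) ->
  exists F, F 0 = 0 /\ forall s, `|s| < r -> is_derive s 1 F (f s).
Proof.
move=> r0 r2 cf.
have cW : {within `[-r, r], continuous f}.
  apply: continuous_in_subspaceT => s; rewrite inE/= in_itv/= -ler_norml => sr.
  by apply: cf; exact: le_lt_trans r2.
pose F s := \int[lebesgue_measure]_(t in [set` `[-r, s]]) f t.
have FI := continuous_compact_integrable (@segment_compact _ (-r) r) cW.
exists (fun s => F s - F 0); split=> [|s sr]; first by rewrite subrr.
have [s1 s2] : -r < s /\ s < r by move: sr; rewrite ltr_norml => /andP[].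
have [|dF eF] := continuous_FTC1_closed s2 FI s1 (x := s).
  by apply: cf; exact: lt_trans sr r2.
rewrite -[f s]subr0; apply: is_deriveB.
exact: (DeriveDef dF (etrans (esym (derive1E F s)) eF)).
Qed.

(** The fundamental theorem of calculus provides primitives on ]-r, r[ for r < 2; they agree
    where they overlap and glue together. *)
Lemma prim_exists f : (forall s, `|s| < 2 -> {for s, continuous f}) ->
  exists F, is_prim f F.
Proof.
move=> cf.
have Fr r : {F | 0 < r -> r < 2 -> F 0 = 0 /\ forall s, `|s| < r -> is_derive s 1 F (f s)}.
  apply: cid; have [r0|r0] := ltP 0 r; last by exists (fun=> 0).
  have [r2|r2] := ltP r 2; last by exists (fun=> 0).
  by have [F HF] := prim_exists_lt r0 r2 cf; exists F.
pose G r := sval (Fr r).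
have GP r : 0 < r -> r < 2 -> G r 0 = 0 /\ forall s, `|s| < r -> is_derive s 1 (G r) (f s).
  exact: svalP (Fr r).
have Guniq r r' s : r < 2 -> r' < 2 -> `|s| < r -> `|s| < r' -> G r s = G r' s.
  move=> r2 r'2 sr sr'.
  have [G0 dG] := GP r (le_lt_trans (normr_ge0 _) sr) r2.
  have [G'0 dG'] := GP r' (le_lt_trans (normr_ge0 _) sr') r'2.
  pose H u := G r u - G r' u.
  have [u us|u _] := @MVT_from_zero H (fun=> 0) s.
    rewrite -(subrr (f u)); apply: is_deriveB; [apply: dG|apply: dG'];
      exact: le_lt_trans us _.
  rewrite mulr0 /H G0 G'0 subrr subr0.
  by move=> /eqP; rewrite subr_eq0 => /eqP.
(* a radius strictly between |s| and 2 *)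
pose rad s := (`|s| + 2) / 2.
have radP s : `|s| < 2 -> `|s| < rad s /\ rad s < 2.
  by move=> s2; rewrite /rad; split; [rewrite ltr_pdivlMr// mulr2n mulrDr mulr1 ltrD2l
    |rewrite ltr_pdivrMr//]; lra.
exists (fun s => G (rad s) s); split=> [|s s2].
  have z2 : `|0 : R| < 2 by rewrite normr0.
  have [h1 h2] := radP 0 z2.
  by have [] := GP (rad 0) (le_lt_trans (normr_ge0 _) h1) h2.
have [h1 h2] := radP s s2.
have [G0 dG] := GP _ (le_lt_trans (normr_ge0 _) h1) h2.
apply: near_eq_is_derive (dG _ h1).
have : \forall u \near s, `|u| < rad s.
  have : {for s, continuous (fun u : R => `|u|)} by exact: norm_continuous.
  by move=> /cvgr_lt; apply.
apply: filterS => u us; have [h3 h4] := radP u (lt_trans us h2).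
exact: Guniq.
Qed.

Definition prim f : R -> R := xget (fun=> 0) [set F | is_prim f F].

Lemma primP f : (forall s, `|s| < 2 -> {for s, continuous f}) -> is_prim f (prim f).
Proof. by move=> /prim_exists[F HF]; exact: (xgetPex (fun=> 0) (ex_intro _ F HF)). Qed.

(** The tube lemma. Uniformity in u is what allows limits in th under the integral sign. *)
Lemma segment_uniform (T : topologicalType) (th0 : T) (Q : R -> T -> Prop) (b : R) :
  (forall u, `|u| <= b -> \forall z \near (u, th0), Q z.1 z.2) ->
  \forall th \near th0, forall u, `|u| <= b -> Q u th.
Proof.
move=> H; have /compact_near_coveringP C := @segment_compact R (-b) b.
have HC : forall u : R, `[- b, b]%classic u -> \forall u' \near u & th \near th0, Q u' th.
  by move=> u /=; rewrite in_itv/= -ler_norml => /H.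
apply: filterS (C T (nbhs th0) (fun th u => Q u th) _ HC) => th Hth u ub.
by apply: Hth => /=; rewrite in_itv/= -ler_norml.
Qed.

Lemma prim_param_cvg (T : topologicalType) (th0 : T) (Phi : R * T -> R)
    (F : R -> T -> R) (b e : R) :
  (forall s, `|s| < 2 -> {for (s, th0), continuous Phi}) ->
  (\forall th \near th0, is_prim (fun s => Phi (s, th)) (F ^~ th)) ->
  b < 2 -> 0 < e ->
  \forall th \near th0, forall s, `|s| <= b -> `|F s th - F s th0| <= e.
Proof.
move=> cPhi nF b2 e0; have e40 : 0 < e / 2 / 2 by rewrite !divr_gt0.
have U : \forall th \near th0, forall u, `|u| <= b ->
    `|Phi (u, th) - Phi (u, th0)| <= e / 2.
  apply: segment_uniform => u ub.
  have /cvgrPdist_le/(_ _ e40) := cPhi u (le_lt_trans ub b2).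
  move=> [[A B] [Au Bt] AB].
  exists (A, B) => //= -[u' th] [Au' Bth].
  have H1 := AB (u', th) (conj Au' Bth).
  have H2 := AB (u', th0) (conj Au' (nbhs_singleton Bt)).
  rewrite -(subrKA (Phi (u, th0))) [e / 2]splitr; apply: le_trans (ler_normD _ _) _.
  by rewrite lerD// distrC.
have F0 := nbhs_singleton nF.
apply: filterS2 U nF => th Uth Fth s sb.
have s2 := le_lt_trans sb b2.
apply: le_trans (is_prim_bound (K := e / 2) (is_primB Fth F0) s2 _) _.
  by move=> u us; apply: Uth; exact: le_trans sb.
by rewrite -[leRHS](@divfK _ 2) ?pnatr_eq0// ler_wpM2l ?ltW// divr_gt0.
Qed.

End Primitive.

(** * Primitives depending on a parameter *)

Section Slices.
Context {R : realType} {E V : normedModType R}.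
Implicit Types (f : R * E -> V) (s : R) (e w : E).

Lemma is_derive_slice1 f s e d :
  is_derive s 1 (fun u => f (u, e)) d <-> is_derive ((s, e) : R * E) ((1, 0) : R * E) f d.
Proof.
have X (h : R) : ((s, e) : R * E) + h *: ((1, 0) : R * E) = (s + h *: (1 : R), e).
  by congr pair; rewrite /= ?scaler0 ?addr0.
by split=> /is_deriveP H; apply/is_deriveP => p /H[r r0 Hr]; exists r => // h h0 hr;
  have := Hr h h0 hr; rewrite X.
Qed.

Lemma is_derive_slice2 f s e w d :
  is_derive e w (fun y => f (s, y)) d <-> is_derive ((s, e) : R * E) ((0, w) : R * E) f d.
Proof.
have X (h : R) : ((s, e) : R * E) + h *: ((0, w) : R * E) = (s, e + h *: w).
  by congr pair; rewrite /= ?scaler0 ?addr0.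
by split=> /is_deriveP H; apply/is_deriveP => p /H[r r0 Hr]; exists r => // h h0 hr;
  have := Hr h h0 hr; rewrite X.
Qed.

Lemma direction_split (v : R * E) : v = v.1 *: ((1, 0) : R * E) + (0, v.2).
Proof.
case: v => a w; congr pair; rewrite /= ?scaler0 ?add0r ?addr0//.
by rewrite [_ *: _]mulr1.
Qed.

End Slices.

Section ParametricPrimitive.
Context {R : realType} {E : normedModType R}.
Variable D : set E.
Hypothesis oD : open D.
Implicit Types (f g : R * E -> R) (s u h : R) (e w : E) (z : R * E).

Definition cylinder : set (R * E) := [set z | `|z.1| < 2 /\ D z.2].
Local Notation Om := cylinder.

Lemma open_cylinder : open Om.
Proof.
have -> : Om = (fun z : R * E => `|z.1|) @^-1` [set x : R | x < 2] `&` snd @^-1` D by [].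
apply: openI; last by apply: open_comp => // z _; exact: cvg_snd.
apply: open_comp; last exact: open_lt.
move=> z _; apply: (@continuous_comp _ _ _ fst (fun x : R => `|x|)); first exact: cvg_fst.
exact: norm_continuous.
Qed.

(** The integral of f (u, z.2) over u from 0 to z.1. *)
Definition pint f z : R := prim (fun u => f (u, z.2)) z.1.

Lemma slice_cont f s e : {for ((s, e) : R * E), continuous f} ->
  {for s, continuous (fun u => f (u, e))}.
Proof.
move=> cf; apply: (@continuous_comp _ _ _ (fun u : R => (u, e)) f) => //.
have H : (fun u : R => (u, e)) x @[x --> s] --> (s, e).
  exact: (@cvg_pair R R E (nbhs s) (nbhs s) (nbhs e) _ _ _ id (fun=> e) cvg_id (cvg_cst e)).
exact: H.
Qed.

Lemma pint_prim f e : {in Om, continuous f} -> D e ->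
  is_prim (fun u => f (u, e)) (fun s => pint f (s, e)).
Proof.
by move=> cf De; apply: primP => s s2; apply: slice_cont; apply: cf; exact/mem_set.
Qed.

Lemma pint0 f e : {in Om, continuous f} -> D e -> pint f (0, e) = 0.
Proof. by move=> cf De; have [] := pint_prim cf De. Qed.

Lemma pint_ds f s e : {in Om, continuous f} -> D e -> `|s| < 2 ->
  is_derive ((s, e) : R * E) ((1, 0) : R * E) (pint f) (f (s, e)).
Proof. by move=> cf De s2; apply/is_derive_slice1; have [_] := pint_prim cf De; apply. Qed.

Lemma pint_bound f s e (K : R) : {in Om, continuous f} -> D e -> `|s| < 2 ->
  (forall u, `|u| < 2 -> `|f (u, e)| <= K) -> `|pint f (s, e)| <= K * 2.
Proof.
move=> cf De s2 fK; apply: le_trans (is_prim_bound (pint_prim cf De) s2 (K := K) _) _.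
  by move=> u us; apply: fK; exact: le_lt_trans s2.
apply: ler_wpM2l; last exact: ltW.
apply: le_trans (normr_ge0 _) (fK 0 _); by rewrite normr0.
Qed.

Lemma pint_sub f g s e : {in Om, continuous f} -> {in Om, continuous g} -> D e -> `|s| < 2 ->
  pint f (s, e) - pint g (s, e) = pint (f - g) (s, e).
Proof.
move=> cf cg De s2.
apply: (is_prim_eq (is_primB (pint_prim cf De) (pint_prim cg De)) (pint_prim (f := f - g) _ De)) => // z zO.
by apply: continuousB; [exact: cf|exact: cg].
Qed.

(** Continuity in e is uniform in s by compactness; together with continuity in s for a fixed
    e this gives joint continuity. *)
Lemma prim_joint_continuous (F f : R * E -> R) :
  {in Om, continuous f} ->
  (forall e, D e -> is_prim (fun u => f (u, e)) (fun u => F (u, e))) ->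
  {in Om, continuous F}.
Proof.
move=> cf pF [s e]; rewrite inE => -[/= s2 De]; apply/cvgrPdist_le => p p0.
have p20 : 0 < p / 2 by rewrite divr_gt0.
pose b := (`|s| + 2) / 2.
have sb : `|s| < b by rewrite /b ltr_pdivlMr//; move: s2; lra.
have b2 : b < 2 by rewrite /b ltr_pdivrMr//; move: s2; lra.
have U : \forall y \near e, forall u : R, `|u| <= b -> `|F (u, y) - F (u, e)| <= p / 2.
  apply: (@prim_param_cvg _ _ e f (fun u y => F (u, y)) b) => //.
    by move=> u u2; apply: cf; exact/mem_set.
  by apply: filterS (open_near oD De) => y; exact: pF.
have [_ dF] := pF e De.
have cF : {for s, continuous (fun u => F (u, e))}.
  by apply/differentiable_continuous/derivable1_diffP; case: (dF s s2).
have /cvgrPdist_le/(_ _ p20) N1 := cF.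
have N2 : \forall u \near s, `|u| < b.
  have : {for s, continuous (fun u : R => `|u|)} by exact: norm_continuous.
  by move=> /cvgr_lt; apply.
have N12 : \forall u \near s, `|u| < b /\ `|F (s, e) - F (u, e)| <= p / 2.
  by apply: filterS2 N1 N2.
exists ([set u | `|u| < b /\ `|F (s, e) - F (u, e)| <= p / 2],
        [set y | forall u : R, `|u| <= b -> `|F (u, y) - F (u, e)| <= p / 2]) => //.
move=> [u y] /= [[ub H1] H2].
rewrite -(subrKA (F (u, e))) [p]splitr; apply: le_trans (ler_normD _ _) _.
by rewrite lerD// distrC; apply: H2; exact: ltW.
Qed.

Lemma pint_cont f : {in Om, continuous f} -> {in Om, continuous (pint f)}.
Proof. by move=> cf; apply: (prim_joint_continuous cf) => e; exact: pint_prim. Qed.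

(** The difference quotient of f in the parameter direction w, as a function of the time and
    of the increment h, extended to h = 0 by the derivative. *)
Definition divdiff f e w (z : R * R) : R :=
  if z.2 == 0 then 'D_((0, w) : R * E) f (z.1, e)
  else z.2^-1 * (f (z.1, e + z.2 *: w) - f (z.1, e)).

(** By the mean value theorem the quotient is a value of the derivative at a nearby point. *)
Lemma divdiff_cont f e w u : Ck 1 Om f -> D e -> `|u| < 2 ->
  {for ((u, 0) : R * R), continuous (divdiff f e w)}.
Proof.
move=> Cf De u2; have Oue : Om (u, e) by [].
have cd := Ck_cont (Ck_derive (0, w) Cf) (mem_set Oue).
apply/cvgrPdist_le => p p0.
have E0 : divdiff f e w (u, 0) = 'D_((0, w) : R * E) f (u, e) by rewrite /divdiff/= eqxx.
have /cvgrPdist_le/(_ _ p0) N1 := cd.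
have [r /= r0 Hr] : nbhs_ball ((u, e) : R * E) [set y | Om y /\
    `|'D_((0, w) : R * E) f (u, e) - 'D_((0, w) : R * E) f y| <= p].
  by apply/nbhs_ballP; apply: filterS2 (open_near open_cylinder Oue) N1 => y.
pose q := r / (`|w| + 1).
have N0 : 0 < `|w| + 1 by rewrite ltr_pwDr.
have q0 : 0 < q by rewrite divr_gt0.
have inball (u' h : R) : `|u' - u| < r -> `|h| < q -> ball ((u, e) : R * E) r (u', e + h *: w).
  move=> ur hq; split=> /=; rewrite -ball_normE /ball_/=; first by rewrite distrC.
  rewrite opprD addNKr normrN normrZ; apply: le_lt_trans (_ : `|h| * (`|w| + 1) < _).
    by rewrite ler_wpM2l// lerDl.
  by rewrite -ltr_pdivlMr.
exists (ball u r, ball (0 : R) q) => /=.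
  by split; apply: nbhsx_ballx.
move=> [u' h] /= []; rewrite -!ball_normE /ball_/= sub0r normrN => ur hq.
rewrite distrC in ur; rewrite E0 /divdiff/=; case: eqP => [h0|/eqP h0].
  have := inball u' 0 ur; rewrite normr0 => /(_ q0) /Hr[_].
  by rewrite scale0r addr0.
have D1 (t : R) : 0 <= t <= 1 -> ball ((u, e) : R * E) r
     ((u', e) + (t * h) *: ((0, w) : R * E)).
  move=> /andP[t0 t1].
  have -> : ((u', e) : R * E) + (t * h) *: ((0, w) : R * E) = (u', e + (t * h) *: w).
    by congr pair; rewrite /= ?scaler0 ?addr0.
  apply: inball => //; apply: le_lt_trans hq.
  by rewrite normrM (ger0_norm t0) ler_piMl.
have [t tI] := @MVT_line_scale _ _ f (u', e) (0, w) h
  (fun t tI => Ck_derivable Cf (Hr _ (D1 t tI)).1).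
have -> : ((u', e) : R * E) + h *: ((0, w) : R * E) = (u', e + h *: w).
  by congr pair; rewrite /= ?scaler0 ?addr0.
move=> ->; rewrite mulKf//; by have [] := Hr _ (D1 t tI).
Qed.

Lemma is_prim_divdiff f e w h : Ck 1 Om f -> D e -> D (e + h *: w) ->
  is_prim (fun s => divdiff f e w (s, h))
    (fun s => if h == 0 then pint ('D_((0, w) : R * E) f) (s, e)
              else h^-1 * (pint f (s, e + h *: w) - pint f (s, e))).
Proof.
move=> Cf De Dh; rewrite /divdiff/=; case: eqP => [h0|/eqP h0].
  by apply: pint_prim => //; exact: Ck_cont (Ck_derive (0, w) Cf).
have [F0 dF] := is_primB (pint_prim (Ck_cont Cf) Dh) (pint_prim (Ck_cont Cf) De).
split; first by rewrite F0 mulr0.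
by move=> s s2; exact: (is_deriveZ _ (dF s s2)).
Qed.

Lemma cvg_is_derive_param (F : R * E -> R) s e w d (Q : R -> R) :
  (forall h : R, h != 0 -> Q h = h^-1 * (F (s, e + h *: w) - F (s, e))) ->
  (forall p : R, 0 < p -> \forall h \near (0 : R), `|Q h - d| <= p) ->
  is_derive ((s, e) : R * E) ((0, w) : R * E) F d.
Proof.
move=> QE HQ; apply/is_derive_slice2/is_deriveP => p p0.
have /nbhs_ballP[r /= r0 Hr] := HQ p p0.
exists r => // h h0 hr; have hn : h != 0 by rewrite -normr_gt0.
have := Hr h; rewrite -ball_normE /ball_/= sub0r normrN => /(_ hr).
rewrite QE// => H.
have -> : F (s, e + h *: w) - F (s, e) - h *: d =
    h * (h^-1 * (F (s, e + h *: w) - F (s, e)) - d).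
  by rewrite mulrBr mulVKf.
by rewrite normrM mulrC ler_wpM2r.
Qed.

(** Differentiation under the integral sign. The difference quotients of the integral are the
    integrals of [divdiff], which is jointly continuous up to h = 0. *)
Lemma pint_dw f s e w : Ck 1 Om f -> D e -> `|s| < 2 ->
  is_derive ((s, e) : R * E) ((0, w) : R * E) (pint f) (pint ('D_((0, w) : R * E) f) (s, e)).
Proof.
move=> Cf De s2.
pose F u h := if h == 0 then pint ('D_((0, w) : R * E) f) (u, e)
              else h^-1 * (pint f (u, e + h *: w) - pint f (u, e)).
apply: (@cvg_is_derive_param _ _ _ _ _ (F s)) => [h h0|p p0].
  by rewrite /F (negbTE h0).
have nD : \forall h \near (0 : R), D (e + h *: w).
  have : {for (0 : R), continuous (fun h : R => e + h *: w)}.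
    by apply: continuousD; [exact: cvg_cst|exact: scalel_continuous].
  by apply; rewrite /= scale0r addr0; exact: open_near.
have := @prim_param_cvg _ _ (0 : R) (divdiff f e w) F `|s| p _ _ s2 p0.
have F0 : F s 0 = pint ('D_((0, w) : R * E) f) (s, e) by rewrite /F eqxx.
move=> H; rewrite -F0; apply: filterS (H _ _) => [h|u u2|]; first by apply.
  exact: divdiff_cont.
by apply: filterS nD => h; exact: is_prim_divdiff.
Qed.

(** The derivative in time is f itself, and the one along a parameter direction is the integral
    of a derivative of f, so that induction on k applies. *)
Lemma Ck_pint k f : Ck k Om f -> Ck k Om (pint f).
Proof.
elim: k f => [|k IH] f Cf; first by split=> //; exact: pint_cont (Ck_cont Cf).
have Cf1 : Ck 1 Om f.
  split; first exact: Ck_cont Cf.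
  by move=> v; have [df Cd] := Cf.2 v; split=> //; split=> //; exact: Ck_cont Cd.
apply: Ck_of_dirs; first exact: pint_cont (Ck_cont Cf).
move=> v; rewrite (direction_split v).
apply: Ck_dir_add; first exact: open_cylinder.
  apply: Ck_dir_scale; first exact: open_cylinder.
  have H z : Om z -> is_derive z ((1, 0) : R * E) (pint f) (f z).
    by case: z => s e [s2 De]; exact: pint_ds (Ck_cont Cf) De s2.
  split=> [z /H[]//|]; apply: Ck_eq open_cylinder _ (CkW Cf) => z.
  by rewrite inE => /H[_ ->].
have H z : Om z -> is_derive z ((0, v.2) : R * E) (pint f) (pint ('D_((0, v.2) : R * E) f) z).
  by case: z => s e [s2 De]; exact: pint_dw.
split=> [z /H[]//|].
apply: Ck_eq open_cylinder _ (IH _ (Ck_derive (0, v.2) Cf)) => z.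
by rewrite inE => /H[_ ->].
Qed.

End ParametricPrimitive.

(** * Matrix-valued functions *)

Section MatrixCalculus.
Context {R : realType} {E : normedModType R}.

Definition MCk k (D : set E) m n (P : E -> 'M[R]_(m, n)) :=
  forall i j, Ck k D (fun z => P z i j).

Definition mderive m n (x v : E) (P : E -> 'M[R]_(m, n)) (d : 'M[R]_(m, n)) :=
  forall i j, is_derive x v (fun z => P z i j) (d i j).

Definition dM m n (v : E) (P : E -> 'M[R]_(m, n)) (x : E) : 'M[R]_(m, n) :=
  \matrix_(i, j) 'D_v (fun z => P z i j) x.

Lemma MCk_mul k D m n p (P : E -> 'M[R]_(m, n)) (Q : E -> 'M[R]_(n, p)) :
  open D -> MCk k D P -> MCk k D Q -> MCk k D (fun z => P z *m Q z).
Proof.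
move=> oD CP CQ i j.
have -> : (fun z => (P z *m Q z) i j) =
    (fun z => \sum_l ((fun y => P y i l) * (fun y => Q y l j)) z).
  by apply/funext => z; rewrite mxE.
by apply: Ck_sum => // l; exact: Ck_mul.
Qed.

Lemma MCk_cst k D m n (P : 'M[R]_(m, n)) : MCk k D (fun=> P).
Proof. by move=> i j; exact: Ck_cst. Qed.

Lemma MCk_add k D m n (P Q : E -> 'M[R]_(m, n)) :
  open D -> MCk k D P -> MCk k D Q -> MCk k D (fun z => P z + Q z).
Proof.
move=> oD CP CQ i j; rewrite (_ : (fun z => _) = (fun z => P z i j) + (fun z => Q z i j)).
  exact: Ck_add.
by apply/funext => z; rewrite mxE.
Qed.

Lemma MCk_opp k D m n (P : E -> 'M[R]_(m, n)) :
  open D -> MCk k D P -> MCk k D (fun z => - P z).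
Proof.
move=> oD CP i j; rewrite (_ : (fun z => _) = (-1) \*: (fun z => P z i j)).
  exact: Ck_scale.
by apply/funext => z; rewrite mxE /= /GRing.scale/= mulN1r.
Qed.

Lemma MCk_tr k D m n (P : E -> 'M[R]_(m, n)) :
  MCk k D P -> MCk k D (fun z => (P z)^T).
Proof.
move=> CP i j; rewrite (_ : (fun z => _) = (fun z => P z j i))//.
by apply/funext => z; rewrite mxE.
Qed.

Lemma MCk_dM k D m n (P : E -> 'M[R]_(m, n)) v : MCk k.+1 D P -> MCk k D (dM v P).
Proof.
move=> CP i j; rewrite (_ : (fun z => _) = 'D_v (fun z => P z i j)).
  exact: Ck_derive.
by apply/funext => z; rewrite mxE.
Qed.

Lemma MCk_mderive k D m n (P : E -> 'M[R]_(m, n)) v x :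
  MCk k.+1 D P -> D x -> mderive x v P (dM v P x).
Proof.
by move=> CP Dx i j; rewrite mxE; apply: derivableP; exact: Ck_derivable (CP i j) Dx.
Qed.

Lemma mderive_dM m n (P : E -> 'M[R]_(m, n)) x v d : mderive x v P d -> dM v P x = d.
Proof. by move=> H; apply/matrixP => i j; rewrite mxE; case: (H i j). Qed.

Lemma MCk_eq k D m n (P Q : E -> 'M[R]_(m, n)) : open D ->
  (forall z, D z -> P z = Q z) -> MCk k D P -> MCk k D Q.
Proof.
move=> oD PQ CP i j; apply: Ck_eq (CP i j) => // z; rewrite inE => Dz.
by rewrite PQ.
Qed.

Lemma mderive_eq D m n (P Q : E -> 'M[R]_(m, n)) x v d : open D -> D x ->
  (forall z, D z -> P z = Q z) -> mderive x v P d -> mderive x v Q d.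
Proof.
move=> oD Dx PQ H i j; apply: near_eq_is_derive (H i j).
by apply: filterS (open_near oD Dx) => y /PQ ->.
Qed.

Lemma mderive_mul m n p (P : E -> 'M[R]_(m, n)) (Q : E -> 'M[R]_(n, p)) x v dP dQ :
  mderive x v P dP -> mderive x v Q dQ ->
  mderive x v (fun z => P z *m Q z) (dP *m Q x + P x *m dQ).
Proof.
move=> HP HQ i j.
have -> : (fun z => (P z *m Q z) i j) =
    (fun z => \sum_l ((fun y => P y i l) * (fun y => Q y l j)) z).
  by apply/funext => z; rewrite mxE.
rewrite !mxE -big_split/=; apply: is_derive_bigsum => l.
apply: is_derive_eq; first exact: is_deriveM (HP i l) (HQ l j).
by rewrite /GRing.scale/=; ring.
Qed.

Lemma mderive_add m n (P Q : E -> 'M[R]_(m, n)) x v dP dQ :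
  mderive x v P dP -> mderive x v Q dQ ->
  mderive x v (fun z => P z + Q z) (dP + dQ).
Proof.
move=> HP HQ i j; rewrite mxE (_ : (fun z => _) = (fun z => P z i j) + (fun z => Q z i j)).
  exact: is_deriveD.
by apply/funext => z; rewrite mxE.
Qed.

Lemma mderive_opp m n (P : E -> 'M[R]_(m, n)) x v dP :
  mderive x v P dP -> mderive x v (fun z => - P z) (- dP).
Proof.
move=> HP i j; rewrite mxE (_ : (fun z => _) = - (fun z => P z i j)).
  exact: is_deriveN.
by apply/funext => z; rewrite mxE.
Qed.

Lemma mderive_cst m n (P : 'M[R]_(m, n)) x v : mderive x v (fun=> P) 0.
Proof. by move=> i j; rewrite mxE; exact: is_derive_cst. Qed.

Lemma mderive_tr m n (P : E -> 'M[R]_(m, n)) x v dP :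
  mderive x v P dP -> mderive x v (fun z => (P z)^T) dP^T.
Proof.
move=> HP i j; rewrite mxE (_ : (fun z => _) = (fun z => P z j i))//.
by apply/funext => z; rewrite mxE.
Qed.

Lemma mderive_scale m n (f : E -> R) (P : E -> 'M[R]_(m, n)) x v df dP :
  is_derive x v f df -> mderive x v P dP ->
  mderive x v (fun z => f z *: P z) (df *: P x + f x *: dP).
Proof.
move=> Hf HP i j; rewrite !mxE (_ : (fun z => _) = f * (fun z => P z i j)).
  apply: is_derive_eq; first exact: is_deriveM Hf (HP i j).
  by rewrite /GRing.scale/=; ring.
by apply/funext => z; rewrite mxE.
Qed.

Lemma MCk_sub k D D' m n (P : E -> 'M[R]_(m, n)) :
  D' `<=` D -> MCk k D P -> MCk k D' P.
Proof. by move=> s CP i j; exact: Ck_sub s (CP i j). Qed.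

Lemma MCk_scale k D m n (c : R) (P : E -> 'M[R]_(m, n)) : open D ->
  MCk k D P -> MCk k D (fun z => c *: P z).
Proof.
move=> oD CP i j; rewrite (_ : (fun z => _) = c \*: (fun z => P z i j)).
  exact: Ck_scale.
by apply/funext => z; rewrite mxE.
Qed.

Lemma MCk_sum k D m n (I : Type) (r : seq I) (P : I -> E -> 'M[R]_(m, n)) :
  open D -> (forall i, MCk k D (P i)) -> MCk k D (fun z => \sum_(i <- r) P i z).
Proof.
move=> oD CP i j; rewrite (_ : (fun z => _) = fun z => \sum_(l <- r) P l z i j).
  by apply: Ck_sum => // l; exact: CP.
by apply/funext => z; rewrite summxE.
Qed.

Lemma mderive_sum m n (I : Type) (r : seq I) (P : I -> E -> 'M[R]_(m, n)) x v d :
  (forall i, mderive x v (P i) (d i)) ->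
  mderive x v (fun y => \sum_(i <- r) P i y) (\sum_(i <- r) d i).
Proof.
move=> H i j; rewrite summxE (_ : (fun z => _) = fun z => \sum_(l <- r) P l z i j).
  by apply: is_derive_bigsum => l; exact: H.
by apply/funext => z; rewrite summxE.
Qed.

Lemma Schwarz_mx D m n (P : E -> 'M[R]_(m, n)) v w z : open D -> D z ->
  MCk 2 D P -> dM v (dM w P) z = dM w (dM v P) z.
Proof.
move=> oD Dz CP; apply/matrixP => i j; rewrite [LHS]mxE [RHS]mxE.
have X u : (fun y => dM u P y i j) = 'D_u (fun y => P y i j).
  by apply/funext => y; rewrite mxE.
apply: (etrans (congr1 (fun f => 'D_v f z) (X w))).
apply: (etrans _ (congr1 (fun f => 'D_w f z) (esym (X v)))).
exact: (Schwarz v w oD Dz (CP i j)).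
Qed.

Lemma dM_lin (b : coords E) D m n (P : E -> 'M[R]_(m, n)) a v w x : open D -> D x ->
  MCk 1 D P -> dM (a *: v + w) P x = a *: dM v P x + dM w P x.
Proof.
move=> oD Dx CP; apply/matrixP => i j; rewrite [RHS]mxE [X in _ = X + _]mxE.
rewrite [LHS]mxE [X in _ = _ * X + _]mxE [X in _ = _ + X]mxE.
exact: (derive_lin b a v w oD Dx (CP i j)).
Qed.

Lemma Ck_row k D n (f : E -> 'cV[R]_n) : open D -> MCk k D f ->
  Ck k D (fun e => (f e)^T).
Proof.
move=> oD Cf; apply: (Ck_coords (b := coords_rV n)) => // j.
by rewrite (_ : _ \o _ = fun e => f e j 0); [exact: Cf|apply/funext => e; rewrite /= mxE].
Qed.

Lemma is_derive_row n (x v : E) (f : E -> 'cV[R]_n) d :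
  mderive x v f d -> is_derive x v (fun e => (f e)^T) d^T.
Proof.
move=> H; apply: (is_derive_coords (b := coords_rV n)) => j /=.
rewrite [X in is_derive _ _ X _](_ : _ = fun z => f z j 0).
  by rewrite [X in is_derive _ _ _ X]mxE; exact: H.
by apply/funext => z; rewrite /= mxE.
Qed.

Lemma mderive_of_row n (x v : E) (f : E -> 'rV[R]_n) d :
  is_derive x v f d -> mderive x v f d.
Proof.
move=> H i j; rewrite ord1.
exact: (is_derive_clin (ccoord_lin (coords_rV n) j) H).
Qed.

End MatrixCalculus.

Lemma mderive_chain {R : realType} {E F : normedModType R} (b : coords E) (U : set E)
    m n (f : F -> E) (P : E -> 'M[R]_(m, n)) x u w : open U -> U (f x) ->
  MCk 1 U P -> is_derive x u f w -> mderive x u (fun z => P (f z)) (dM w P (f x)).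
Proof.
by move=> oU Ufx CP fw i j; rewrite mxE; exact: (is_derive_chain b oU Ufx (CP i j) fw).
Qed.

(** The numbers a N - 2 * 2^-N increase, the numbers a N + 2 * 2^-N decrease, and the supremum of
    the former lies between them. *)
Lemma geometric_limit {R : realType} (a : nat -> R) :
  (forall N, `|a N.+1 - a N| <= 2^-1 ^+ N) ->
  exists l : R, forall N, `|l - a N| <= 2 * 2^-1 ^+ N.
Proof.
move=> H.
pose lo N := a N - 2 * 2^-1 ^+ N; pose up N := a N + 2 * 2^-1 ^+ N.
have E2 N : 2 * (2^-1 : R) ^+ N.+1 = 2^-1 ^+ N by rewrite exprS mulVKf.
have loS N : lo N <= lo N.+1.
  rewrite /lo E2; have := H N; rewrite ler_norml => /andP[h _].
  move: h; move: (2^-1 ^+ N) => p; lra.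
have upS N : up N.+1 <= up N.
  rewrite /up E2; have := H N; rewrite ler_norml => /andP[_ h].
  move: h; move: (2^-1 ^+ N) => p; lra.
have lo_nd : {homo lo : x y / (x <= y)%N >-> x <= y} by apply: homo_leq => //; exact: le_trans.
have up_ni : {homo up : x y / (x <= y)%N >-> y <= x}.
  by apply: homo_leq => // y x z xy yz; exact: le_trans yz xy.
have loup N : lo N <= up N.
  by rewrite /lo /up lerD2l ge0_cp// ?mulr_ge0// exprn_ge0// invr_ge0.
have lu N M : lo N <= up M.
  apply: le_trans (lo_nd N (maxn N M) (leq_maxl _ _)) _.
  by apply: le_trans (loup _) (up_ni M _ (leq_maxr _ _)).
have hs : has_sup (range lo).
  by split; [exists (lo 0%N); exists 0%N|exists (up 0%N) => _ [N _ <-]].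
exists (sup (range lo)) => N.
have h1 : lo N <= sup (range lo) by apply: sup_upper_bound => //; exists N.
have h2 : sup (range lo) <= up N by apply: ge_sup => [|_ [M _ <-]//]; exists (lo 0%N); exists 0%N.
rewrite ler_norml; move: h1 h2; rewrite /lo /up; move: (2 * 2^-1 ^+ N) => p.
by move=> h1 h2; apply/andP; split; lra.
Qed.

Lemma half_pow_small {R : realType} (e : R) : 0 < e -> exists N, 2^-1 ^+ N <= e.
Proof.
move=> e0; have [N HN] : exists N : nat, e^-1 < N%:R.
  by exists (Num.trunc e^-1).+1; exact: Num.Theory.truncnS_gt.
exists N; rewrite exprVn invf_ple ?posrE// ?exprn_gt0//.
by apply: le_trans (ltW HN) _; rewrite -natrX ler_nat ltnW// ltn_expl.
Qed.

(** * Linear differential equations *)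

Section LinearODE.
Context {R : realType} {E : normedModType R}.
Variable D : set E.
Hypothesis oD : open D.
Variable m : nat.
Implicit Types (P Q Y G : R * E -> 'M[R]_m) (z : R * E).
Local Notation Om := (cylinder D).
Local Notation ds := ((1, 0) : R * E).
Local Notation dpar w := ((0, w) : R * E).

Definition pint_mx n1 n2 (P : R * E -> 'M[R]_(n1, n2)) z : 'M[R]_(n1, n2) :=
  \matrix_(i, j) pint (fun y => P y i j) z.

Lemma MCk_cont k n1 n2 (P : R * E -> 'M[R]_(n1, n2)) : MCk k Om P ->
  forall i j, {in Om, continuous (fun z => P z i j)}.
Proof. by move=> CP i j; exact: Ck_cont (CP i j). Qed.
Arguments MCk_cont {k n1 n2 P} _ i j.

Lemma MCk_pint_mx k n1 n2 (P : R * E -> 'M[R]_(n1, n2)) : MCk k Om P -> MCk k Om (pint_mx P).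
Proof.
move=> CP i j; rewrite (_ : (fun z => _) = pint (fun y => P y i j)).
  exact: Ck_pint.
by apply/funext => z; rewrite mxE.
Qed.

Lemma pint_mx0 k n1 n2 (P : R * E -> 'M[R]_(n1, n2)) e : MCk k Om P -> D e -> pint_mx P (0, e) = 0.
Proof.
move=> CP De; apply/matrixP => i j; rewrite !mxE.
exact: (pint0 (MCk_cont CP i j) De).
Qed.

Lemma pint_mx_ds k n1 n2 (P : R * E -> 'M[R]_(n1, n2)) s e :
  MCk k Om P -> D e -> `|s| < 2 -> mderive (s, e) ds (pint_mx P) (P (s, e)).
Proof.
move=> CP De s2 i j; rewrite (_ : (fun z => _) = pint (fun y => P y i j)).
  exact: (pint_ds (MCk_cont CP i j)).
by apply/funext => z; rewrite mxE.
Qed.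

Lemma mulmx_bound (A B : 'M[R]_m) (a c : R) : 0 <= a ->
  (forall i j, `|A i j| <= a) -> (forall i j, `|B i j| <= c) ->
  forall i j, `|(A *m B) i j| <= a * (c * m%:R).
Proof.
move=> a0 HA HB i j; rewrite mxE; apply: le_trans (ler_norm_sum _ _ _) _.
apply: (@le_trans _ _ (\sum_(l < m) a * c)).
  by apply: ler_sum => l _; rewrite normrM ler_pM.
by rewrite sumr_const card_ord -[leLHS]mulr_natr -mulrA.
Qed.

(** The time interval has half-length 2 and the entries of G are at most kappa, so the integral
    is at most 2 m kappa a, and 4 m kappa is at most 1. *)
Lemma picard_step G (kappa : R) P Q (a : R) : 0 <= a ->
  MCk 0 Om G -> kappa * m%:R * 4 <= 1 ->
  (forall z i j, Om z -> `|G z i j| <= kappa) ->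
  MCk 0 Om P -> MCk 0 Om Q ->
  (forall z i j, Om z -> `|(P z - Q z) i j| <= a) ->
  forall z i j, Om z ->
  `|(pint_mx (fun y => P y *m G y) z - pint_mx (fun y => Q y *m G y) z) i j| <= 2^-1 * a.
Proof.
move=> a0 CG km Gk CP CQ PQ [s e] i j [/= s2 De]; rewrite !mxE.
have CPG := MCk_mul (open_cylinder oD) CP CG.
have CQG := MCk_mul (open_cylinder oD) CQ CG.
rewrite (pint_sub (MCk_cont CPG i j) (MCk_cont CQG i j) De s2).
apply: le_trans (pint_bound (K := a * (kappa * m%:R)) _ De s2 _) _.
- move=> z zO; apply: continuousB; [exact: (MCk_cont CPG i j)|exact: (MCk_cont CQG i j)].
- move=> u u2; have Ou : Om (u, e) by [].
  rewrite [X in `|X|](_ : _ = ((P (u, e) - Q (u, e)) *m G (u, e)) i j); last first.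
    by rewrite mulmxBl [RHS]mxE [X in _ = _ + X]mxE.
  apply: mulmx_bound => // i' j'; [exact: PQ|exact: Gk].
rewrite -mulrA mulrC ler_wpM2r//; move: km; move: (kappa * m%:R) => x; lra.
Qed.

(** The iterates converge geometrically and uniformly, so the limit is continuous and a fixed
    point of the integral operator. *)
Lemma picard G (kappa : R) : MCk 0 Om G -> kappa * m%:R * 4 <= 1 ->
  (forall z i j, Om z -> `|G z i j| <= kappa) ->
  exists P, MCk 0 Om P /\ forall z, Om z -> P z = 1%:M + pint_mx (fun y => P y *m G y) z.
Proof.
move=> CG km Gk; have oO := open_cylinder oD.
(* the iterates start at 0, so that the first increment is the identity matrix *)
pose S := fix S N : R * E -> 'M[R]_m :=
  if N is N'.+1 then fun z => 1%:M + pint_mx (fun y => S N' y *m G y) z else fun=> 0.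
have CS N : MCk 0 Om (S N).
  elim: N => [|N IH]; first exact: MCk_cst.
  apply: MCk_add => //; first exact: MCk_cst.
  by apply: MCk_pint_mx; exact: MCk_mul.
have h0 N : 0 <= 2^-1 ^+ N :> R by rewrite exprn_ge0// invr_ge0.
have dS N z i j : Om z -> `|(S N.+1 z - S N z) i j| <= 2^-1 ^+ N.
  elim: N z i j => [|N IH] z i j Oz.
    rewrite /= expr0 subr0 mxE; have -> : pint_mx (fun y => 0 *m G y) z i j = 0.
      rewrite (_ : (fun y => _) = (fun y => S 0%N y *m G y))//.
      case: z Oz => s e [/= s2 De]; rewrite mxE.
      apply/eqP; rewrite -normr_le0; apply: le_trans (pint_bound (K := 0) _ De s2 _) _.
      - exact: (MCk_cont (MCk_mul oO (CS 0%N) CG) i j).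
      - by move=> u u2; rewrite /= mul0mx mxE normr0.
      - by rewrite mul0r.
    by rewrite addr0 mxE; case: eqP => _; rewrite ?normr1 ?normr0.
  have -> : S N.+2 z - S N.+1 z =
    pint_mx (fun y => S N.+1 y *m G y) z - pint_mx (fun y => S N y *m G y) z.
    by rewrite /= opprD addrACA subrr add0r.
  rewrite exprS; exact: (picard_step (h0 N) CG km Gk (CS N.+1) (CS N) IH).
have lim z i j : {l : R | Om z -> forall N, `|l - S N z i j| <= 2 * 2^-1 ^+ N}.
  apply: cid; have [Oz|nOz] := pselect (Om z); last by exists 0.
  have [|l Hl] := @geometric_limit R (fun N => S N z i j).
    by move=> N; have := dS N z i j Oz; rewrite !mxE.
  by exists l => _.
pose P z : 'M[R]_m := \matrix_(i, j) sval (lim z i j).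
have PS z i j N : Om z -> `|(P z - S N z) i j| <= 2 * 2^-1 ^+ N.
  by move=> Oz; rewrite 3!mxE; exact: (svalP (lim z i j)).
have CP : MCk 0 Om P.
  move=> i j; split=> // z; rewrite inE => Oz; apply/cvgrPdist_le => p p0.
  have p30 : 0 < p / 3 by rewrite divr_gt0.
  have [N HN] := half_pow_small (divr_gt0 p30 (ltr0Sn R 1)).
  have HN' : 2 * 2^-1 ^+ N <= p / 3 by rewrite mulrC -ler_pdivlMr.
  have /cvgrPdist_le/(_ _ p30) NS := MCk_cont (CS N) i j _ (mem_set Oz).
  apply: filterS2 NS (open_near oO Oz) => y H1 Oy.
  have H2 := le_trans (PS z i j N Oz) HN'.
  have H3 := le_trans (PS y i j N Oy) HN'.
  move: H2 H3; rewrite ![(_ - S N _) i j]mxE ![(- S N _) i j]mxE => H2 H3.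
  move: H1 H2 H3; rewrite !ler_norml => /andP[? ?] /andP[? ?] /andP[? ?].
  by apply/andP; split; lra.
exists P; split=> // z Oz; apply/matrixP => i j.
apply/eqP; rewrite -subr_eq0 -normr_le0; apply/ler_addgt0Pl => p p0; rewrite addr0.
have [N HN] := half_pow_small (divr_gt0 p0 (ltr0Sn R 1)).
have HN' : 2 * 2^-1 ^+ N <= p by rewrite mulrC -ler_pdivlMr.
have H1 := PS z i j N.+1 Oz.
have H2 := picard_step (mulr_ge0 (ler0n R 2) (h0 N)) CG km Gk CP (CS N) (fun z i j => PS z i j N) i j Oz.
have -> : P z i j - (1%:M + pint_mx (fun y => P y *m G y) z) i j = (P z - S N.+1 z) i j -
    (pint_mx (fun y => P y *m G y) z - pint_mx (fun y => S N y *m G y) z) i j.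
  transitivity ((P z - (1%:M + pint_mx (fun y => P y *m G y) z)) i j).
    by rewrite [RHS]mxE [X in _ = _ + X]mxE.
  transitivity ((P z - S N.+1 z - (pint_mx (fun y => P y *m G y) z - pint_mx (fun y => S N y *m G y) z)) i j).
    congr fun_of_matrix; rewrite [S N.+1 z]/= opprB !opprD !addrA subrK//.
  by rewrite [LHS]mxE [X in _ + X = _]mxE.
apply: le_trans (ler_normB _ _) _; apply: le_trans (lerD H1 H2) _.
rewrite exprS mulVKf// mulKf//; move: HN'; move: (2^-1 ^+ N) => x; lra.
Qed.

(** P solves P_s = P G, and Y is its inverse. Making Y part of the solution avoids the inversion
    of matrices of functions, and the symmetry [ode_sol_tr] carries every result on P over to Y. *)
Record ode_sol G P Y : Prop := OdeSol {
  sol_contG : MCk 0 Om G;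
  sol_cont : MCk 0 Om P;
  sol_contV : MCk 0 Om Y;
  sol_init : forall e, D e -> P (0, e) = 1%:M;
  sol_initV : forall e, D e -> Y (0, e) = 1%:M;
  sol_ds : forall z, Om z -> mderive z ds P (P z *m G z);
  sol_dsV : forall z, Om z -> mderive z ds Y (- (G z *m Y z)) }.

Lemma const_along_s (f : R * E -> 'M[R]_m) s e : D e -> `|s| < 2 ->
  (forall z, Om z -> mderive z ds f 0) -> f (s, e) = f (0, e).
Proof.
move=> De s2 H; apply/matrixP => i j.
have [u us|u us] := @MVT_from_zero R (fun u => f (u, e) i j) (fun=> 0) s.
  have Ou : Om (u, e) by split=> //=; exact: le_lt_trans s2.
  by apply: (is_derive_slice1 (fun z => f z i j) u e 0).2; have := H _ Ou i j; rewrite mxE.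
by rewrite mulr0 => /eqP; rewrite subr_eq0 => /eqP.
Qed.

Lemma sol_mulmx G P Y z : ode_sol G P Y -> Om z -> P z *m Y z = 1%:M.
Proof.
move=> S; case: z => s e [/= s2 De].
rewrite (@const_along_s (fun z => P z *m Y z) s e De s2).
  by rewrite (sol_init S De) (sol_initV S De) mulmx1.
move=> z Oz; have := mderive_mul (sol_ds S Oz) (sol_dsV S Oz).
by rewrite mulmxN mulmxA subrr.
Qed.

Lemma sol_mulVmx G P Y z : ode_sol G P Y -> Om z -> Y z *m P z = 1%:M.
Proof. by move=> S Oz; apply: mulmx1C; exact: sol_mulmx S Oz. Qed.

Lemma ode_sol_tr G P Y : ode_sol G P Y ->
  ode_sol (fun z => - (G z)^T) (fun z => (Y z)^T) (fun z => (P z)^T).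
Proof.
move=> S; have oO := open_cylinder oD; split.
- by apply: MCk_opp => //; apply: MCk_tr; exact: sol_contG S.
- by apply: MCk_tr; exact: sol_contV S.
- by apply: MCk_tr; exact: sol_cont S.
- by move=> e De; rewrite (sol_initV S De) trmx1.
- by move=> e De; rewrite (sol_init S De) trmx1.
- by move=> z /(sol_dsV S)/mderive_tr; rewrite linearN /= trmx_mul mulmxN.
- by move=> z /(sol_ds S)/mderive_tr; rewrite trmx_mul mulNmx opprK.
Qed.

(** The inverse of P is the transpose of the solution for the matrix - G^T. *)
Lemma ode_exists G (kappa : R) : MCk 0 Om G -> kappa * m%:R * 4 <= 1 ->
  (forall z i j, Om z -> `|G z i j| <= kappa) ->
  exists P Y, ode_sol G P Y.
Proof.
move=> CG km Gk; have oO := open_cylinder oD.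
have aux H : MCk 0 Om H -> (forall z i j, Om z -> `|H z i j| <= kappa) ->
    exists P, [/\ MCk 0 Om P, forall e, D e -> P (0, e) = 1%:M &
      forall z, Om z -> mderive z ds P (P z *m H z)].
  move=> CH Hk; have [P [CP PE]] := picard CH km Hk.
  have CPH := MCk_mul oO CP CH.
  exists P; split=> // [e De|[s e] [s2 De]].
    have O0 : Om (0, e) by split=> //=; rewrite normr0.
    by rewrite PE// (pint_mx0 CPH De) addr0.
  apply: (mderive_eq oO _ (fun z Oz => esym (PE z Oz))); first by [].
  rewrite -[_ *m _]add0r; apply: mderive_add; first exact: mderive_cst.
  exact: (pint_mx_ds CPH).
have [P [CP P0 dP]] := aux G CG Gk.
have [|z i j Oz|Q [CQ Q0 dQ]] := aux (fun z => - (G z)^T).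
- by apply: MCk_opp => //; exact: MCk_tr.
- by rewrite !mxE normrN; exact: Gk.
exists P, (fun z => (Q z)^T); split=> //.
- exact: MCk_tr.
- by move=> e De; rewrite Q0// trmx1.
- by move=> z Oz; have /mderive_tr := dQ z Oz; rewrite trmx_mul linearN /= trmxK mulNmx.
Qed.

End LinearODE.
Arguments MCk_cont {R E D k n1 n2 P} _ i j.

(** * Smooth dependence on parameters *)

Section ODEParameters.
Context {R : realType} {E : normedModType R}.
Variable D : set E.
Hypothesis oD : open D.
Variable m : nat.
Implicit Types (P Q Y G : R * E -> 'M[R]_m) (z : R * E) (w : E).
Local Notation Om := (cylinder D).
Local Notation ds := ((1, 0) : R * E).
Local Notation dpar w := ((0, w) : R * E).

Definition mcont (T : topologicalType) (x : T) n p (P : T -> 'M[R]_(n, p)) :=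
  forall i j, {for x, continuous (fun y => P y i j)}.

Lemma mcont_mul (T : topologicalType) (x : T) n p q (P : T -> 'M[R]_(n, p))
    (Q : T -> 'M[R]_(p, q)) : mcont x P -> mcont x Q -> mcont x (fun y => P y *m Q y).
Proof.
move=> cP cQ i j; rewrite (_ : (fun y => _) = (fun y => \sum_l (P y i l * Q y l j))).
  elim: (index_enum _) => [|l r IH].
    by rewrite (_ : (fun y => _) = cst 0); [exact: cst_continuous|apply/funext => y; rewrite big_nil].
  rewrite (_ : (fun y => _) = (fun y => P y i l) * (fun y => Q y l j)
                            + (fun y => \sum_(l <- r) P y i l * Q y l j)).
    by apply: continuousD => //; apply: continuousM.
  by apply/funext => y; rewrite big_cons.
by apply/funext => y; rewrite mxE.
Qed.

Lemma mderive_slice P u e d : mderive (u, e) ds P d -> mderive u 1 (fun u => P (u, e)) d.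
Proof. by move=> H i j; apply: (is_derive_slice1 (fun z => P z i j) u e _).2. Qed.

Lemma param_shift_continuous u e w :
  {for ((u, 0) : R * R), continuous (fun z : R * R => (z.1, e + z.2 *: w))}.
Proof.
have H1 : (fun z : R * R => z.1) x @[x --> ((u, 0) : R * R)] --> u by exact: cvg_fst.
have H2 : (fun z : R * R => e + z.2 *: w) x @[x --> ((u, 0) : R * R)] --> e + (0 : R) *: w.
  apply: cvgD; first exact: cvg_cst.
  have H : {for ((u, 0) : R * R), continuous ((fun h : R => h *: w) \o @snd R R)}.
    by apply: continuous_comp; [exact: cvg_snd|exact: scalel_continuous].
  exact: H.
exact: (@cvg_pair _ _ _ (nbhs ((u, 0) : R * R)) (nbhs u) (nbhs (e + (0 : R) *: w)) _ _ _ _ _ H1 H2).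
Qed.

(** Variation of constants. The quotient (P (u, e + h w) Y (u, e) - 1) / h vanishes at u = 0, and
    its derivative in u is P (u, e + h w) ((G (u, e + h w) - G (u, e)) / h) Y (u, e). This
    derivative is jointly continuous up to h = 0, so the quotient tends to the integral of
    P (dG/dw) Y. *)
Lemma sol_dw G P Y w z : ode_sol D G P Y -> MCk 1 Om G -> Om z ->
  mderive z (dpar w) P (pint_mx (fun y => P y *m dM (dpar w) G y *m Y y) z *m P z).
Proof.
move=> S CG; case: z => s e [/= s2 De].
have oO := open_cylinder oD.
set X := fun y => P y *m dM (dpar w) G y *m Y y.
have CX : MCk 0 Om X.
  apply: (MCk_mul oO _ (sol_contV S)); apply: (MCk_mul oO (sol_cont S)).
  exact: MCk_dM.
(* F u h is the quotient in the sense of variation of constants, Phi its derivative in u *)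
pose Phi (z : R * R) := P (z.1, e + z.2 *: w) *m
   (\matrix_(i, j) divdiff (fun z => G z i j) e w z) *m Y (z.1, e).
pose F u h : 'M[R]_m := if h == 0 then pint_mx X (u, e)
   else h^-1 *: (P (u, e + h *: w) *m Y (u, e) - 1%:M).
have cPhi u : `|u| < 2 -> mcont ((u, 0) : R * R) Phi.
  move=> u2; have Ou : Om (u, e) by [].
  apply: mcont_mul; first apply: mcont_mul.
  - move=> i j.
    apply: (@continuous_comp _ _ _ (fun z : R * R => (z.1, e + z.2 *: w)) (fun z => P z i j)).
      exact: param_shift_continuous.
    by apply: (MCk_cont (sol_cont S) i j); rewrite /= scale0r addr0 inE.
  - move=> i j; rewrite (_ : (fun y => _) = divdiff (fun z => G z i j) e w).
      exact: (divdiff_cont oD).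
    by apply/funext => y; rewrite mxE.
  - move=> i j; apply: (@continuous_comp _ _ _ (fun z : R * R => (z.1, e)) (fun z => Y z i j)).
      have H1 : (fun z : R * R => z.1) x @[x --> ((u, 0) : R * R)] --> u by exact: cvg_fst.
      exact: (@cvg_pair _ _ _ (nbhs ((u, 0) : R * R)) (nbhs u) (nbhs e) _ _ _ _ _ H1 (cvg_cst e)).
    by apply: (MCk_cont (sol_contV S) i j); rewrite inE.
have nD : \forall h \near (0 : R), D (e + h *: w).
  have : {for (0 : R), continuous (fun h : R => e + h *: w)}.
    by apply: continuousD; [exact: cvg_cst|exact: scalel_continuous].
  by apply; rewrite /= scale0r addr0; exact: open_near.
have pPhi i j h : D (e + h *: w) -> is_prim (fun u => Phi (u, h) i j) (fun u => F u h i j).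
  move=> Dh; rewrite /F /Phi /=; case: eqP => [->|/eqP h0].
    rewrite scale0r addr0.
    have [X0 dX] := pint_prim (MCk_cont CX i j) De.
    split=> [|u u2]; first by rewrite mxE.
    rewrite (_ : (fun u => _) = (fun u => pint (fun y => X y i j) (u, e))); last first.
      by apply/funext => u'; rewrite mxE.
    apply: is_derive_eq (dX u u2) _; rewrite /X; congr fun_of_matrix.
    congr (_ *m _ *m _); apply/matrixP => k l; rewrite !mxE /divdiff/= eqxx //.
  split=> [|u u2].
    by rewrite (sol_init S Dh) (sol_initV S De) mulmx1 subrr scaler0 mxE.
  have Ou : Om (u, e) by []. have Oh : Om (u, e + h *: w) by [].
  have H1 := mderive_slice (sol_ds S Oh); have H2 := mderive_slice (sol_dsV S Ou).
  have H3 := mderive_scale (is_derive_cst (h^-1) u 1)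
    (mderive_add (mderive_mul H1 H2) (mderive_opp (mderive_cst (1%:M : 'M[R]_m) u 1))).
  apply: is_derive_eq (H3 i j) _; congr fun_of_matrix.
  rewrite scale0r add0r subr0 mulmxN -!mulmxA -mulmxBr -mulmxBl scalemxAr scalemxAl.
  congr (_ *m (_ *m _)); apply/matrixP => k l.
  by rewrite !mxE /divdiff/= (negbTE h0).
move=> i j.
apply: (@cvg_is_derive_param _ _ (fun z => P z i j) s e w _ (fun h => (F s h *m P (s, e)) i j)).
  move=> h h0; rewrite /F (negbTE h0) -scalemxAl mulmxBl mul1mx -mulmxA.
  rewrite (sol_mulVmx S (_ : Om (s, e)))// mulmx1 !mxE //.
move=> p p0; pose K := 1 + \sum_l `|P (s, e) l j|.
have K0 : 0 < K by rewrite ltr_pwDl// sumr_ge0.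
have F0 : pint_mx X (s, e) = F s 0 by rewrite /F eqxx.
have nF : \forall h \near (0 : R), forall l, `|F s h i l - F s 0 i l| <= p / K.
  apply: (@filter_forall R _ (fun l h => `|F s h i l - F s 0 i l| <= p / K) (nbhs (0 : R)) _) => l.
  have := @prim_param_cvg _ _ (0 : R) (fun z : R * R => Phi z i l) (fun u h => F u h i l) `|s| (p / K).
  move=> /(_ _ _ s2 (divr_gt0 p0 K0)) H.
  apply: filterS (H _ _) => [h /(_ s (lexx _))//|u u2|]; first exact: cPhi.
  by apply: filterS nD => h; exact: pPhi.
apply: filterS nF => h Hh; rewrite F0 !mxE -sumrB.
apply: (@le_trans _ _ (\sum_l (p / K) * `|P (s, e) l j|)).
  apply: le_trans (ler_norm_sum _ _ _) _; apply: ler_sum => l _.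
  by rewrite -mulrBl normrM ler_wpM2r.
rewrite -mulr_sumr mulrAC ler_pdivrMr// ler_wpM2l ?ltW// /K.
by rewrite ltrDr.
Qed.

(** The derivatives of P are expressed through G, its derivatives, P and Y, so each order of
    smoothness yields the next one. *)
Lemma sol_CkS k G P Y : ode_sol D G P Y -> (forall k, MCk k Om G) ->
  MCk k Om P -> MCk k Om Y -> MCk k.+1 Om P.
Proof.
move=> S CG CP CY i j; have oO := open_cylinder oD.
apply: Ck_of_dirs; first exact: Ck_cont (CP i j).
move=> v; rewrite (direction_split v).
apply: Ck_dir_add; first exact: oO.
  apply: Ck_dir_scale; first exact: oO.
  split=> [z Oz|]; first by case: (sol_ds S Oz i j).
  apply: Ck_eq oO _ (MCk_mul oO CP (CG k) i j) => z; rewrite inE => Oz.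
  by have [_ ->] := sol_ds S Oz i j.
split=> [z Oz|]; first by case: (sol_dw v.2 S (CG 1%N) Oz i j).
have C : MCk k Om (fun z => pint_mx (fun y => P y *m dM (dpar v.2) G y *m Y y) z *m P z).
  apply: MCk_mul => //; apply: (MCk_pint_mx oD); do 2 apply: MCk_mul => //.
  exact: MCk_dM.
apply: Ck_eq oO _ (C i j) => z; rewrite inE => Oz.
by have [_ ->] := sol_dw v.2 S (CG 1%N) Oz i j.
Qed.

Lemma sol_smooth k G P Y : ode_sol D G P Y -> (forall k, MCk k Om G) ->
  MCk k Om P /\ MCk k Om Y.
Proof.
move=> S CG; have oO := open_cylinder oD; elim: k => [|k [CP CY]].
  by split; [exact: sol_cont S|exact: sol_contV S].
split; first exact: sol_CkS S CG CP CY.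
have CGt k' : MCk k' Om (fun z => - (G z)^T) by apply: MCk_opp => //; exact: MCk_tr.
have /MCk_tr := sol_CkS (ode_sol_tr oD S) CGt (MCk_tr CY) (MCk_tr CP).
by apply: (MCk_eq oO) => z _; rewrite trmxK.
Qed.

End ODEParameters.

(** * Matrix-valued one-forms along rays *)

Lemma Ck_scalef {R : realType} {E V : normedModType R} (c : coords V) k (D : set E)
  (g : E -> R) (f : E -> V) : open D ->
  Ck k D g -> Ck k D f -> Ck k D (fun z => g z *: f z).
Proof.
move=> oD Cg Cf; apply: (Ck_coords (b := c)) => // i.
rewrite (_ : _ \o _ = g * (ccoord c i \o f)).
  by apply: Ck_mul => //; exact: Ck_clin_comp (ccoord_lin c i) oD Cf.
by apply/funext => z /=; rewrite (clinZ (ccoord_lin c i)).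
Qed.

Lemma clinear_boundedV {R : realType} {E V : normedModType R} (b : coords E)
    (c : coords V) (l : E -> V) : clinear l ->
  exists2 K : R, 0 < K & forall x, `|l x| <= K * `|x|.
Proof.
move=> ll.
have Ki i : {K | 0 < K & forall x, `|ccoord c i (l x)| <= K * `|x|}.
  by apply: cid2; exact: clinear_bounded (clinear_comp ll (ccoord_lin c i)).
pose k i := let: exist2 K _ _ := Ki i in K.
have k0 i : 0 < k i by rewrite /k; case: (Ki i).
have kb i x : `|ccoord c i (l x)| <= k i * `|x| by rewrite /k; case: (Ki i).
exists (1 + \sum_i k i * `|cvec c i|).
  by rewrite ltr_pwDl// sumr_ge0// => i _; rewrite mulr_ge0// ltW.
move=> x; apply: le_trans (norm_le_coords c _) _.
apply: (@le_trans _ _ (\sum_i k i * `|cvec c i| * `|x|)).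
  by apply: ler_sum => i _; rewrite mulrAC ler_wpM2r.
by rewrite -mulr_suml ler_wpM2r// lerDr.
Qed.

Section Rays.
Context {R : realType} {E : normedModType R} (b : coords E).
Variable pr : E -> E.
Hypotheses (pr_lin : clinear pr) (pr_id : forall x, pr (pr x) = pr x).
Variable e0 : E.
Local Notation ds := ((1, 0) : R * E).
Local Notation dpar w := ((0, w) : R * E).

(** The component of z.2 - e0 in the image of the projection pr is scaled by z.1, and the other
    one is kept. With pr the identity these are the rays from e0; with the projection of
    R x V onto V they are rays in the fibres t = const, and the constructions below then
    depend on the parameter t. *)
Definition ray (z : R * E) : E := z.2 + (z.1 - 1) *: pr (z.2 - e0).

Lemma ray1 e : ray (1, e) = e.
Proof. by rewrite /ray/= subrr scale0r addr0. Qed.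

Lemma Ck_snd_shift k (D : set (R * E)) : open D -> Ck k D (fun z => z.2 - e0).
Proof.
move=> oD; have := Ck_add oD (Ck_clin (clinear_snd R E) k D) (Ck_cst k D (- e0)).
exact.
Qed.

Lemma Ck_ray k (D : set (R * E)) : open D -> Ck k D ray.
Proof.
move=> oD; apply: (Ck_add oD (Ck_clin (clinear_snd R E) k D)).
apply: (Ck_scalef b) => //; last exact: Ck_clin_comp pr_lin oD (Ck_snd_shift k oD).
have := Ck_add oD (Ck_clin (clinear_fst R E) k D) (Ck_cst k D (- 1 : R)).
exact.
Qed.

Lemma ray_ds z : is_derive z ds ray (pr (z.2 - e0)).
Proof.
case: z => s e; apply/is_deriveP => p p0; exists 1 => // h h0 _.
rewrite (_ : _ - _ - _ = 0) ?normr0 ?mulr_ge0 ?ltW// /ray/= scaler0 addr0.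
rewrite [h *: 1]mulr1 (addrAC s) (scalerDl (pr (e - e0)) (s - 1) h) addrA.
by move: (e + _ *: _) (h *: _) => x y; rewrite addrAC addrK subrr.
Qed.

Lemma ray_dpar z w : pr w = w -> is_derive z (dpar w) ray (z.1 *: w).
Proof.
case: z => s e pw; apply/is_deriveP => p p0; exists 1 => // h h0 _.
rewrite (_ : _ - _ - _ = 0) ?normr0 ?mulr_ge0 ?ltW// /ray/= scaler0 addr0.
rewrite [e + h *: w - e0]addrAC (clinD pr_lin (e - e0)) (clinZ pr_lin) pw scalerDr.
have -> : (s - 1) *: (h *: w) = h *: (s *: w) - h *: w.
  by rewrite scalerBl scale1r !scalerA mulrC.
rewrite addrACA [h *: w + _]addrC subrK.
by move: (e + _ *: _) (h *: _) => x y; rewrite addrAC addrK subrr.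
Qed.

(** For |s| < 2 the coefficient s - 1 in [ray] is at most 3 in absolute value; K bounds the
    projection pr. *)
Lemma ray_ball (r : R) : 0 < r -> exists2 q : R, 0 < q <= r &
  forall s e, `|s| < 2 -> ball e0 q e -> ball e0 r (ray (s, e)).
Proof.
move=> r0; have [K K0 HK] := clinear_boundedV b b pr_lin.
exists (r / (1 + 3 * K)).
  have K1 : 0 < 1 + 3 * K by rewrite ltr_pwDl// mulr_ge0// ltW.
  rewrite divr_gt0// ler_pdivrMr//; apply: ler_peMr; first exact: ltW.
  by rewrite lerDl mulr_ge0// ltW.
move=> s e s2; rewrite -!ball_normE /ball_/= distrC => H.
rewrite distrC /ray/= addrAC; apply: le_lt_trans (ler_normD _ _) _.
rewrite normrZ; apply: le_lt_trans (_ : `|e - e0| * (1 + 3 * K) < _).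
  rewrite mulrDr mulr1 lerD2l mulrCA ler_pM//.
    apply: le_trans (ler_normB _ _) _; rewrite normr1; move: s2; lra.
  by rewrite mulrC; exact: HK.
by rewrite -ltr_pdivlMr// ltr_pwDl// mulr_ge0// ltW.
Qed.

Section OneForm.
Variables (m n : nat) (Ga : E -> E -> 'M[R]_(m, n)) (U : set E).
Hypothesis oU : open U.
Hypothesis Ga_lin : forall y a v w, Ga y (a *: v + w) = a *: Ga y v + Ga y w.
Hypothesis Ga_smooth : forall k v, MCk k U (Ga ^~ v).

Lemma one_form0 y : Ga y 0 = 0.
Proof. by have := Ga_lin y (-1) 0 0; rewrite scaler0 addr0 scaleN1r addNr. Qed.

Lemma one_form_coords y v : Ga y v = \sum_i ccoord b i v *: Ga y (cvec b i).
Proof.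
rewrite {1}(ccoordE b v); elim: (index_enum _) => [|i r IH].
  by rewrite !big_nil one_form0.
by rewrite !big_cons Ga_lin IH.
Qed.

Lemma dM_one_form_coords y w v : U y ->
  dM w (Ga ^~ v) y = \sum_i ccoord b i v *: dM w (Ga ^~ (cvec b i)) y.
Proof.
move=> Uy; apply: mderive_dM.
rewrite (_ : Ga ^~ v = fun y => \sum_i ccoord b i v *: Ga y (cvec b i)); last first.
  by apply/funext => z; exact: one_form_coords.
apply: mderive_sum => i.
have := mderive_scale (is_derive_cst (ccoord b i v) y w) (MCk_mderive w (@Ga_smooth 1 (cvec b i)) Uy).
by rewrite scale0r add0r.
Qed.

(** The value of the form on the velocity of the ray through z.2. *)
Definition ray_form (z : R * E) : 'M[R]_(m, n) := Ga (ray z) (pr (z.2 - e0)).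

Variable D : set E.
Hypothesis oD : open D.
Hypothesis rayD : forall s e, `|s| < 2 -> D e -> U (ray (s, e)).
Local Notation Om := (cylinder D).

Lemma cylinder_ray z : Om z -> U (ray z).
Proof. by case: z => s e [s2 De]; exact: rayD. Qed.

Lemma ray_form_coords :
  ray_form = fun z => \sum_i ccoord b i (pr (z.2 - e0)) *: Ga (ray z) (cvec b i).
Proof. by apply/funext => z; exact: one_form_coords. Qed.

Lemma MCk_ray_form k : MCk k Om ray_form.
Proof.
have oO := open_cylinder oD; rewrite ray_form_coords => i j.
rewrite (_ : (fun z => _) = fun z => \sum_l (((ccoord b l \o pr) \o (fun z => z.2 - e0)) *
    ((fun y => Ga y (cvec b l) i j) \o ray)) z); last first.
  by apply/funext => z; rewrite summxE; apply: eq_bigr => l _; rewrite mxE.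
apply: Ck_sum => // l; apply: Ck_mul => //.
  exact: (Ck_clin_comp (clinear_comp pr_lin (ccoord_lin b l)) oO (Ck_snd_shift k oO)).
apply: (Ck_comp_scalar b oO oU cylinder_ray (Ck_ray k oO)).
exact: Ga_smooth.
Qed.

(** Up to the factor z.1, [ray_form] and Ga (ray z) w are the components of the pull-back of Ga
    by [ray] in the directions of time and of w. The derivatives here and in
    [form_along_ray_ds] therefore differ by the exterior derivative of Ga. *)
Lemma ray_form_dpar z w : pr w = w -> Om z ->
  mderive z (dpar w) ray_form
    (Ga (ray z) w + z.1 *: dM w (Ga ^~ (pr (z.2 - e0))) (ray z)).
Proof.
move=> pw Oz; have Ur := cylinder_ray Oz.
rewrite ray_form_coords (one_form_coords _ w) (dM_one_form_coords _ _ Ur) scaler_sumr -big_split/=.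
apply: mderive_sum => i.
have H1 : is_derive z (dpar w) (fun z => ccoord b i (pr (z.2 - e0))) (ccoord b i w).
  have L := is_derive_clin (clinear_comp pr_lin (ccoord_lin b i))
    (is_deriveB (is_derive_clin_id (clinear_snd R E) z (dpar w)) (is_derive_cst e0 z (dpar w))).
  by rewrite subr0 /= pw in L; exact: L.
have H2 := mderive_chain b oU Ur (@Ga_smooth 1 (cvec b i)) (ray_dpar z pw).
have := mderive_scale H1 H2.
rewrite (_ : dM (z.1 *: w) _ _ = z.1 *: dM w (Ga ^~ (cvec b i)) (ray z)); last first.
  apply/matrixP => k l; rewrite !mxE.
  have := derive_lin b z.1 w 0 oU Ur (@Ga_smooth 1 (cvec b i) k l).
  by rewrite addr0 derive0 addr0.
by rewrite scalerA mulrC -scalerA.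
Qed.

Lemma form_along_ray_ds z w : Om z ->
  mderive z ds (fun z => z.1 *: Ga (ray z) w)
    (Ga (ray z) w + z.1 *: dM (pr (z.2 - e0)) (Ga ^~ w) (ray z)).
Proof.
move=> Oz; have Ur := cylinder_ray Oz.
have := mderive_scale (is_derive_clin_id (clinear_fst R E) z ds)
   (mderive_chain b oU Ur (@Ga_smooth 1 w) (ray_ds z)).
by rewrite /= scale1r.
Qed.

End OneForm.
End Rays.

(** * Flat and closed matrix-valued one-forms *)

Section Integration.
Context {R : realType} {E : normedModType R} (b : coords E).
Variable pr : E -> E.
Hypotheses (pr_lin : clinear pr) (pr_id : forall x, pr (pr x) = pr x).
Variables (e0 : E) (U : set E).
Hypotheses (oU : open U) (Ue0 : U e0).
Local Notation ds := ((1, 0) : R * E).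
Local Notation dpar w := ((0, w) : R * E).

Lemma ray_domain : exists2 q : R, 0 < q & ball e0 q `<=` U /\
  forall s e, `|s| < 2 -> ball e0 q e -> U (ray pr e0 (s, e)).
Proof.
have [r /= r0 Hr] : nbhs_ball e0 U by apply/nbhs_ballP; exact: open_near.
have [q /andP[q0 qr] Hq] := ray_ball b pr_lin e0 r0.
exists q => //; split=> [e He|s e s2 He]; apply: Hr; last exact: Hq.
exact: le_ball He.
Qed.

Section Small.
Variables (m n : nat) (Ga : E -> E -> 'M[R]_(m, n)).
Hypothesis Ga_lin : forall y a v w, Ga y (a *: v + w) = a *: Ga y v + Ga y w.
Hypothesis Ga_smooth : forall k v, MCk k U (Ga ^~ v).

(** Near e0 the velocity pr (e - e0) is small while Ga stays bounded; smallness makes the Picard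
    iteration converge on the whole time interval. *)
Lemma ray_form_small (kappa : R) : 0 < kappa -> exists2 q : R, 0 < q &
  [/\ ball e0 q `<=` U, forall s e, `|s| < 2 -> ball e0 q e -> U (ray pr e0 (s, e)) &
  forall z i j, cylinder (ball e0 q) z -> `|ray_form pr e0 Ga z i j| <= kappa].
Proof.
move=> kp0; pose N : R := (cdim b).+1%:R.
have N0 : 0 < N by rewrite ltr0n.
have [r /= r0 Hr] : nbhs_ball e0 [set y | U y /\ forall l i j,
    `|Ga y (cvec b l) i j| <= `|Ga e0 (cvec b l) i j| + 1].
  apply/nbhs_ballP; apply: filterI; first exact: open_near.
  apply: filter_forall => l; apply: filter_forall => i; apply: filter_forall => j.
  have /cvgrPdist_le/(_ _ ltr01) := Ck_cont (@Ga_smooth 0 (cvec b l) i j) (mem_set Ue0).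
  apply: filterS => y Hy; rewrite -[X in `|X|](subrK (Ga e0 (cvec b l) i j)).
  by apply: le_trans (ler_normD _ _) _; rewrite addrC lerD2l distrC.
have [q1 /andP[q10 q1r] Hq1] := ray_ball b pr_lin e0 r0.
have [q2 /= q20 Hq2] : nbhs_ball (0 : E) [set d | forall l i j,
    `|ccoord b l (pr d)| <= kappa / N / (`|Ga e0 (cvec b l) i j| + 1)].
  apply/nbhs_ballP.
  apply: filter_forall => l; apply: filter_forall => i; apply: filter_forall => j.
  have c0 : 0 < kappa / N / (`|Ga e0 (cvec b l) i j| + 1).
    by rewrite !divr_gt0// ltr_wpDl.
  have [s s0 Hs] := cvg0_bound (clinear_comp pr_lin (ccoord_lin b l)) c0.
  apply/nbhs_ballP; exists s => //= d; rewrite -ball_normE /ball_/= sub0r normrN.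
  by move=> /Hs/ltW.
exists (Num.min q1 q2); first by rewrite lt_min q10.
have B1 e : ball e0 (Num.min q1 q2) e -> ball e0 q1 e.
  by apply: le_ball; rewrite ge_min lexx.
have B2 e : ball e0 (Num.min q1 q2) e -> ball e0 q2 e.
  by apply: le_ball; rewrite ge_min lexx orbT.
split=> [e /B1 He|s e s2 /B1 He|[s e] i j [/= s2 He]].
- by have [] := Hr e (le_ball q1r He).
- by have [] := Hr _ (Hq1 s e s2 He).
have [_ HG] := Hr _ (Hq1 s e s2 (B1 _ He)).
have := Hq2 (e - e0); rewrite -ball_normE /ball_/= sub0r normrN.
have := B2 _ He; rewrite -ball_normE /ball_/= distrC => He' /(_ He') Hl.
rewrite (ray_form_coords b pr e0 Ga_lin)/= summxE.
apply: le_trans (ler_norm_sum _ _ _) _.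
apply: (@le_trans _ _ (\sum_(l < cdim b) kappa / N)).
  apply: ler_sum => l _; rewrite mxE normrM.
  apply: le_trans (ler_pM (normr_ge0 _) (normr_ge0 _) (Hl l i j) (HG l i j)) _.
  by rewrite divfK// gt_eqF// ltr_wpDl.
rewrite sumr_const card_ord -[leLHS]mulr_natl mulrCA ger_pMr//.
by rewrite ler_pdivrMr// mul1r ler_nat.
Qed.

End Small.

Lemma pr_shift_id (z : R * E) : pr (pr (z.2 - e0)) = pr (z.2 - e0).
Proof. exact: pr_id. Qed.

Lemma MCk_slice k m n (D : set E) (P : R * E -> 'M[R]_(m, n)) : open D ->
  MCk k (cylinder D) P -> MCk k D (fun e => P (1, e)).
Proof.
move=> oD CP i j.
apply: (Ck_comp_scalar (coords_prod (@coordsR R) b) oD (open_cylinder oD)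
  (f := fun e => (1, e)) (g := fun z => P z i j)).
- by move=> e De; split=> //=; rewrite normr1 ltr1n.
- apply: (Ck_coords (b := coords_prod (@coordsR R) b)) => // l.
  rewrite /=; case: (fintype.split l) => q /=; first exact: Ck_cst.
  exact: (Ck_clin (ccoord_lin b q)).
- exact: CP.
Qed.

Lemma mderive_slice2 m n (P : R * E -> 'M[R]_(m, n)) s e w d :
  mderive (s, e) (dpar w) P d -> mderive e w (fun y => P (s, y)) d.
Proof. by move=> H i j; apply: (is_derive_slice2 (fun z => P z i j) s e w _).2. Qed.

(** Solve P_s = P Ga (velocity) along the rays with P = 1 at s = 0, and set p e = P (1, e). Flatness
    implies that the defect Z = D_w P - s P Ga (ray) w satisfies the same linear equation
    Z_s = Z G; it vanishes at s = 0, hence at s = 1, which is the equation for p in the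
    direction w. Where pr (e - e0) = 0 the ray is constant and P stays equal to 1. *)
Theorem frobenius m (Ga : E -> E -> 'M[R]_m) :
  (forall y a v w, Ga y (a *: v + w) = a *: Ga y v + Ga y w) ->
  (forall k v, MCk k U (Ga ^~ v)) ->
  (forall y v w, U y -> pr v = v -> pr w = w ->
     dM v (Ga ^~ w) y - dM w (Ga ^~ v) y + Ga y v *m Ga y w - Ga y w *m Ga y v = 0) ->
  exists2 q : R, 0 < q & ball e0 q `<=` U /\
  exists p y : E -> 'M[R]_m,
    [/\ forall k, MCk k (ball e0 q) p,
        forall k, MCk k (ball e0 q) y,
        forall e, ball e0 q e -> p e *m y e = 1%:M /\ y e *m p e = 1%:M,
        forall e w, ball e0 q e -> pr w = w -> mderive e w p (p e *m Ga e w) &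
        forall e, ball e0 q e -> pr (e - e0) = 0 -> p e = 1%:M].
Proof.
move=> Ga_lin Ga_smooth flat.
(* the bound under which the Picard iteration contracts *)
pose kappa : R := (m%:R * 4 + 1)^-1.
have k1 : 0 < m%:R * 4 + 1 :> R by rewrite ltr_wpDl// mulr_ge0.
have kap0 : 0 < kappa by rewrite invr_gt0.
have [q q0 [BU BR Bk]] := ray_form_small Ga_lin Ga_smooth kap0.
have oD : open (ball e0 q) by exact: ball_open.
pose Om := cylinder (ball e0 q); have oO : open Om := open_cylinder oD.
pose G := ray_form pr e0 Ga.
have CG k : MCk k Om G by exact: (MCk_ray_form b pr_lin oU Ga_lin Ga_smooth oD BR).
have [|z i j Oz|P [Y S]] := ode_exists oD (CG 0%N) (kappa := kappa).
- by rewrite -mulrA mulrC ler_pdivrMr// mul1r lerDl.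
- exact: Bk.
have CP k : MCk k Om P by have [] := sol_smooth oD k S CG.
have CY k : MCk k Om Y by have [] := sol_smooth oD k S CG.
have O1 e : ball e0 q e -> Om (1, e) by move=> He; split=> //=; rewrite normr1 ltr1n.
have Ur z : Om z -> U (ray pr e0 z) by exact: cylinder_ray BR z.
exists q => //; split=> //; exists (fun e => P (1, e)), (fun e => Y (1, e)); split.
- by move=> k; exact: MCk_slice.
- by move=> k; exact: MCk_slice.
- by move=> e /O1 Oe; split; [exact: (sol_mulmx S Oe)|exact: (sol_mulVmx S Oe)].
- move=> e w He pw.
    (* Z solves the equation of P, so Z *m Y is constant in time *)
  pose Z z := dM (dpar w) P z - z.1 *: (P z *m Ga (ray pr e0 z) w).
  have dZ z : Om z -> mderive z ds Z (Z z *m G z).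
    move=> Oz.
    have H1 : mderive z ds (dM (dpar w) P) (dM ds (dM (dpar w) P) z).
      exact: (MCk_mderive ds (MCk_dM (dpar w) (CP 2%N)) Oz).
    have E1 : dM ds (dM (dpar w) P) z = dM (dpar w) (fun y => P y *m G y) z.
      rewrite (Schwarz_mx ds (dpar w) oO Oz (CP 2%N)).
      apply/matrixP => i j; rewrite !mxE; apply: near_eq_derive.
      apply: filterS (open_near oO Oz) => y Oy.
      by rewrite (mderive_dM (sol_ds S Oy)).
    have H2 := mderive_mul (MCk_mderive (dpar w) (CP 1%N) Oz)
      (ray_form_dpar b pr_lin oU Ga_lin Ga_smooth BR pw Oz).
    rewrite (mderive_dM H2) in E1.
    have H3 := mderive_mul (sol_ds S Oz) (form_along_ray_ds b oU Ga_smooth BR w Oz).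
    have H4 := mderive_add H1 (mderive_opp H3).
    have ZE : Z = fun z => dM (dpar w) P z + - (P z *m (z.1 *: Ga (ray pr e0 z) w)).
      by apply/funext => z'; rewrite /Z scalemxAr.
    rewrite ZE; move: H4; congr mderive.
    rewrite E1 -/G.
    have fl : dM w (Ga^~ (pr (z.2 - e0))) (ray pr e0 z) -
       (G z *m Ga (ray pr e0 z) w + dM (pr (z.2 - e0)) (Ga^~ w) (ray pr e0 z)) =
       - (Ga (ray pr e0 z) w *m G z).
      apply/eqP; rewrite -subr_eq0 -oppr_eq0.
      rewrite -(flat (ray pr e0 z) _ w (Ur z Oz) (pr_shift_id z) pw) /G /ray_form.
      by rewrite opprK opprD opprB (addrC (_ *m _) (dM _ _ _)) (addrAC (dM _ _ _)).
    have K : Ga (ray pr e0 z) w + z.1 *: dM w (Ga^~ (pr (z.2 - e0))) (ray pr e0 z) -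
       (z.1 *: (G z *m Ga (ray pr e0 z) w) +
        (Ga (ray pr e0 z) w + z.1 *: dM (pr (z.2 - e0)) (Ga^~ w) (ray pr e0 z))) =
       - (z.1 *: (Ga (ray pr e0 z) w *m G z)).
      rewrite [X in _ - X]addrCA opprD addrACA subrr add0r -scalerDr -scalerBr fl.
      by rewrite scalerN.
    rewrite -(mulmxA (P z) (G z)) -(mulmxDr (P z)) -addrA -mulmxBr -(scalemxAr z.1 (G z)) K.
    by rewrite mulmxN [RHS]mulmxBl -[in RHS]mulmxA -scalemxAl.
  have ZY z : Om z -> mderive z ds (fun z => Z z *m Y z) 0.
    move=> Oz; have := mderive_mul (dZ z Oz) (sol_dsV S Oz).
    by rewrite mulmxN mulmxA subrr.
  have Z1 : Z (1, e) = 0.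
    rewrite -[Z _]mulmx1 -(sol_mulVmx S (O1 e He)) mulmxA.
    rewrite (const_along_s (D := ball e0 q) He (s := 1) _ ZY) ?normr1 ?ltr1n//.
    rewrite /Z /= scale0r subr0.
    suff -> : dM (dpar w) P (0, e) = 0 by rewrite !mul0mx.
    apply: mderive_dM => i j; rewrite mxE.
    apply: (is_derive_slice2 (fun z => P z i j) 0 e w 0).1.
    apply: near_eq_is_derive (is_derive_cst ((1%:M : 'M[R]_m) i j) e w).
    by apply: filterS (open_near oD He) => y By; rewrite (sol_init S By).
  apply: mderive_slice2.
  have -> : P (1, e) *m Ga e w = dM (dpar w) P (1, e).
    move: Z1; rewrite /Z scale1r ray1 => /eqP; rewrite subr_eq0 => /eqP ->//.
  exact: (MCk_mderive (dpar w) (CP 1%N) (O1 e He)).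
- move=> e He pe.
  apply/matrixP => i j.
  have [u u1|u u1] := @MVT_from_zero R (fun u => P (u, e) i j) (fun=> 0) 1.
    have Ou : Om (u, e).
      by split=> //=; apply: le_lt_trans u1 _; rewrite normr1 ltr1n.
    apply: (is_derive_slice1 (fun z => P z i j) u e 0).2.
    have := sol_ds S Ou i j; rewrite /G /ray_form pe (one_form0 Ga_lin) mulmx0 mxE; exact.
  by rewrite mulr0 (sol_init S He) => /eqP; rewrite subr_eq0 => /eqP.
Qed.

(** The Poincare lemma with parameters. The primitive is the integral of al (velocity) along the
    ray; since al is closed, the derivative along w of the integrand is the derivative in s of
    s al (ray) w. *)
Theorem primitive_of_closed_form m n (al : E -> E -> 'M[R]_(m, n)) :
  (forall y a v w, al y (a *: v + w) = a *: al y v + al y w) ->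
  (forall k v, MCk k U (al ^~ v)) ->
  (forall y v w, U y -> pr v = v -> pr w = w -> dM v (al ^~ w) y = dM w (al ^~ v) y) ->
  exists2 q : R, 0 < q & ball e0 q `<=` U /\
  exists g : E -> 'M[R]_(m, n),
    [/\ forall k, MCk k (ball e0 q) g,
        forall e w, ball e0 q e -> pr w = w -> mderive e w g (al e w) &
        forall e, ball e0 q e -> pr (e - e0) = 0 -> g e = 0].
Proof.
move=> al_lin al_smooth closed.
have [q q0 [BU BR]] := ray_domain.
have oD : open (ball e0 q) by exact: ball_open.
pose Om := cylinder (ball e0 q); have oO : open Om := open_cylinder oD.
pose f := ray_form pr e0 al.
have Cf k : MCk k Om f by exact: (MCk_ray_form b pr_lin oU al_lin al_smooth oD BR).
have CJ k : MCk k Om (pint_mx f) by exact: (MCk_pint_mx oD (Cf k)).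
have Ur z : Om z -> U (ray pr e0 z) by exact: cylinder_ray BR z.
have n1 : `|1 : R| < 2 by rewrite normr1 ltr1n.
exists q => //; split=> //; exists (fun e => pint_mx f (1, e)); split.
- by move=> k; exact: MCk_slice.
- move=> e w He pw; apply: mderive_slice2 => i j.
  have Cfij k : Ck k Om (fun z => f z i j) by exact: Cf.
  rewrite (_ : (fun z => _) = pint (fun z => f z i j)); last first.
    by apply/funext => z; rewrite mxE.
  apply: is_derive_eq (pint_dw oD w (Cfij 1%N) He n1) _.
  pose g u := (u *: al (ray pr e0 (u, e)) w) i j.
  have pg : is_prim (fun u => 'D_(dpar w) (fun z => f z i j) (u, e)) g.
    split=> [|u u2]; first by rewrite /g scale0r mxE.
    have Ou : Om (u, e) by [].
    apply: is_derive_eq.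
      apply: (is_derive_slice1 (fun z => (z.1 *: al (ray pr e0 z) w) i j) u e _).2.
      exact: (form_along_ray_ds b oU al_smooth BR w Ou i j).
    have [_ ->] := ray_form_dpar b pr_lin oU al_lin al_smooth BR pw Ou i j.
    by rewrite (closed _ _ w (Ur _ Ou) (pr_shift_id (u, e)) pw).
  have cD : {in Om, continuous ('D_(dpar w) (fun z => f z i j))}.
    exact: Ck_cont (Ck_derive (dpar w) (Cfij 1%N)).
  rewrite (is_prim_eq (pint_prim cD He) pg (s := 1))// /g scale1r ray1//.
- move=> e He pe; apply/matrixP => i j; rewrite [LHS]mxE [RHS]mxE.
  have cf : {in Om, continuous (fun z => f z i j)} by exact: Ck_cont (Cf 0%N i j).
  have p0 : is_prim (fun=> 0 : R) (fun=> 0 : R) by split=> // u _; exact: is_derive_cst.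
  apply: (is_prim_eq (pint_prim cf He) p0) => // u _.
  by rewrite /f /ray_form pe (one_form0 al_lin) mxE.
Qed.

End Integration.

(** * The inverse function theorem *)

Section FixedPoint.
Context {R : realType} {E : normedModType R} (b : coords E).

Lemma fixed_point (T : E -> E) (a : E) (rho : R) : 0 < rho ->
  (forall x, `|x - a| <= rho -> `|T x - a| <= rho) ->
  (forall x y, `|x - a| <= rho -> `|y - a| <= rho -> `|T x - T y| <= 2^-1 * `|x - y|) ->
  exists2 x, `|x - a| <= rho & T x = x.
Proof.
move=> r0 Tin Tc; pose x N := iter N T a.
have xin N : `|x N - a| <= rho.
  elim: N => [|N IH]; first by rewrite /= subrr normr0 ltW.
  exact: Tin.
have h0 N : 0 <= 2^-1 ^+ N :> R by rewrite exprn_ge0// invr_ge0.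
have dx N : `|x N.+1 - x N| <= rho * 2^-1 ^+ N.
  elim: N => [|N IH]; first by rewrite expr0 mulr1; exact: xin 1%N.
  change (`|T (x N.+1) - T (x N)| <= rho * 2^-1 ^+ N.+1).
  apply: le_trans (Tc _ _ (xin _) (xin _)) _.
  by rewrite exprS mulrCA ler_wpM2l// invr_ge0.
have [K K0 HK] := coords_bounded b.
have lk i d : `|ccoord b i d| <= K * `|d|.
  apply: (le_trans _ (HK d).1); rewrite (bigD1 i)//= lerDl; exact: sumr_ge0.
have Kr0 : 0 < K * rho by rewrite mulr_gt0.
have lim i : {l : R | forall N, `|l - ccoord b i (x N) / (K * rho)| <= 2 * 2^-1 ^+ N}.
  apply: cid; apply: geometric_limit => N.
  rewrite -mulrBl -(clinB (ccoord_lin b i)) normrM normfV (gtr0_norm Kr0) ler_pdivrMr//.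
  apply: le_trans (lk i _) _; rewrite mulrCA; apply: (ler_wpM2l (ltW K0)); rewrite mulrC; exact: dx.
(* the limits of the coordinates of the iterates, rescaled *)
pose X := \sum_i (sval (lim i) * (K * rho)) *: cvec b i.
pose C := \sum_i 2 * (K * rho) * `|cvec b i|.
have C0 : 0 <= C by apply: sumr_ge0 => i _; rewrite !mulr_ge0// ltW.
have Xx N : `|X - x N| <= C * 2^-1 ^+ N.
  rewrite {1}(ccoordE b (x N)) /X -sumrB /C mulr_suml.
  apply: le_trans (ler_norm_sum _ _ _) _; apply: ler_sum => i _.
  rewrite -scalerBl normrZ mulrAC ler_wpM2r//.
  have := svalP (lim i) N => H.
  rewrite -[X in _ - X](divfK (lt0r_neq0 Kr0)) -mulrBl normrM (gtr0_norm Kr0).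
  by rewrite mulrAC ler_wpM2r// ltW.
have small (e : R) : 0 < e -> exists N, C * 2^-1 ^+ N <= e.
  move=> e0; have C1 : 0 < C + 1 by rewrite ltr_wpDl.
  have [N HN] := half_pow_small (divr_gt0 e0 C1); exists N.
  apply: (@le_trans _ _ ((C + 1) * 2^-1 ^+ N)); first by rewrite ler_wpM2r// lerDl.
  by rewrite mulrC -ler_pdivlMr.
have Xa : `|X - a| <= rho.
  apply/ler_addgt0Pl => e /small[N HN].
  rewrite -(subrKA (x N)); apply: le_trans (ler_normD _ _) _; apply: lerD => //.
  exact: le_trans (Xx N) HN.
exists X => //; apply/eqP; rewrite -subr_eq0 -normr_le0; apply/ler_addgt0Pl => e e0; rewrite addr0.
have [N HN] := small (e / 2) (divr_gt0 e0 (ltr0Sn R 1)).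
rewrite -(subrKA (x N.+1)) [e]splitr; apply: le_trans (ler_normD _ _) _; apply: lerD.
  apply: le_trans (Tc _ _ Xa (xin N)) _; apply: (le_trans _ HN).
  by apply: (le_trans _ (Xx N)); rewrite ler_piMl// invf_le1// ler1n.
rewrite distrC; apply: le_trans (Xx _) _; apply: (le_trans _ HN).
by rewrite exprS mulrCA ler_piMl ?mulr_ge0// invf_le1// ler1n.
Qed.

End FixedPoint.

Section InverseFunction.
Context {R : realType} {E : normedModType R} (b : coords E).
Variables (psi : E -> E) (D : set E) (e0 : E).
Hypotheses (oD : open D) (De0 : D e0) (Cpsi : forall k, Ck k D psi).
Hypothesis dpsi0 : forall v, 'D_v psi e0 = v.

(** Strict differentiability of each coordinate at e0, with an error small enough to absorb the
    constants that compare the norm with the coordinates. *)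
Lemma near_identity_of_derivative : exists2 r : R, 0 < r & ball e0 r `<=` D /\
  forall x y, ball e0 r x -> ball e0 r y ->
    `|psi x - psi y - (x - y)| <= 2^-1 * `|x - y|.
Proof.
have [s /= s0 Hs] : nbhs_ball e0 D by apply/nbhs_ballP; exact: open_near.
have [K K0 HK] := coords_bounded b.
pose V := 1 + \sum_i `|cvec b i|.
have V0 : 0 < V by rewrite ltr_pwDl// sumr_ge0.
(* ep * (K * |x - y|) in each coordinate adds up to at most |x - y| / 2 *)
pose ep : R := 2^-1 / K / V.
have ep0 : 0 < ep by rewrite !divr_gt0.
have Cg i : Ck 1 D (ccoord b i \o psi) by exact: Ck_clin_comp (ccoord_lin b i) oD (Cpsi 1).
have ri i : {r : R | 0 < r & forall p d, `|p - e0| + \sum_j `|ccoord b j d| * `|cvec b j| < r ->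
    `|(ccoord b i \o psi) (p + d) - (ccoord b i \o psi) p
       - \sum_j ccoord b j d * 'D_(cvec b j) (ccoord b i \o psi) e0| <= ep * \sum_j `|ccoord b j d|}.
  by apply: cid2; exact: strict_diff oD De0 (Cg i) ep ep0.
have [r1 /= r10 Hr1] : nbhs_ball (0 : R) [set x | forall i, x < let: exist2 r _ _ := ri i in r].
  apply/nbhs_ballP;
  apply: (@filter_forall R _ (fun i (x : R) => x < let: exist2 r _ _ := ri i in r)
    (nbhs (0 : R)) _) => i; case: (ri i) => r r0 _.
  by apply/nbhs_ballP; exists r => //= x; rewrite -ball_normE /ball_/= sub0r normrN;
    apply: le_lt_trans; exact: ler_norm.
pose r2 := r1 / 2.
have r20 : 0 < r2 by rewrite divr_gt0.
have Hr2 i : r2 < let: exist2 r _ _ := ri i in r.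
  apply: Hr1; rewrite -ball_normE /ball_/= sub0r normrN gtr0_norm// /r2.
  by rewrite ltr_pdivrMr// ltr_pMr// ltr1n.
(* the radius for which both the base point and the increment enter the strict estimate *)
pose q := r2 / (1 + 2 * K).
have K1 : 0 < 1 + 2 * K by rewrite ltr_pwDl// mulr_ge0// ltW.
have q0 : 0 < q by rewrite divr_gt0.
exists (Num.min s q); first by rewrite lt_min s0.
split=> [e|x y].
  by move=> He; apply: Hs; apply: le_ball He; rewrite ge_min lexx.
rewrite -!ball_normE /ball_/= !lt_min => /andP[_ xq] /andP[_ yq].
have xy : `|x - y| < 2 * q.
  rewrite -(subrKA e0); apply: le_lt_trans (ler_normD _ _) _.
  by rewrite mulr2n mulrDl mul1r ltrD// distrC.
have E1 i : `|ccoord b i (psi x - psi y - (x - y))| <= ep * (K * `|x - y|).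
  have := Hr2 i; case: (ri i) => r r0 Hr rr2.
  have := Hr y (x - y); rewrite -(derive_coords b (x - y) oD De0 (Cg i)).
  have dpsi : is_derive e0 (x - y) psi (x - y).
    rewrite -[X in is_derive _ _ _ X](dpsi0 (x - y)); apply: derivableP.
    exact: Ck_derivable (Cpsi 1) De0.
  have [_ ->] := is_derive_clin (ccoord_lin b i) dpsi.
  rewrite [y + (x - y)]addrC subrK /= !(clinB (ccoord_lin b i)) => H.
  apply: le_trans (H _) _; last first.
    by apply: (ler_wpM2l (ltW ep0)); exact: (HK (x - y)).1.
  apply: lt_trans rr2; apply: lt_le_trans (_ : q + K * (2 * q) <= _); last first.
    have -> : q + K * (2 * q) = q * (1 + 2 * K) by ring.
    by rewrite /q divfK ?gt_eqF.
  rewrite distrC; apply: ltr_leD => //.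
  apply: le_trans (HK (x - y)).2 _; rewrite ler_wpM2l ?ltW//.
apply: le_trans (norm_le_coords b _) _.
apply: (@le_trans _ _ (\sum_i ep * (K * `|x - y|) * `|cvec b i|)).
  by apply: ler_sum => i _; rewrite ler_wpM2r.
rewrite -mulr_sumr; apply: (@le_trans _ _ (ep * (K * `|x - y|) * V)).
  apply: ler_wpM2l; first exact: (mulr_ge0 (ltW ep0) (mulr_ge0 (ltW K0) (normr_ge0 _))).
  by rewrite /V lerDr.
rewrite [leLHS](_ : _ = 2^-1 * `|x - y|)// /ep.
by field; rewrite !gt_eqF.
Qed.

Variable r : R.
Hypotheses (r0 : 0 < r) (rD : ball e0 r `<=` D).
Hypothesis lip : forall x y, ball e0 r x -> ball e0 r y ->
    `|psi x - psi y - (x - y)| <= 2^-1 * `|x - y|.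
Local Notation B := (ball e0 r).

Lemma near_identity_expand x y : B x -> B y -> `|x - y| <= 2 * `|psi x - psi y|.
Proof.
move=> Bx By; have H := lip Bx By.
have H2 : `|x - y| - `|psi x - psi y| <= 2^-1 * `|x - y|.
  by apply: (le_trans _ H); rewrite [leRHS]distrC; exact: lerB_dist.
move: H2; move: `|x - y| `|_| => p q; lra.
Qed.

Lemma near_identity_inj x y : B x -> B y -> psi x = psi y -> x = y.
Proof.
move=> Bx By e; apply/eqP; rewrite -subr_eq0 -normr_le0.
by apply: le_trans (near_identity_expand Bx By) _; rewrite e subrr normr0 mulr0.
Qed.

(** A point y near psi a is attained because x |-> x - psi x + y is a contraction of a small closed
    ball around a. *)
Lemma near_identity_open : open (psi @` B).
Proof.
rewrite openE => _ [a Ba <-].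
have [q /= q0 Hq] : nbhs_ball a B by apply/nbhs_ballP; apply: open_near => //; exact: ball_open.
pose rho := q / 2; have rho0 : 0 < rho by rewrite divr_gt0.
have Bc x : `|x - a| <= rho -> B x.
  move=> xa; apply: Hq; rewrite -ball_normE /ball_/= distrC; apply: le_lt_trans xa _.
  by rewrite /rho ltr_pdivrMr// ltr_pMr// ltr1n.
apply/nbhs_ballP; exists (rho / 2); first by rewrite /= divr_gt0.
move=> y; rewrite -ball_normE /ball_/= => ya.
pose T x := x - psi x + y.
have Tc u v : `|u - a| <= rho -> `|v - a| <= rho -> `|T u - T v| <= 2^-1 * `|u - v|.
  move=> /Bc Bu /Bc Bv; apply: (le_trans _ (lip Bu Bv)).
  rewrite /T opprD addrACA subrr addr0 distrC [X in `|X| <= _](_ : _ = psi u - psi v - (u - v))//.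
  by rewrite !opprB [LHS]addrACA [RHS]addrACA [v + _]addrC.
have [|x xa Tx] := fixed_point b rho0 _ Tc.
  move=> x xa; rewrite -(subrKA (T a)) [rho]splitr; apply: le_trans (ler_normD _ _) _.
  apply: lerD.
    apply: le_trans (Tc _ _ xa _) _; first by rewrite subrr normr0 ltW.
    by rewrite mulrC ler_pM2r ?invr_gt0.
  by rewrite /T addrAC [a - _]addrC addrK addrC distrC ltW.
exists x; first by have := Bc x xa; rewrite -ball_normE.
by move: Tx; rewrite /T -addrA => /eqP; rewrite -[X in _ == X]addr0 (inj_eq (addrI x)) addrC subr_eq0 => /eqP.
Qed.

Definition near_identity_inv (y : E) : E := xget e0 [set x | B x /\ psi x = y].

Lemma near_identity_invP y : (psi @` B) y -> B (near_identity_inv y) /\ psi (near_identity_inv y) = y.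
Proof. by move=> [x Bx xy]; exact: (xgetPex e0 (ex_intro (fun x => B x /\ psi x = y) x (conj Bx xy))). Qed.

Lemma near_identity_invK x : B x -> near_identity_inv (psi x) = x.
Proof.
move=> Bx; have [Bi e] := near_identity_invP (ex_intro2 _ _ x Bx erefl).
exact: near_identity_inj.
Qed.

Variable L : E -> E -> E.
Hypothesis CL : forall k w, Ck k D (L ^~ w).
Hypothesis LP : forall e w, D e -> 'D_(L e w) psi e = w.

Lemma is_derive_near_identity_inv y w : (psi @` B) y ->
  is_derive y w near_identity_inv (L (near_identity_inv y) w).
Proof.
move=> [e Be <-]; rewrite near_identity_invK//; apply/is_deriveP => p p0.
have p20 : 0 < p / 2 by rewrite divr_gt0.
have De : D e by exact: rD.
have /is_deriveP/(_ _ p20)[q q0 Hq] : is_derive e (L e w) psi w.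
  rewrite -[X in is_derive _ _ _ X](LP w De); apply: derivableP.
  exact: Ck_derivable (Cpsi 1) De.
have line_near (z : E) (v : E) (S : set E) : open S -> S z ->
    \forall h \near (0 : R), S (z + h *: v).
  move=> oS Sz; have : {for (0 : R), continuous (fun h : R => z + h *: v)}.
    by apply: continuousD; [exact: cvg_cst|exact: scalel_continuous].
  by apply; rewrite /= scale0r addr0; exact: open_near.
have N1 := line_near (psi e) w _ near_identity_open (ex_intro2 _ _ e Be erefl).
have N2 := line_near e (L e w) _ (@ball_open _ _ e0 r) Be.
have [s /= s0 Hs] : nbhs_ball (0 : R) [set h | (psi @` B) (psi e + h *: w) /\ B (e + h *: L e w)].
  by apply/nbhs_ballP; apply: filterS2 N1 N2 => h.
exists (Num.min q s); first by rewrite lt_min q0.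
move=> h h0; rewrite lt_min => /andP[hq hs].
have Bh : ball (0 : R) s h by rewrite -ball_normE /ball_/= sub0r normrN.
have [W1 B1] := Hs h Bh.
have [B2 E2] := near_identity_invP W1.
rewrite (near_identity_invK Be) -addrA -opprD; apply: le_trans (near_identity_expand B2 B1) _.
rewrite E2 distrC [X in `|X|](_ : _ = psi (e + h *: L e w) - psi e - h *: w).
  by rewrite -ler_pdivlMl// mulrA [2^-1 * p]mulrC; exact: Hq.
by rewrite opprD addrA.
Qed.

(** The derivative of the inverse along w is L (inverse) w, so each order of smoothness of the
    inverse yields the next one. *)
Lemma near_identity_inv_smooth k : Ck k (psi @` B) near_identity_inv.
Proof.
elim: k => [|k IH].
  split=> // y; rewrite inE => Wy; apply/cvgrPdist_le => p p0.
  have p20 : 0 < p / 2 by rewrite divr_gt0.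
  have /nbhs_ballP[q /= q0 Hq] := open_near near_identity_open Wy.
  apply/nbhs_ballP; exists (Num.min q (p / 2)); first by rewrite /= lt_min q0.
  move=> z zy; have Wz : (psi @` B) z by apply: Hq; apply: le_ball zy; rewrite ge_min lexx.
  have [B1 E1] := near_identity_invP Wy; have [B2 E2] := near_identity_invP Wz.
  apply: le_trans (near_identity_expand B1 B2) _; rewrite E1 E2 mulrC -ler_pdivlMr//.
  move: zy; rewrite -ball_normE /ball_/= lt_min => /andP[_]; exact: ltW.
split=> [y|w]; first exact: (Ck_cont IH).
split=> [y|]; first by rewrite inE => /(is_derive_near_identity_inv w)[].
apply: Ck_eq near_identity_open _
  (Ck_comp b b near_identity_open oD _ IH (CL k w)) => [y|y /near_identity_invP[/rD]//].
by rewrite inE => /(is_derive_near_identity_inv w)[_ ->].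
Qed.

End InverseFunction.

(** * The curvature of the Chern connection *)

Section SmoothScalars.
Context {R : realType} {E : normedModType R} (D : set E).
Hypothesis oD : open D.
Implicit Types (f g : E -> R).

Definition smooth_scalar f := forall k, Ck k D f.

Lemma smooth_cst (c : R) : smooth_scalar (fun=> c).
Proof. by move=> k; exact: Ck_cst. Qed.

Lemma smooth_add f g : smooth_scalar f -> smooth_scalar g -> smooth_scalar (fun z => f z + g z).
Proof. by move=> Cf Cg k; exact: Ck_add (Cf k) (Cg k). Qed.

Lemma smooth_mul f g : smooth_scalar f -> smooth_scalar g -> smooth_scalar (fun z => f z * g z).
Proof. by move=> Cf Cg k; exact: Ck_mul (Cf k) (Cg k). Qed.

Lemma smooth_opp f : smooth_scalar f -> smooth_scalar (fun z => - f z).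
Proof.
move=> Cf; rewrite (_ : (fun z => _) = (fun z => -1 * f z)); last first.
  by apply/funext => z; rewrite mulN1r.
by apply: smooth_mul => //; exact: smooth_cst.
Qed.

Lemma smooth_sub f g : smooth_scalar f -> smooth_scalar g -> smooth_scalar (fun z => f z - g z).
Proof. by move=> Cf Cg; apply: smooth_add => //; exact: smooth_opp. Qed.

Lemma smooth_sum (I : Type) (r : seq I) (f : I -> E -> R) :
  (forall i, smooth_scalar (f i)) -> smooth_scalar (fun z => \sum_(i <- r) f i z).
Proof. by move=> Cf k; apply: Ck_sum => // i; exact: Cf. Qed.

Lemma smooth_derive f v : smooth_scalar f -> smooth_scalar ('D_v f).
Proof. by move=> Cf k; exact: Ck_derive v (Cf k.+1). Qed.

Lemma smooth_clin f : clinear f -> smooth_scalar f.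
Proof. by move=> lf k; exact: Ck_clin. Qed.

End SmoothScalars.

Section CurvatureFormula.
Context {R : realType} {n : nat}.
Local Notation E1 := (E1 R n).
Variables (F : E1 -> 'rV[R]_n) (W : set E1).
Hypotheses (oW : open W) (CF : forall k, Ck k W F).

Lemma smoothF j : smooth_scalar W (fun z => F z 0 j).
Proof. by move=> k; exact: (Ck_clin_comp (@clinear_coord R 1 n 0 j) oW (CF k)). Qed.

Lemma smooth_dF i j : smooth_scalar W (dF F i j).
Proof. exact: smooth_derive (@smoothF j). Qed.

Lemma smooth_omega i Z : smooth_scalar W (fun z => omega i z Z).
Proof.
apply: smooth_sub => //; first exact: smooth_cst.
apply: smooth_mul => //; last exact: smooth_cst.
apply: smooth_clin.
exact: (clinear_comp (@clinear_snd R _ _) (@clinear_coord R 1 n 0 i)).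
Qed.

Definition hcomp (z X : E1) : 'cV[R]_n := \col_i omega i z X.
Definition vcomp (z X : E1) : 'cV[R]_n := \col_i coframe F (Some (inr i)) z X.

Lemma smooth_hcomp Z k : MCk k W (hcomp ^~ Z).
Proof.
move=> i j; rewrite (_ : (fun z => _) = (fun z => omega i z Z)).
  exact: smooth_omega.
by apply/funext => z; rewrite mxE.
Qed.

Lemma smooth_vcomp Z k : MCk k W (vcomp ^~ Z).
Proof.
move=> i j; rewrite (_ : (fun z => _) = (fun z => coframe F (Some (inr i)) z Z)); last first.
  by apply/funext => z; rewrite mxE.
apply: smooth_sub => //.
  apply: smooth_sub => //; first exact: smooth_cst.
  by apply: smooth_mul => //; [exact: smoothF|exact: smooth_cst].
apply: smooth_mul => //; first exact: smooth_cst.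
apply: smooth_sum => // l; apply: smooth_mul => //; [exact: smooth_omega|exact: smooth_dF].
Qed.

(** The connection form: the derivative along Y of the i-th vector of the frame of T^-, and of that
    of T^+, has the k-th component theta Y z k i. *)
Definition theta (Y z : E1) : 'M[R]_n := \matrix_(k, i)
  (- 2^-1 * (Y.1.1 * dF F i k z + \sum_j omega j z Y * pdot i (dF F j k) z)).

Lemma smooth_theta Y k : MCk k W (theta Y).
Proof.
move=> l i; rewrite (_ : (fun z => _) = (fun z =>
  (- 2^-1 * (Y.1.1 * dF F i l z + \sum_j omega j z Y * pdot i (dF F j l) z)))); last first.
  by apply/funext => z; rewrite mxE.
apply: smooth_mul => //; first exact: smooth_cst.
apply: smooth_add => //.
  by apply: smooth_mul => //; [exact: smooth_cst|exact: smooth_dF].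
apply: smooth_sum => // j; apply: smooth_mul => //; first exact: smooth_omega.
exact: smooth_derive (@smooth_dF j l).
Qed.

Definition comb_minus (z : E1) (a : 'cV[R]_n) : E1 := \sum_k a k 0 *: X_minus F k z.
Definition comb_plus (z : E1) (a : 'cV[R]_n) : E1 := \sum_k a k 0 *: X_plus k z.

Lemma comb_minusE z a :
  comb_minus z a = (0, a^T, \row_j \sum_k a k 0 * (2^-1 * dF F k j z)).
Proof.
rewrite /comb_minus [LHS]surjective_pairing [X in (X, _)]surjective_pairing.
rewrite (clin_sum (@clinear_snd R _ _)) !(clin_sum (@clinear_fst R _ _)) /=.
rewrite (clin_sum (@clinear_snd R _ _)) /=; congr (_, _, _).
- by rewrite big1// => i _; rewrite [_ *: _]mulr0.
- by rewrite [RHS]row_sum_delta; apply: eq_bigr => i _; rewrite mxE.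
- by apply/rowP => j; rewrite summxE mxE; apply: eq_bigr => i _; rewrite !mxE.
Qed.

Lemma comb_plusE z a : comb_plus z a = (0, 0, a^T).
Proof.
rewrite /comb_plus [LHS]surjective_pairing [X in (X, _)]surjective_pairing.
rewrite (clin_sum (@clinear_snd R _ _)) !(clin_sum (@clinear_fst R _ _)) /=.
rewrite (clin_sum (@clinear_snd R _ _)) /=; congr (_, _, _).
- by rewrite big1// => i _; rewrite [_ *: _]mulr0.
- by rewrite big1// => i _; rewrite scaler0.
- by rewrite [RHS]row_sum_delta; apply: eq_bigr => i _; rewrite mxE.
Qed.

(** The vector with components c, a, d in the decomposition T^0 + T^- + T^+. *)
Definition assemble z c a d : E1 := c *: X_sigma F z + comb_minus z a + comb_plus z d.

Lemma assembleE z c a d : assemble z c a d =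
  (c, c *: z.2 + a^T, c *: F z + \row_j (\sum_k a k 0 * (2^-1 * dF F k j z)) + d^T).
Proof.
rewrite /assemble comb_minusE comb_plusE /X_sigma; congr (_, _, _) => /=.
  by rewrite !addr0 [_ *: _]mulr1.
by rewrite addr0.
Qed.

Lemma coframe0_assemble z c a d : coframe F None z (assemble z c a d) = c.
Proof. by rewrite assembleE. Qed.

Lemma hcomp_assemble z c a d : hcomp z (assemble z c a d) = a.
Proof.
rewrite assembleE; apply/colP => i; rewrite !mxE /omega/= !mxE.
by rewrite mulrC addrAC subrr add0r.
Qed.

Lemma vcomp_assemble z c a d : vcomp z (assemble z c a d) = d.
Proof.
have H := hcomp_assemble z c a d; rewrite assembleE in H *.
apply/colP => i; rewrite !mxE /= !mxE.
under [X in _ - _ * X]eq_bigr => j _.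
  have -> : omega j z (c, c *: z.2 + a^T, c *: F z +
      \row_j (\sum_k a k 0 * (2^-1 * dF F k j z)) + d^T) = a j 0.
    by rewrite -[in RHS]H mxE.
  over.
have -> : \sum_(k < n) a k 0 * (2^-1 * dF F k i z) = 2^-1 * \sum_(j < n) a j 0 * dF F j i z.
  by rewrite mulr_sumr; apply: eq_bigr => k _; rewrite mulrCA.
by move: (\sum_(j < n) _) => S /=; ring.
Qed.

Lemma big_option (V : nmodType) (T : finType) (f : option T -> V) :
  \sum_a f a = f None + \sum_a f (Some a).
Proof.
rewrite (bigD1 None)//=; congr (_ + _).
rewrite (reindex_omap Some id)/=; last by case.
by apply: eq_bigl => a; rewrite eqxx.
Qed.

Lemma sum_frame (V : nmodType) (f : @frame_ix n -> V) :
  \sum_a f a = f None + (\sum_i f (Some (inl i)) + \sum_i f (Some (inr i))).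
Proof. by rewrite big_option big_sumType. Qed.

Lemma chern_sum (X : 'I_n -> E1) z Y i :
  Y.1.1 *: - (2^-1 *: \sum_j dF F i j z *: X j) +
  \sum_j omega j z Y *: - (2^-1 *: \sum_k pdot i (dF F j k) z *: X k) =
  \sum_k theta Y z k i *: X k.
Proof.
have -> : \sum_j omega j z Y *: - (2^-1 *: \sum_k pdot i (dF F j k) z *: X k) =
    \sum_k (- 2^-1 * \sum_j omega j z Y * pdot i (dF F j k) z) *: X k.
  under eq_bigr do rewrite -scaleNr scalerA scaler_sumr.
  rewrite exchange_big /=; apply: eq_bigr => k _.
  rewrite mulr_sumr scaler_suml; apply: eq_bigr => j _.
  by rewrite scalerA mulrCA mulrA.
rewrite -scaleNr scalerA scaler_sumr -big_split/=; apply: eq_bigr => k _.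
rewrite scalerA -scalerDl mxE; congr (_ *: _); ring.
Qed.

Lemma chern_minus z Y i :
  \sum_b coframe F b z Y *: chern_frame F b (Some (inl i)) z =
  \sum_k theta Y z k i *: X_minus F k z.
Proof.
rewrite sum_frame /= [X in _ + (_ + X)]big1 => [|j _]; last by rewrite scaler0.
by rewrite addr0 chern_sum.
Qed.

Lemma chern_plus z Y i :
  \sum_b coframe F b z Y *: chern_frame F b (Some (inr i)) z =
  \sum_k theta Y z k i *: X_plus k z.
Proof.
rewrite sum_frame /= [X in _ + (_ + X)]big1 => [|j _]; last by rewrite scaler0.
by rewrite addr0 (chern_sum (fun k => X_plus k z)).
Qed.

Lemma mulmx_comb (X : 'I_n -> E1) (A : 'M[R]_n) (v : 'cV[R]_n) :
  \sum_i v i 0 *: (\sum_k A k i *: X k) = \sum_k (A *m v) k 0 *: X k.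
Proof.
under eq_bigr do rewrite scaler_sumr.
rewrite exchange_big/=; apply: eq_bigr => k _.
by rewrite mxE scaler_suml; apply: eq_bigr => i _; rewrite scalerA mulrC.
Qed.

Lemma nablaE (Y Z : vfield (R := R) (n := n)) z : nabla F Y Z z =
  assemble z ('D_(Y z) (fun w => (Z w).1.1) z)
    (dM (Y z) (fun w => hcomp w (Z w)) z + theta (Y z) z *m hcomp z (Z z))
    (dM (Y z) (fun w => vcomp w (Z w)) z + theta (Y z) z *m vcomp z (Z z)).
Proof.
rewrite /nabla sum_frame /assemble -[RHS]addrA; congr (_ + (_ + _)).
- by rewrite big1 ?scaler0 ?addr0// => b _; rewrite [chern_frame _ _ _ _](_ : _ = 0) ?scaler0//;
    case: b => [[]|].
- under eq_bigr do rewrite chern_minus.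
  rewrite big_split/= /comb_minus.
  under [RHS]eq_bigr do rewrite mxE scalerDl.
  rewrite big_split/= -mulmx_comb; congr (_ + _); apply: eq_bigr => i _.
    rewrite mxE; congr (_ *: _); congr (derive _ _ _).
    by apply/funext => w; rewrite mxE.
  by rewrite mxE.
- under eq_bigr do rewrite chern_plus.
  rewrite big_split/= /comb_plus.
  under [RHS]eq_bigr do rewrite mxE scalerDl.
  rewrite big_split/= -(mulmx_comb (fun k => X_plus k z)); congr (_ + _); apply: eq_bigr => i _.
    rewrite mxE; congr (_ *: _); congr (derive _ _ _).
    by apply/funext => w; rewrite mxE.
  by rewrite mxE.
Qed.

Definition theta_curv (X Y z : E1) : 'M[R]_n :=
  dM X (theta Y) z - dM Y (theta X) z + theta X z *m theta Y z - theta Y z *m theta X z.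

(** The second derivatives of the components zeta cancel by symmetry, and so do the terms with
    first derivatives of zeta. *)
Lemma commutator_section (zeta : E1 -> 'cV[R]_n) X Y z : W z ->
  (forall k, MCk k W zeta) ->
  (dM X (fun w => dM Y zeta w + theta Y w *m zeta w) z
     + theta X z *m (dM Y zeta z + theta Y z *m zeta z))
  - (dM Y (fun w => dM X zeta w + theta X w *m zeta w) z
     + theta Y z *m (dM X zeta z + theta X z *m zeta z)) =
  theta_curv X Y z *m zeta z.
Proof.
move=> Wz Cz.
have D1 V V' : dM V (fun w => dM V' zeta w + theta V' w *m zeta w) z =
    dM V (dM V' zeta) z + (dM V (theta V') z *m zeta z + theta V' z *m dM V zeta z).
  apply: mderive_dM; apply: mderive_add.
    exact: (MCk_mderive V (MCk_dM V' (Cz 2%N)) Wz).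
  apply: mderive_mul; first exact: (MCk_mderive V (smooth_theta V' 1) Wz).
  exact: (MCk_mderive V (Cz 1%N) Wz).
rewrite !D1.
have -> : dM X (dM Y zeta) z = dM Y (dM X zeta) z.
  exact: (Schwarz_mx X Y oW Wz (Cz 2%N)).
rewrite /theta_curv !(mulmxDl, mulmxDr, mulNmx) !mulmxA.
move: (dM Y (dM X zeta) z) (dM X _ z *m _) (dM Y _ z *m _) (theta X z *m dM _ _ _)
  (theta Y z *m dM _ _ _) (theta X z *m theta Y z *m _) (theta Y z *m theta X z *m _).
move=> a1 a2 a3 a4 a5 a6 a7.
apply/colP => i; rewrite !mxE; ring.
Qed.

(** X^sigma is parallel, and the components in T^- and in T^+ are differentiated by the same matrix
    [theta]. *)
Lemma curvatureE z X Y Z : W z -> curvature_at F z X Y Z =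
  comb_minus z (theta_curv X Y z *m hcomp z Z) + comb_plus z (theta_curv X Y z *m vcomp z Z).
Proof.
move=> Wz; rewrite /curvature_at /curvature.
have N0 : nabla F (bracket (cst X) (cst Y)) (cst Z) z = 0.
  have B0 : bracket (cst X) (cst Y) z = 0 by rewrite /bracket !derive_cst subrr.
  rewrite nablaE B0 derive0.
  have Z0 (f : E1 -> 'cV[R]_n) : dM 0 f z = 0 by apply/colP => i; rewrite !mxE derive0.
  have T0 : theta 0 z = 0.
    apply/matrixP => k i; rewrite !mxE /= mul0r add0r big1 ?mulr0// => j _.
    by rewrite /omega/= mxE mulr0 subrr mul0r.
  by rewrite !Z0 T0 !mul0mx addr0 assembleE scale0r !trmx0 addr0 scale0r add0r
    (_ : \row_j _ = 0) ?addr0//; apply/rowP => j; rewrite !mxE big1// => k _; rewrite mxE mul0r.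
rewrite N0 subr0.
have NN V V' : nabla F (cst V) (nabla F (cst V') (cst Z)) z = assemble z 0
  (dM V (fun w => dM V' (hcomp ^~ Z) w + theta V' w *m hcomp w Z) z
     + theta V z *m (dM V' (hcomp ^~ Z) z + theta V' z *m hcomp z Z))
  (dM V (fun w => dM V' (vcomp ^~ Z) w + theta V' w *m vcomp w Z) z
     + theta V z *m (dM V' (vcomp ^~ Z) z + theta V' z *m vcomp z Z)).
  have A w : nabla F (cst V') (cst Z) w = assemble w 0
      (dM V' (hcomp ^~ Z) w + theta V' w *m hcomp w Z)
      (dM V' (vcomp ^~ Z) w + theta V' w *m vcomp w Z) by rewrite nablaE derive_cst.
  rewrite nablaE; congr assemble.
  - rewrite (_ : (fun w => _) = cst 0) ?derive_cst//; apply/funext => w.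
    by rewrite A; exact: (coframe0_assemble w 0).
  - have -> : (fun w => hcomp w (nabla F (cst V') (cst Z) w)) =
        fun w => dM V' (hcomp ^~ Z) w + theta V' w *m hcomp w Z.
      by apply/funext => w; rewrite A hcomp_assemble.
    by rewrite A hcomp_assemble.
  - have -> : (fun w => vcomp w (nabla F (cst V') (cst Z) w)) =
        fun w => dM V' (vcomp ^~ Z) w + theta V' w *m vcomp w Z.
      by apply/funext => w; rewrite A vcomp_assemble.
    by rewrite A vcomp_assemble.
have AB c a d c' a' d' : assemble z c a d - assemble z c' a' d' =
    assemble z (c - c') (a - a') (d - d').
  rewrite /assemble /comb_minus /comb_plus scalerBl.
  under [in RHS]eq_bigr do rewrite [X in X *: _]mxE [X in (_ + X) *: _]mxE scalerBl.
  under [X in _ = _ + X]eq_bigr do rewrite [X in X *: _]mxE [X in (_ + X) *: _]mxE scalerBl.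
  by rewrite !sumrB opprD addrACA opprD [X in X + _ = _]addrACA.
rewrite !NN AB subrr /assemble scale0r add0r.
congr (comb_minus z _ + comb_plus z _).
  by apply: (commutator_section X Y Wz); exact: smooth_hcomp.
by apply: (commutator_section X Y Wz); exact: smooth_vcomp.
Qed.

Lemma comb_minus_assemble z a : comb_minus z a = assemble z 0 a 0.
Proof.
by rewrite /assemble scale0r add0r [comb_plus z 0](_ : _ = 0) ?addr0// /comb_plus big1// => k _;
  rewrite mxE scale0r.
Qed.

Lemma comb_plus_assemble z a : comb_plus z a = assemble z 0 0 a.
Proof.
by rewrite /assemble scale0r add0r [comb_minus z 0](_ : _ = 0) ?add0r// /comb_minus big1// => k _;
  rewrite mxE scale0r.
Qed.

Lemma T_minus_comb z a : T_minus F z (comb_minus z a).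
Proof. by exists (fun i => a i 0). Qed.

Lemma T_plus_comb z a : T_plus z (comb_plus z a).
Proof. by exists (fun i => a i 0). Qed.

Lemma T_minusP z Z : T_minus F z Z -> exists a, Z = comb_minus z a.
Proof.
by move=> [a ->]; exists (\col_i a i); apply: eq_bigr => i _; rewrite mxE.
Qed.

Lemma T_plusP z Z : T_plus z Z -> exists a, Z = comb_plus z a.
Proof.
by move=> [a ->]; exists (\col_i a i); apply: eq_bigr => i _; rewrite mxE.
Qed.

Lemma mulmx_all_eq0 (A : 'M[R]_n) : (forall a : 'cV_n, A *m a = 0) -> A = 0.
Proof.
move=> H; apply/matrixP => i j; have /matrixP/(_ i 0) := H (delta_mx j 0).
rewrite !mxE (bigD1 j)//= mxE !eqxx mulr1 big1 ?addr0// => l lj.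
by rewrite mxE (negbTE lj) mulr0.
Qed.

Lemma curvature_minus z X Y a : W z ->
  curvature_at F z X Y (comb_minus z a) = comb_minus z (theta_curv X Y z *m a).
Proof.
move=> Wz; rewrite curvatureE// (comb_minus_assemble z a) hcomp_assemble vcomp_assemble mulmx0.
by rewrite [comb_plus z 0](_ : _ = 0) ?addr0// /comb_plus big1// => k _; rewrite mxE scale0r.
Qed.

Lemma curvature_plus z X Y a : W z ->
  curvature_at F z X Y (comb_plus z a) = comb_plus z (theta_curv X Y z *m a).
Proof.
move=> Wz; rewrite curvatureE// (comb_plus_assemble z a) hcomp_assemble vcomp_assemble mulmx0.
by rewrite [comb_minus z 0](_ : _ = 0) ?add0r// /comb_minus big1// => k _; rewrite mxE scale0r.
Qed.

Lemma curvature_vanishes_minus z X Y : W z ->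
  (forall Z, T_minus F z Z -> curvature_at F z X Y Z = 0) <-> theta_curv X Y z = 0.
Proof.
move=> Wz; split=> [H|H Z /T_minusP[a ->]].
  apply: mulmx_all_eq0 => a; have := H _ (T_minus_comb z a).
  rewrite curvature_minus// comb_minusE => -[/(congr1 trmx)]; rewrite trmxK trmx0//.
rewrite curvature_minus// H mul0mx /comb_minus big1// => k _; by rewrite mxE scale0r.
Qed.

Lemma curvature_vanishes_plus z X Y : W z ->
  (forall Z, T_plus z Z -> curvature_at F z X Y Z = 0) <-> theta_curv X Y z = 0.
Proof.
move=> Wz; split=> [H|H Z /T_plusP[a ->]].
  apply: mulmx_all_eq0 => a; have := H _ (T_plus_comb z a).
  rewrite curvature_plus// comb_plusE => -[/(congr1 trmx)]; rewrite trmxK trmx0//.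
rewrite curvature_plus// H mul0mx /comb_plus big1// => k _; by rewrite mxE scale0r.
Qed.

End CurvatureFormula.

(** * Equations that are quadratic in the velocity *)

Section NormalForm.
Context {R : realType} {n : nat}.
Local Notation E1 := (E1 R n).
Local Notation E0 := (R * 'rV[R]_n)%type.
Variables (F : E1 -> 'rV[R]_n) (V : set 'rV[R]_n).
Hypothesis oV : open V.

Definition over0 : set E0 := [set e | V e.2].
Definition over1 : set E1 := [set z | V z.1.2].

Lemma open_over0 : open over0.
Proof. by apply: open_comp oV => e _; exact: cvg_snd. Qed.

Lemma open_over1 : open over1.
Proof. by apply: (open_comp _ open_over0) => z _; exact: cvg_fst. Qed.

Hypothesis CF : forall k, Ck k over1 F.
Local Notation smooth1 := (smooth_scalar over1).

Definition coords0 : coords E0 := coords_prod (@coordsR R) (coords_rV n).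
Definition coords1 : coords E1 := coords_prod coords0 (coords_rV n).

Lemma derive_vert (g : E1 -> R) z (v : 'rV[R]_n) : over1 z -> Ck 1 over1 g ->
  'D_((0, v) : E1) g z = \sum_l v 0 l * pdot l g z.
Proof.
move=> Oz Cg.
have lin (r : seq 'I_n) : 'D_((0, \sum_(l <- r) v 0 l *: delta_mx 0 l) : E1) g z =
    \sum_(l <- r) v 0 l * pdot l g z.
  elim: r => [|l r IH]; first by rewrite !big_nil derive0.
  rewrite !big_cons -IH /pdot.
  rewrite -(derive_lin coords1 (v 0 l) _ _ open_over1 Oz Cg).
  congr (derive _ _ _); congr pair; rewrite /= ?scaler0 ?addr0//.
by rewrite -lin -row_sum_delta.
Qed.

Lemma is_derive_fibre_line (g : E1 -> R) (e : E0) (v : 'rV[R]_n) (s : R) : over0 e -> Ck 1 over1 g ->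
  is_derive s 1 (fun s : R => g (e, s *: v)) (\sum_l v 0 l * pdot l g (e, s *: v)).
Proof.
move=> Oe Cg; rewrite -(derive_vert (z := (e, s *: v)) v Oe Cg).
have X (h : R) : ((e, 0) : E1) + h *: ((0, v) : E1) = (e, h *: v).
  by congr pair; rewrite /= ?scaler0 ?add0r ?addr0.
have -> : (fun s : R => g (e, s *: v)) = fun s => g (((e, 0) : E1) + s *: ((0, v) : E1)).
  by apply/funext => h; rewrite X.
rewrite -X; apply: is_derive_line; rewrite X; have O1 : over1 (e, s *: v) by []. exact: (Ck_derivable Cg O1).
Qed.

Lemma fibre_line_const (g : R -> R) : (forall s : R, is_derive s 1 g 0) -> g 1 = g 0.
Proof.
move=> H; have [u _] := @MVT_from_zero R g (fun=> 0) 1 (fun u _ => H u).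
by rewrite mulr0 => /eqP; rewrite subr_eq0 => /eqP.
Qed.

(** If F is quadratic in v, these are its coefficients: by [fibre_zeroth],
    F = ccoef - 2 bcoef v - sum_j v_j hcoef_j v. The form Theta = bcoef dt + sum_j hcoef_j dx^j lives
    on the space of (t, x). *)
Definition bcoef : E0 -> 'M[R]_n := locked (fun e =>
  \matrix_(k, i) (- 2^-1 * dF F i k (e, 0))).
Definition hcoef : 'I_n -> E0 -> 'M[R]_n := locked (fun j e =>
  \matrix_(k, i) (- 2^-1 * pdot i (dF F j k) (e, 0))).
Definition ccoef (e : E0) : 'cV[R]_n := (F (e, 0))^T.
Definition Theta : E0 -> E0 -> 'M[R]_n := locked (fun e w : E0 =>
  w.1 *: bcoef e + \sum_j w.2 0 j *: hcoef j e).

Lemma ThetaE e w : Theta e w = w.1 *: bcoef e + \sum_j w.2 0 j *: hcoef j e.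
Proof. by rewrite /Theta -lock. Qed.

Lemma Theta_lin e a v w : Theta e (a *: v + w) = a *: Theta e v + Theta e w.
Proof.
rewrite !ThetaE /= scalerDr scalerDl -[RHS]addrA [X in _ = _ + X]addrCA [RHS]addrA.
rewrite scalerA; congr (_ + _).
rewrite scaler_sumr -big_split/=; apply: eq_bigr => j _.
by rewrite !mxE scalerDl scalerA.
Qed.

Lemma hcoefE j e k i : hcoef j e k i = - 2^-1 * pdot i (dF F j k) (e, 0).
Proof. by rewrite /hcoef -lock mxE. Qed.

Lemma bcoefE e k i : bcoef e k i = - 2^-1 * dF F i k (e, 0).
Proof. by rewrite /bcoef -lock mxE. Qed.

Lemma hcoef_sym j i e k : over0 e -> hcoef j e k i = hcoef i e k j.
Proof.
move=> Oe; rewrite !hcoefE.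
have S := Schwarz ((0, 0, delta_mx 0 i) : E1) ((0, 0, delta_mx 0 j) : E1) open_over1
  (Oe : over1 (e, 0)) (smoothF open_over1 CF k 2).
by rewrite /dF /pdot S.
Qed.

(** The lower indices of the coefficients of [hcoef] come from a second derivative of F. *)
Lemma Theta_torsion_free e (xi eta : 'rV[R]_n) : over0 e ->
  Theta e (0, xi) *m eta^T = Theta e (0, eta) *m xi^T.
Proof.
move=> Oe; rewrite !ThetaE /= !scale0r !add0r; apply/matrixP => k l.
have L (x y : 'rV[R]_n) : ((\sum_j x 0 j *: hcoef j e) *m y^T) k l =
    \sum_i \sum_j x 0 j * hcoef j e k i * y 0 i.
  rewrite mxE; apply: eq_bigr => i _; rewrite summxE mulr_suml; apply: eq_bigr => j _.
  by rewrite [X in X * _]mxE [y^T _ _]mxE ord1.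
rewrite !L exchange_big/=; apply: eq_bigr => j _; apply: eq_bigr => i _.
by rewrite (hcoef_sym j i k Oe); ring.
Qed.

Lemma smooth_zero_section k (g : E1 -> R) : smooth1 g -> Ck k over0 (fun e => g (e, 0)).
Proof.
move=> Cg; apply: (Ck_comp_scalar coords1 open_over0 open_over1
  (f := fun e : E0 => (e, 0) : E1) (g := g)) => //.
apply: Ck_clin; exact: clinear_pair (clinear_id _) (clinear0 _ _).
Qed.

Lemma smooth_bcoef k : MCk k over0 bcoef.
Proof.
move=> i j; rewrite (_ : (fun z => _) = fun e => (fun z => - 2^-1 * dF F j i z) (e, 0)).
  apply: (@smooth_zero_section k (fun z => - 2^-1 * dF F j i z)).
  apply: (smooth_mul open_over1); first exact: smooth_cst.
  exact: (smooth_dF open_over1 CF j i).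
by apply/funext => e; rewrite bcoefE.
Qed.

Lemma smooth_hcoef l k : MCk k over0 (hcoef l).
Proof.
move=> i j; rewrite (_ : (fun z => _) = fun e => (fun z => - 2^-1 * pdot j (dF F l i) z) (e, 0)).
  apply: (@smooth_zero_section k (fun z => - 2^-1 * pdot j (dF F l i) z)).
  apply: (smooth_mul open_over1); first exact: smooth_cst.
  exact: (smooth_derive _ (smooth_dF open_over1 CF l i)).
by apply/funext => e; rewrite hcoefE.
Qed.

Lemma smooth_ccoef k : MCk k over0 ccoef.
Proof.
move=> i j; rewrite (_ : (fun z => _) = fun e => (fun z => F z 0 i) (e, 0)).
  apply: (@smooth_zero_section k (fun z => F z 0 i)); exact: (smoothF open_over1 CF i).
by apply/funext => e; rewrite mxE ord1.
Qed.

Lemma smooth_Theta k w : MCk k over0 (Theta ^~ w).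
Proof.
have oO := open_over0.
rewrite (_ : Theta ^~ w = fun e => w.1 *: bcoef e + \sum_j w.2 0 j *: hcoef j e); last first.
  by apply/funext => e; exact: ThetaE.
apply: MCk_add => //; first exact: (MCk_scale _ oO (smooth_bcoef k)).
by apply: MCk_sum => // j; exact: (MCk_scale _ oO (smooth_hcoef j k)).
Qed.

Hypothesis third0 : forall z i j k l, over1 z -> pdot l (pdot i (dF F j k)) z = 0.

Let dFs i k := smooth_dF open_over1 CF i k.

(** With vanishing third derivatives, F and its derivatives on a fibre are found by integration
    along the line s |-> (e, s v), starting at the zero velocity. *)
Lemma fibre_second e v i j k : over0 e ->
  pdot i (dF F j k) (e, v) = - 2 * hcoef j e k i.
Proof.
move=> Oe; rewrite hcoefE mulrA mulrNN divff// mul1r.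
have := @fibre_line_const (fun s => pdot i (dF F j k) (e, s *: v)).
rewrite scale1r scale0r; apply => s.
apply: is_derive_eq (is_derive_fibre_line v s Oe (smooth_derive _ (dFs j k) 1)) _.
by rewrite big1// => l _; rewrite third0// mulr0.
Qed.

Lemma fibre_first e v i k : over0 e ->
  dF F i k (e, v) = - 2 * (bcoef e k i + \sum_j v 0 j * hcoef j e k i).
Proof.
move=> Oe; have := @fibre_line_const (fun s => dF F i k (e, s *: v)
  + s * (2 * \sum_j v 0 j * hcoef j e k i)).
rewrite scale1r scale0r mul0r mul1r addr0 => H.
have K : dF F i k (e, v) + 2 * \sum_j v 0 j * hcoef j e k i = dF F i k (e, 0).
  apply: H => s; apply: is_derive_eq.
    apply: is_deriveD; first exact: (is_derive_fibre_line v s Oe (dFs i k 1)).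
  rewrite scaler0 add0r [_%:A]mulr1 mulr_sumr -big_split/= big1// => l _.
  by rewrite fibre_second// (hcoef_sym i l k Oe); ring.
apply: (addIr (2 * \sum_j v 0 j * hcoef j e k i)); rewrite K bcoefE; by field.
Qed.

Lemma fibre_zeroth e v : over0 e ->
  (F (e, v))^T = ccoef e - 2 *: (bcoef e *m v^T) - Theta e (0, v) *m v^T.
Proof.
move=> Oe; apply/colP => k.
pose B := (bcoef e *m v^T) k 0; pose Q := (Theta e (0, v) *m v^T) k 0.
have QE : Q = \sum_i v 0 i * \sum_j v 0 j * hcoef j e k i.
  rewrite /Q ThetaE/= scale0r add0r mxE; apply: eq_bigr => i _.
  by rewrite summxE [v^T _ _]mxE mulrC; congr (_ * _); apply: eq_bigr => j _; rewrite mxE.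
have BE : B = \sum_i v 0 i * bcoef e k i.
  by rewrite /B mxE; apply: eq_bigr => i _; rewrite [v^T _ _]mxE mulrC.
have := @fibre_line_const (fun s => F (e, s *: v) 0 k + (s * (2 * B) + s * (s * Q))).
rewrite scale1r scale0r !mul0r !addr0 !mul1r => H.
rewrite [LHS]mxE [RHS]mxE [X in _ = X + _]mxE [X in _ = _ + X]mxE.
rewrite [X in _ = _ + X + _]mxE [X in _ = _ - X + _]mxE -/B -/Q.
rewrite [ccoef e k 0]mxE.
suff K : F (e, v) 0 k + (2 * B + Q) = F (e, 0) 0 k by rewrite -K; ring.
apply: H => s; apply: is_derive_eq.
  apply: is_deriveD; first exact: (is_derive_fibre_line v s Oe (smoothF open_over1 CF k 1)).
rewrite /GRing.scale/=.
have -> : \sum_l v 0 l * pdot l (fun z => F z 0 k) (e, s *: v) = - 2 * B - 2 * s * Q.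
  rewrite BE QE !mulr_sumr -sumrB; apply: eq_bigr => i _.
  rewrite -[pdot i _]/(dF F i k) fibre_first//.
  under eq_bigr do rewrite mxE -mulrA.
  by rewrite -mulr_sumr; ring.
by rewrite /cst; ring.
Qed.

(** The velocity enters [theta] through the derivatives of F and through omega; for quadratic F both
    contributions cancel. *)
Lemma theta_base Y z : over1 z -> theta F Y z = Theta z.1 Y.1.
Proof.
case: z => e v Oe; apply/matrixP => k i; rewrite [LHS]mxE fibre_first//.
have -> : \sum_j omega j (e, v) Y * pdot i (dF F j k) (e, v) =
    - 2 * (\sum_(j < n) Y.1.2 0 j * hcoef j e k i) + 2 * Y.1.1 * \sum_j v 0 j * hcoef j e k i.
  rewrite !mulr_sumr -big_split/=; apply: eq_bigr => j _.
  by rewrite fibre_second// /omega/=; ring.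
have -> : Theta e Y.1 k i = Y.1.1 * bcoef e k i + \sum_(j < n) Y.1.2 0 j * hcoef j e k i.
  rewrite ThetaE mxE [X in X + _]mxE summxE; congr (_ + _).
  by apply: eq_bigr => j _; rewrite mxE.
by field.
Qed.

Definition base_curv (v w e : E0) : 'M[R]_n :=
  dM v (Theta ^~ w) e - dM w (Theta ^~ v) e + Theta e v *m Theta e w - Theta e w *m Theta e v.

Lemma theta_curv_base X Y z : over1 z -> theta_curv F X Y z = base_curv X.1 Y.1 z.1.
Proof.
move=> Oz.
have D1 S T : dM S (theta F T) z = dM S.1 (Theta ^~ T.1) z.1.
  apply: mderive_dM; apply: (mderive_eq open_over1 Oz (P := fun z => Theta z.1 T.1)).
    by move=> y Oy; rewrite theta_base.
  apply: (mderive_chain coords0 (f := fst) open_over0) => //.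
    exact: smooth_Theta.
  exact: (is_derive_clin_id (clinear_fst _ _)).
by rewrite /theta_curv !D1 !theta_base.
Qed.

End NormalForm.

(** * The curvature conditions on the base *)

Section BaseConditions.
Context {R : realType} {n : nat}.
Local Notation E1 := (E1 R n).
Local Notation E0 := (R * 'rV[R]_n)%type.
Variables (F : E1 -> 'rV[R]_n) (V : set 'rV[R]_n).
Hypothesis oV : open V.
Local Notation over0 := (over0 V).
Local Notation over1 := (over1 V).
Hypothesis CF : forall k, Ck k over1 F.
Local Notation Theta := (Theta F).
Local Notation base_curv := (base_curv F).

Lemma theta_vertical (d : 'rV[R]_n) w : theta F (0, 0, d) w = 0.
Proof.
apply/matrixP => k i; rewrite [LHS]mxE [RHS]mxE mul0r add0r big1 ?mulr0// => j _.
by rewrite /omega/= mxE mulr0 subrr mul0r.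
Qed.

Lemma theta_unit_horizontal (X : E1) j w k i : X.1 = (0, delta_mx 0 j) ->
  theta F X w k i = - 2^-1 * pdot i (dF F j k) w.
Proof.
move=> X1; rewrite [LHS]mxE X1 /= mul0r add0r (bigD1 j)//= /omega X1/= mxE !eqxx mulr0 subr0.
rewrite mul1r big1 ?addr0// => l lj.
by rewrite mxE eqxx (negbTE lj) mulr0 subr0 mul0r.
Qed.

(** [theta] vanishes on vertical vectors. For X in T^- over the j-th coordinate direction and
    Y = d/dv^l, only the derivative along Y of theta X remains, and theta X has the entries
    - F^k_(v^i v^j) / 2. *)
Lemma third_derivatives_vanish :
  (forall z X Y, over1 z -> T_minus F z X -> T_plus z Y -> theta_curv F X Y z = 0) ->
  forall z i j k l, over1 z -> pdot l (pdot i (dF F j k)) z = 0.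
Proof.
move=> H z i j k l Oz; have oO := open_over1 oV.
have := H z _ _ Oz (T_minus_comb F z (delta_mx j 0)) (T_plus_comb z (delta_mx l 0)).
rewrite comb_plusE trmx_delta /theta_curv.
set X := comb_minus F z (delta_mx j 0); set Y : E1 := (0, 0, delta_mx 0 l).
have X1 : X.1 = (0, delta_mx 0 j) by rewrite /X comb_minusE trmx_delta.
rewrite (_ : theta F Y = fun=> 0); last by apply/funext => w; exact: theta_vertical.
rewrite mul0mx mulmx0 subr0 addr0 (mderive_dM (mderive_cst 0 z X)) sub0r.
move=> /eqP; rewrite oppr_eq0 => /eqP/matrixP/(_ k i).
rewrite [LHS]mxE [RHS]mxE.
rewrite (_ : (fun w => theta F X w k i) = (- 2^-1) \*: (pdot i (dF F j k))); last first.
  by apply/funext => w; rewrite (theta_unit_horizontal w k i X1).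
rewrite deriveZ; last first.
  exact: (Ck_derivable (smooth_derive _ (smooth_dF oO CF j k) 1) Oz).
move=> /eqP; rewrite scaler_eq0 oppr_eq0 invr_eq0 pnatr_eq0/= => /eqP.
exact.
Qed.

Hypothesis third0 : forall z i j k l, over1 z -> pdot l (pdot i (dF F j k)) z = 0.

Lemma over1_lift e v : over0 e -> over1 (e, v).
Proof. by []. Qed.

Lemma base_flat_fibres :
  (forall z X Y, over1 z -> T_minus F z X -> T_minus F z Y -> theta_curv F X Y z = 0) ->
  forall e xi eta, over0 e -> base_curv (0, xi) (0, eta) e = 0.
Proof.
move=> H e xi eta Oe.
have Oz : over1 (e, 0) by exact: over1_lift.
have := H _ _ _ Oz (T_minus_comb F (e, 0) xi^T) (T_minus_comb F (e, 0) eta^T).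
by rewrite (theta_curv_base oV CF third0)// !comb_minusE !trmxK.
Qed.

Lemma base_curv_linl a v v' w e : over0 e ->
  base_curv (a *: v + v') w e = a *: base_curv v w e + base_curv v' w e.
Proof.
move=> Oe; have oO := open_over0 oV.
have CT u k : MCk k over0 (Theta ^~ u) by exact: smooth_Theta.
have D1 : dM (a *: v + v') (Theta ^~ w) e = a *: dM v (Theta ^~ w) e + dM v' (Theta ^~ w) e.
  exact: (dM_lin (coords0 (n := n)) a v v' oO Oe (CT w 1)).
have D2 : dM w (Theta ^~ (a *: v + v')) e = a *: dM w (Theta ^~ v) e + dM w (Theta ^~ v') e.
  apply: mderive_dM.
  rewrite (_ : Theta ^~ _ = fun y => a *: Theta y v + Theta y v'); last first.
    by apply/funext => y; exact: Theta_lin.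
  apply: mderive_add; last exact: (MCk_mderive w (CT v' 1) Oe).
  have := mderive_scale (is_derive_cst a e w) (MCk_mderive w (CT v 1) Oe).
  by rewrite scale0r add0r.
rewrite /base_curv D1 D2 !Theta_lin (mulmxDr (Theta e w) (a *: Theta e v)) mulmxDl.
rewrite -scalemxAl -(scalemxAr a (Theta e w)).
rewrite !opprD [X in X + _ + _ = _]addrACA [X in X + _ = _]addrACA [LHS]addrACA.
by rewrite -scalerBr -scalerDr -scalerBr.
Qed.

Lemma base_curv_anti v w e : base_curv v w e = - base_curv w v e.
Proof.
by rewrite /base_curv !opprB opprD opprB addrA [RHS]addrAC [X in _ = X]addrC !addrA.
Qed.

Lemma time_space_split (w : E0) : w = w.1 *: ((1, 0) : E0) + (0, w.2).
Proof.
by case: w => t x; congr pair; rewrite /= ?scaler0 ?add0r ?addr0 // [_ *: _]mulr1.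
Qed.

(** The vectors X^sigma at (e, v) project to (1, v) for all v, so (i) already contains, by
    differences, the flatness in pairs of space directions. *)
Lemma base_flat :
  (forall z X Y, over1 z -> T_sigma F z X -> T_minus F z Y -> theta_curv F X Y z = 0) ->
  forall e v w, over0 e -> base_curv v w e = 0.
Proof.
move=> H e v w Oe.
have B1 xi eta : base_curv (1, xi) (0, eta) e = 0.
  have Oz : over1 (e, xi) by exact: over1_lift.
  have := H _ _ _ Oz erefl (T_minus_comb F (e, xi) eta^T).
  by rewrite (theta_curv_base oV CF third0)// !comb_minusE !trmxK.
(* (1, xi) is the sum of (1, 0) and (0, xi) *)
have B0 xi eta : base_curv (0, xi) (0, eta) e = 0.
  have := B1 xi eta; rewrite (time_space_split (1, xi)) base_curv_linl//= scale1r B1 add0r.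
  exact.
have B2 eta : base_curv (0, eta) (1, 0) e = 0 by rewrite base_curv_anti B1 oppr0.
have B3 : base_curv (1, 0) (1, 0) e = 0 by rewrite /base_curv !subrr add0r subrr.
rewrite (time_space_split v) base_curv_linl// base_curv_anti.
rewrite [base_curv (0, _) w e]base_curv_anti (time_space_split w) !base_curv_linl//.
by rewrite B3 B2 B0 B1 !scaler0 !addr0 !oppr0 scaler0 addr0.
Qed.

(** The translation part of the affine connection on R x M whose linear part is [Theta]; its
    horizontal vectors over w at the velocity v have the vertical part [hfib]. *)
Definition cform (e w : E0) : 'cV[R]_n := w.1 *: ccoef F e - bcoef F e *m w.2^T.

Lemma cform_lin e a v w : cform e (a *: v + w) = a *: cform e v + cform e w.
Proof.
rewrite /cform /= scalerDl linearP /= mulmxDr -scalemxAr opprD scalerBr scalerA.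
by rewrite addrACA.
Qed.

Lemma smooth_cform k w : MCk k over0 (cform ^~ w).
Proof.
have oO := open_over0 oV; apply: MCk_add => //.
  exact: (MCk_scale _ oO (smooth_ccoef oV CF k)).
apply: MCk_opp => //; apply: MCk_mul => //; first exact: (smooth_bcoef oV CF k).
exact: MCk_cst.
Qed.

End BaseConditions.

(** * The condition K = 0 on the base *)

Lemma is_derive_pair {R : realType} {U E V : normedModType R} (b : coords E) (c : coords V)
    (f : U -> E) (g : U -> V) x v df dg :
  is_derive x v f df -> is_derive x v g dg -> is_derive x v (fun y => (f y, g y)) (df, dg).
Proof.
move=> Hf Hg; apply: (is_derive_coords (b := coords_prod b c)) => i /=.
case: (fintype.split i) => j /=.
  exact: (is_derive_clin (ccoord_lin b j) Hf).
exact: (is_derive_clin (ccoord_lin c j) Hg).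
Qed.

Section KCondition.
Context {R : realType} {n : nat}.
Local Notation E1 := (E1 R n).
Local Notation E0 := (R * 'rV[R]_n)%type.
Variables (F : E1 -> 'rV[R]_n) (V : set 'rV[R]_n).
Hypothesis oV : open V.
Local Notation over0 := (over0 V).
Local Notation over1 := (over1 V).
Hypothesis CF : forall k, Ck k over1 F.
Hypothesis third0 : forall z i j k l, over1 z -> pdot l (pdot i (dF F j k)) z = 0.
Local Notation Theta := (Theta F).
Local Notation base_curv := (base_curv F).
Local Notation cform := (cform F).

Definition hfib (w : E0) (z : E1) : 'cV[R]_n := cform z.1 w - Theta z.1 w *m z.2^T.

Lemma Theta_split e (w : E0) : Theta e w = w.1 *: bcoef F e + Theta e (0, w.2).
Proof. by rewrite !ThetaE /= scale0r add0r. Qed.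

(** For quadratic F the horizontal distribution is that of an affine connection. *)
Lemma horE X z : over1 z -> hor F (cst X) z = (X.1, (hfib X.1 z)^T).
Proof.
case: z => e v Oz.
have -> : hor F (cst X) (e, v) = assemble F (e, v) X.1.1 (hcomp (e, v) X) 0.
  rewrite /assemble /hor [comb_plus _ _](_ : _ = 0) ?addr0; last first.
    by rewrite /comb_plus big1// => k _; rewrite mxE scale0r.
  congr (_ + _); apply: eq_bigr => i _; by rewrite mxE.
have hE : hcomp (e, v) X = X.1.2^T - X.1.1 *: v^T.
  by apply/colP => i; rewrite !mxE /omega/= mulrC.
rewrite assembleE hE [RHS]surjective_pairing; congr pair.
  rewrite [RHS]surjective_pairing /=; congr pair.
  by rewrite linearB /= trmxK linearZ /= trmxK addrC subrK.
rewrite trmx0 addr0 /=.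
apply: (can_inj (@trmxK _ _ _)); rewrite trmxK linearD /= linearZ /=.
rewrite (fibre_zeroth oV CF third0 v Oz).
have -> : (\row_j \sum_k (X.1.2^T - X.1.1 *: v^T) k 0 * (2^-1 * dF F k j (e, v)))^T =
    - ((bcoef F e + Theta e (0, v)) *m (X.1.2^T - X.1.1 *: v^T)).
  apply/colP => j; rewrite [LHS]mxE [LHS]mxE [RHS]mxE [X in _ = - X]mxE -sumrN.
  apply: eq_bigr => k _; rewrite (fibre_first oV CF third0 v k j Oz).
  rewrite [(_ + Theta _ _) _ _]mxE.
  have -> : Theta e (0, v) j k = \sum_l v 0 l * hcoef F l e j k.
    rewrite ThetaE/= scale0r add0r summxE; apply: eq_bigr => l _; by rewrite mxE.
  by field.
rewrite /hfib /cform /= (Theta_split e X.1) !mulmxDl !mulmxDr !mulmxN -!scalemxAr -scalemxAl.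
rewrite (Theta_torsion_free oV CF X.1.2 v Oz).
rewrite !scalerBr scalerA.
move: (X.1.1 *: ccoef F e) (bcoef F e *m v^T) (Theta e (0, v) *m v^T)
  (bcoef F e *m X.1.2^T) (Theta e (0, v) *m X.1.2^T) => a1 a2 a3 a4 a5.
by apply/matrixP => i j; rewrite !mxE; ring.
Qed.

Lemma smooth_hfib w k : MCk k over1 (hfib w).
Proof.
have oO := open_over1 oV; have oO0 := open_over0 oV.
have pull m1 m2 (P : E0 -> 'M[R]_(m1, m2)) : MCk k over0 P -> MCk k over1 (fun z => P z.1).
  move=> CP i j; apply: (Ck_comp_scalar (coords0 (n := n)) oO oO0 (f := fst)
    (g := fun e => P e i j)) => //.
  exact: (Ck_clin (clinear_fst _ _)).
apply: MCk_add => //; first exact: (pull _ _ (cform ^~ w) (smooth_cform oV CF k w)).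
apply: MCk_opp => //; apply: MCk_mul => //.
  exact: (pull _ _ (Theta ^~ w) (smooth_Theta oV CF k w)).
apply: MCk_tr => i j.
exact: (Ck_clin (clinear_comp (@clinear_snd R _ _) (@clinear_coord R 1 n i j))).
Qed.

Lemma dM_hfib (w : E0) z (X : E1) : over1 z ->
  dM X (hfib w) z = dM X.1 (cform ^~ w) z.1
    - (dM X.1 (Theta ^~ w) z.1 *m z.2^T + Theta z.1 w *m X.2^T).
Proof.
move=> Oz; have oO0 := open_over0 oV.
have pull m1 m2 (P : E0 -> 'M[R]_(m1, m2)) : MCk 1 over0 P ->
    mderive z X (fun z => P z.1) (dM X.1 P z.1).
  move=> CP; apply: (mderive_chain (coords0 (n := n)) (f := fst) oO0) => //.
  exact: (is_derive_clin_id (clinear_fst _ _)).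
apply: mderive_dM; apply: mderive_add.
  exact: (pull _ _ (cform ^~ w) (smooth_cform oV CF 1 w)).
apply: mderive_opp; apply: mderive_mul.
  exact: (pull _ _ (Theta ^~ w) (smooth_Theta oV CF 1 w)).
apply: mderive_tr => i j.
exact: (is_derive_clin_id (clinear_comp (@clinear_snd R _ _) (@clinear_coord R 1 n i j))).
Qed.

Lemma derive_hor X (Y : E1) z : over1 z ->
  'D_X (hor F (cst Y)) z = (0, (dM X (hfib Y.1) z)^T).
Proof.
move=> Oz; have oO := open_over1 oV.
suff [_ <-] : is_derive z X (fun w => ((Y.1, (hfib Y.1 w)^T) : E1)) (0, (dM X (hfib Y.1) z)^T).
  by apply: near_eq_derive; apply: filterS (open_near oO Oz) => w Ow; rewrite horE.
have H := MCk_mderive X (smooth_hfib Y.1 1) Oz.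
apply: (is_derive_pair (coords0 (n := n)) (coords_rV n) (is_derive_cst Y.1 z X)).
exact: is_derive_row.
Qed.

Lemma K_vanishes_at z X Y : over1 z -> K_at F z X Y = 0 ->
  dM (hor F (cst X) z) (hfib Y.1) z = dM (hor F (cst Y) z) (hfib X.1) z.
Proof.
move=> Oz; rewrite /K_at /K_form /ver /bracket.
set B := _ - _.
have -> : \sum_i coframe F (Some (inr i)) z B *: X_plus i z = comb_plus z (vcomp F z B).
  by apply: eq_bigr => i _; rewrite mxE.
rewrite comb_plusE => -[/(congr1 trmx)]; rewrite trmxK trmx0 => H.
have BE : B = (0, (dM (hor F (cst X) z) (hfib Y.1) z - dM (hor F (cst Y) z) (hfib X.1) z)^T).
  rewrite /B !derive_hor//; congr pair; rewrite /= ?subr0//.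
  by rewrite linearB.
move: H; rewrite BE; set Q := _ - _ => H.
apply/eqP; rewrite -subr_eq0 -/Q; apply/eqP; rewrite -[RHS]H.
apply/colP => i; rewrite [RHS]mxE /= mulr0 subr0 big1 ?mulr0 ?subr0; first by rewrite [RHS]mxE.
by move=> l _; rewrite /omega/= mulr0 subr0 mxE mul0r.
Qed.

(** The curvature of an affine connection at the velocity v is affine in v: its linear part is
    [base_curv], and its constant part is the covariant exterior derivative of [cform]. *)
Lemma K_flat : (forall z X Y, over1 z -> K_at F z X Y = 0) ->
  forall e v w, over0 e -> base_curv v w e = 0 /\
    dM v (cform ^~ w) e - dM w (cform ^~ v) e
      - Theta e w *m cform e v + Theta e v *m cform e w = 0.
Proof.
move=> H e v w Oe.
have K eta := K_vanishes_at (over1_lift eta Oe) (H (e, eta) ((v, 0) : E1) ((w, 0) : E1) (over1_lift eta Oe)).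
have {K} K eta : dM v (cform ^~ w) e - (dM v (Theta ^~ w) e *m eta^T
      + Theta e w *m (cform e v - Theta e v *m eta^T)) =
    dM w (cform ^~ v) e - (dM w (Theta ^~ v) e *m eta^T
      + Theta e v *m (cform e w - Theta e w *m eta^T)).
  have Oz := over1_lift eta Oe; have := K eta.
  by rewrite !dM_hfib// !horE// !trmxK.
have K0 : dM v (cform ^~ w) e - dM w (cform ^~ v) e
      - Theta e w *m cform e v + Theta e v *m cform e w = 0.
  have := K 0; rewrite trmx0 !mulmx0 !add0r !subr0 => E.
  by rewrite [X in X + _]addrAC E [X in X + _]addrAC subrr add0r addNr.
split=> //; apply: mulmx_all_eq0 => eta; have := K eta^T; rewrite trmxK.
have -> : dM v (cform ^~ w) e = dM w (cform ^~ v) e + Theta e w *m cform e v - Theta e v *m cform e w.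
  by apply/eqP; rewrite -subr_eq0 -[X in _ == X]K0; apply/eqP;
    rewrite opprD opprK opprD !addrA.
rewrite /base_curv !(mulmxDl, mulmxBr, mulNmx) !mulmxA.
move: (dM w (cform ^~ v) e) (Theta e w *m cform e v) (Theta e v *m cform e w)
  (dM v _ e *m eta) (dM w _ e *m eta) (Theta e v *m _ *m eta) (Theta e w *m _ *m eta).
move=> a1 a2 a3 a4 a5 a6 a7 /matrixP E.
apply/matrixP => i j; have := E i j; rewrite !mxE => E'; lra.
Qed.

End KCondition.

(** * Adapted coordinates *)

Section AdaptedCoordinates.
Context {R : realType} {n : nat}.
Local Notation E1 := (E1 R n).
Local Notation E0 := (R * 'rV[R]_n)%type.
Variables (F : E1 -> 'rV[R]_n) (V : set 'rV[R]_n).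
Hypothesis oV : open V.
Local Notation over0 := (over0 V).
Local Notation over1 := (over1 V).
Hypothesis CF : forall k, Ck k over1 F.
Local Notation Theta := (Theta F).
Local Notation base_curv := (base_curv F).
Local Notation cform := (cform F).
Local Notation dt := ((1, 0) : E0).
Variable e0 : E0.
Hypothesis e0V : over0 e0.

(** The new space coordinates u, their Jacobian p in the space directions, and its inverse y; the
    equation for p says that its rows are parallel for [Theta] along the fibres t = const. The
    values at e0 make the derivative of (t, x) |-> (t, u) at e0 the identity. *)
Record adapted (r : R) (u : E0 -> 'cV[R]_n) (p y : E0 -> 'M[R]_n) : Prop := Adapted {
  adapted_r : 0 < r;
  adapted_sub : ball e0 r `<=` over0;
  adapted_u : forall k, MCk k (ball e0 r) u;
  adapted_p : forall k, MCk k (ball e0 r) p;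
  adapted_y : forall k, MCk k (ball e0 r) y;
  adapted_py : forall e, ball e0 r e -> p e *m y e = 1%:M;
  adapted_yp : forall e, ball e0 r e -> y e *m p e = 1%:M;
  adapted_du : forall e xi, ball e0 r e -> mderive e (0, xi) u (p e *m xi^T);
  adapted_dp : forall e xi, ball e0 r e -> mderive e (0, xi) p (p e *m Theta e (0, xi));
  adapted_p0 : p e0 = 1%:M;
  adapted_u0 : u e0 = 0;
  adapted_ut0 : dM dt u e0 = 0 }.

Definition space_part (e : E0) : E0 := (0, e.2).

Lemma space_part_lin : clinear space_part.
Proof. exact: clinear_pair (clinear0 _ _) (clinear_snd _ _). Qed.

Lemma space_part_id e : space_part (space_part e) = space_part e.
Proof. by []. Qed.

Lemma space_partP v : space_part v = v -> v = (0, v.2).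
Proof. by []. Qed.

Lemma ball_center0 (x : E0) (r : R) : 0 < r -> ball x r x.
Proof. exact: ballxx. Qed.

(** The form p dx is closed along the fibres t = const because [Theta] is torsion-free, and u is its
    primitive. *)
Lemma coordinates_of_frame q (p y : E0 -> 'M[R]_n) : 0 < q -> ball e0 q `<=` over0 ->
  (forall k, MCk k (ball e0 q) p) -> (forall k, MCk k (ball e0 q) y) ->
  (forall e, ball e0 q e -> p e *m y e = 1%:M /\ y e *m p e = 1%:M) ->
  (forall e xi, ball e0 q e -> mderive e (0, xi) p (p e *m Theta e (0, xi))) ->
  p e0 = 1%:M ->
  exists r u, r <= q /\ adapted r u p y.
Proof.
move=> q0 qV Cp Cy py dp p0.
pose al (e w : E0) : 'cV[R]_n := p e *m w.2^T.
have oB : open (ball e0 q) by exact: ball_open.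
have [e a v w|k v|e v w Be pv pw|r r0 [rq [u [Cu du u0]]]] :=
  @primitive_of_closed_form R E0 (coords0 (n := n)) _ space_part_lin space_part_id e0 _ oB
    (ball_center0 e0 q0) n 1 al.
- by rewrite /al /= linearP /= mulmxDr -scalemxAr.
- apply: MCk_mul => //; exact: MCk_cst.
- have H (x z : 'rV[R]_n) : dM (0, x) (al ^~ (0, z)) e = p e *m Theta e (0, x) *m z^T.
    apply: mderive_dM; have := mderive_mul (dp e x Be) (mderive_cst z^T e (0, x)).
    by rewrite mulmx0 addr0.
  rewrite (space_partP pv) (space_partP pw) !H -!mulmxA.
  by rewrite (Theta_torsion_free oV CF _ _ (qV e Be)).
have r'0 : 0 < Num.min r q by rewrite lt_min r0.
have rr : ball e0 (Num.min r q) `<=` ball e0 r by apply: le_ball; rewrite ge_min lexx.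
have rq' : ball e0 (Num.min r q) `<=` ball e0 q by apply: le_ball; rewrite ge_min lexx orbT.
exists (Num.min r q), u; split; first by rewrite ge_min lexx orbT.
split=> //.
- by move=> e /rq'/qV.
- by move=> k; exact: MCk_sub rr (Cu k).
- by move=> k; exact: MCk_sub rq' (Cp k).
- by move=> k; exact: MCk_sub rq' (Cy k).
- by move=> e /rq'/py[].
- by move=> e /rq'/py[].
- by move=> e xi /rr Be; exact: (du e (0, xi) Be).
- by move=> e xi /rq'; exact: dp.
- by apply: u0; [exact: ball_center0|rewrite /space_part subrr].
- apply: mderive_dM => i j; rewrite mxE; apply/is_deriveP => ep ep0.
  exists r => // h h0 hs.
  have Bh : ball e0 r (e0 + h *: dt).
    rewrite -ball_normE /ball_/= opprD addNKr normrN normrZ.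
    rewrite (_ : `|dt| = 1) ?mulr1//.
    by rewrite prod_normE /= normr0 normr1 max_l.
  rewrite (u0 _ Bh) ?(u0 e0 (ball_center0 e0 r0)) ?subrr ?/space_part//=.
    by rewrite scaler0 subrr normr0 mulr_ge0// ltW.
  by rewrite scaler0 addr0 subrr.
Qed.

Hypothesis third0 : forall z i j k l, over1 z -> pdot l (pdot i (dF F j k)) z = 0.

Theorem adapted_of_flat_fibres :
  (forall e xi eta, over0 e -> base_curv (0, xi) (0, eta) e = 0) ->
  exists r u p y, adapted r u p y.
Proof.
move=> flat; have oO := open_over0 oV.
have [e a v w|k v|e v w Oe pv pw|q q0 [qV [p [y [Cp Cy py dp p0]]]]] :=
  @frobenius R E0 (coords0 (n := n)) _ space_part_lin space_part_id e0 _ oO e0V n Theta.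
- exact: Theta_lin.
- exact: smooth_Theta.
- by rewrite (space_partP pv) (space_partP pw); exact: flat.
have z0 : space_part (e0 - e0) = 0 by rewrite /space_part subrr.
have [r [u [_ Hu]]] := coordinates_of_frame q0 qV Cp Cy py
  (fun e xi Be => dp e (0, xi) Be erefl)
  (p0 e0 (ball_center0 e0 q0) z0).
by exists r, u, p, y.
Qed.

Lemma frame_of_flat : (forall e v w, over0 e -> base_curv v w e = 0) ->
  exists q (p y : E0 -> 'M[R]_n), [/\ 0 < q, ball e0 q `<=` over0,
    (forall k, MCk k (ball e0 q) p) /\ (forall k, MCk k (ball e0 q) y),
    forall e, ball e0 q e -> p e *m y e = 1%:M /\ y e *m p e = 1%:M &
    (forall e w, ball e0 q e -> mderive e w p (p e *m Theta e w)) /\ p e0 = 1%:M].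
Proof.
move=> flat; have oO := open_over0 oV.
have [e a v w|k v|e v w Oe _ _|q q0 [qV [p [y [Cp Cy py dp p0]]]]] :=
  @frobenius R E0 (coords0 (n := n)) id (clinear_id _) (fun=> erefl) e0 _ oO e0V n Theta.
- exact: Theta_lin.
- exact: smooth_Theta.
- exact: flat.
exists q, p, y; split=> //; split=> [e w Be|]; first exact: dp.
by apply: p0; [exact: ball_center0|rewrite subrr].
Qed.

(** The frame is parallel in the time direction as well, where [Theta] is [bcoef]. *)
Theorem adapted_of_flat :
  (forall e v w, over0 e -> base_curv v w e = 0) ->
  exists r u p y, adapted r u p y /\
    forall e, ball e0 r e -> dM dt p e = p e *m bcoef F e.
Proof.
move=> /frame_of_flat[q [p [y [q0 qV [Cp Cy] py [dp p0]]]]].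
have [r [u [rq Hu]]] := coordinates_of_frame q0 qV Cp Cy py (fun e xi Be => dp e (0, xi) Be) p0.
exists r, u, p, y; split=> // e Be; have Bq := le_ball rq Be.
rewrite (mderive_dM (dp e dt Bq)) ThetaE /= scale1r big1 ?addr0// => j _.
by rewrite mxE scale0r.
Qed.

(** The time derivative of u is prescribed too: the form - p cform is closed, its primitive g has
    g_t = - p C, and then g dt + p dx is closed. *)
Theorem adapted_of_K_zero :
  (forall e v w, over0 e -> base_curv v w e = 0 /\
    dM v (cform ^~ w) e - dM w (cform ^~ v) e
      - Theta e w *m cform e v + Theta e v *m cform e w = 0) ->
  exists r u p y, [/\ adapted r u p y,
    forall e, ball e0 r e -> dM dt p e = p e *m bcoef F e &
    forall e, ball e0 r e -> dM dt (dM dt u) e = - (p e *m ccoef F e)].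
Proof.
move=> H; have oO := open_over0 oV.
have [|q [p [y [q0 qV [Cp Cy] py [dp p0]]]]] := frame_of_flat.
  by move=> e v w Oe; have [] := H e v w Oe.
have oB : open (ball e0 q) by exact: ball_open.
have Cc k w : MCk k (ball e0 q) (cform ^~ w) by exact: MCk_sub qV (smooth_cform oV CF k w).
(* the differential of the time derivative g of u *)
pose al (e w : E0) : 'cV[R]_n := - (p e *m cform e w).
have [e a v w|k v|e v w Be _ _|q1 q10 [q1q [g [Cg dg g0]]]] :=
  @primitive_of_closed_form R E0 (coords0 (n := n)) id (clinear_id _) (fun=> erefl) e0 _ oB
    (ball_center0 e0 q0) n 1 al.
- by rewrite /al cform_lin mulmxDr -scalemxAr opprD scalerN.
- by apply: MCk_opp => //; exact: MCk_mul.
- have D v' w' : dM v' (al ^~ w') e =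
      - (p e *m Theta e v' *m cform e w' + p e *m dM v' (cform ^~ w') e).
    apply: mderive_dM; apply: mderive_opp; apply: mderive_mul; first exact: dp.
    exact: (MCk_mderive v' (Cc 1%N w') Be).
  have [_ E] := H e v w (qV e Be).
  rewrite !D; congr (- _); rewrite -!mulmxA -!mulmxDr; congr (_ *m _).
  apply/eqP; rewrite -subr_eq0 -[X in _ == X]E; apply/eqP.
  move: (dM v _ e) (dM w _ e) (Theta e w *m _) (Theta e v *m _) => a1 a2 a3 a4.
  by apply/matrixP => i j; rewrite !mxE; ring.
(* the differential of u *)
pose be (e w : E0) : 'cV[R]_n := w.1 *: g e + p e *m w.2^T.
have oB1 : open (ball e0 q1) by exact: ball_open.
have [e a v w|k v|e v w Be _ _|r r0 [rq1 [u [Cu du u0]]]] :=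
  @primitive_of_closed_form R E0 (coords0 (n := n)) id (clinear_id _) (fun=> erefl) e0 _ oB1
    (ball_center0 e0 q10) n 1 be.
- rewrite /be /= linearP /= mulmxDr -scalemxAr scalerDl scalerDr scalerA.
  by rewrite addrACA.
- apply: MCk_add => //; first exact: (MCk_scale _ oB1 (Cg k)).
  by apply: MCk_mul => //; [exact: MCk_sub q1q (Cp k)|exact: MCk_cst].
- have Bq := q1q e Be.
  have D (v' w' : E0) : dM v' (be ^~ w') e =
      w'.1 *: - (p e *m cform e v') + p e *m Theta e v' *m w'.2^T.
    apply: mderive_dM; apply: mderive_add.
      have := mderive_scale (is_derive_cst w'.1 e v') (dg e v' Be erefl).
      by rewrite scale0r add0r.
    have := mderive_mul (dp e v' Bq) (mderive_cst w'.2^T e v').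
    by rewrite mulmx0 addr0.
  rewrite !D /cform !(Theta_split F e v) !(Theta_split F e w) -!mulmxA !mulmxDl.
  rewrite (Theta_torsion_free oV CF v.2 w.2 (qV e Bq)) -!scalemxAl !mulmxBr !mulmxDr -!scalemxAr.
  rewrite !opprB !scalerBr !scalerA.
  move: (p e *m ccoef F e) (p e *m (bcoef F e *m v.2^T)) (p e *m (bcoef F e *m w.2^T))
    (p e *m (Theta e _ *m _)) => a1 a2 a3 a4.
  by apply/matrixP => i j; rewrite !mxE; ring.
have rq : ball e0 r `<=` ball e0 q by move=> e /rq1/q1q.
exists r, u, p, y; split.
- split=> //.
  + by move=> e /rq/qV.
  + by move=> k; exact: MCk_sub rq (Cp k).
  + by move=> k; exact: MCk_sub rq (Cy k).
  + by move=> e /rq/py[].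
  + by move=> e /rq/py[].
  + move=> e xi Be; have := du e (0, xi) Be erefl.
    by rewrite /be /= scale0r add0r.
  + by move=> e xi /rq Be; exact: dp.
  + by apply: u0; [exact: ball_center0|rewrite subrr].
  + rewrite (mderive_dM (du e0 dt (ball_center0 e0 r0) erefl)) /be /= trmx0 mulmx0 addr0 scale1r.
    by apply: g0; [exact: ball_center0|rewrite subrr].
- move=> e /rq Bq; rewrite (mderive_dM (dp e dt Bq)) ThetaE /= scale1r big1 ?addr0// => j _.
  by rewrite mxE scale0r.
- move=> e Be; have H1 := dg e dt (rq1 e Be) erefl.
  have E1 : forall e', ball e0 r e' -> g e' = dM dt u e'.
    move=> e' Be'; rewrite (mderive_dM (du e' dt Be' erefl)) /be /= trmx0 mulmx0 addr0.
    by rewrite scale1r.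
  have oBr : open (ball e0 r) by exact: ball_open.
  have H2 := mderive_eq oBr Be E1 H1.
  by rewrite (mderive_dM H2) /al /cform /= trmx0 mulmx0 subr0 scale1r.
Qed.

End AdaptedCoordinates.

(** * Charts, curves and jets *)

Lemma Ck_sin_cos {R : realType} k (D : set R) : open D ->
  Ck k D (sin : R -> R) /\ Ck k D (cos : R -> R).
Proof.
move=> oD.
have cs : {in D, continuous (sin : R -> R)} by move=> x _; exact: continuous_sin.
have cc : {in D, continuous (cos : R -> R)} by move=> x _; exact: continuous_cos.
have ds x w : is_derive x w (sin : R -> R) (w * cos x).
  by have := is_derive_scale_dir w (is_derive_sin x); rewrite [_ *: 1]mulr1.
have dc x w : is_derive x w (cos : R -> R) (w * - sin x).
  by have := is_derive_scale_dir w (is_derive_cos x); rewrite [_ *: 1]mulr1.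
elim: k => [|k [IHs IHc]]; first by [].
split; split=> // w; split=> [x _|].
- by case: (ds x w).
- apply: Ck_eq oD _ (Ck_scale w oD IHc) => x _.
  by have [_ ->] := ds x w.
- by case: (dc x w).
- apply: Ck_eq oD _ (Ck_scale (- w) oD IHs) => x _.
  by have [_ ->] := dc x w; rewrite /= /GRing.scale/= mulrN mulNr.
Qed.

Section Manifold.
Context {R : realType} {n : nat} {M : topologicalType}.
Variable A : set (chart M 'rV[R]_n).
Hypothesis atlasA : is_atlas A.
Implicit Types (c d : chart M 'rV[R]_n) (g h : curve A) (s t : R).

Lemma atlas_chart c : A c -> is_chart c.
Proof. by have [H _ _] := atlasA; exact: H. Qed.

Lemma atlas_coord_system c : A c -> coord_system A c.
Proof. by move=> Ac; have [H _ H2] := atlasA; split=> [|d Ad]; [exact: H|exact: H2]. Qed.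

End Manifold.

Section ChartImages.
Context {R : realType} {T : topologicalType} {E : normedModType R}.
Implicit Types (c : chart T E) (W : set T).

Lemma cimP c x : cdom c x -> cim c (cmap c x).
Proof. by exists x. Qed.

Lemma cinvK c x : is_chart c -> cdom c x -> cinv c (cmap c x) = x.
Proof. by move=> [_ _ H _ _] cx; apply: H; rewrite inE. Qed.

Lemma cmapK c y : is_chart c -> cim c y -> cmap c (cinv c y) = y /\ cdom c (cinv c y).
Proof. by move=> ch [x cx <-]; rewrite cinvK. Qed.

Lemma open_chart_image c W : is_chart c -> open W -> open (cmap c @` (cdom c `&` W)).
Proof.
move=> ch oW; have [oD oI K cc ci] := ch.
rewrite openE => _ [x [cx Wx] <-].
have Ix : cim c (cmap c x) by exact: cimP.
have cix := ci _ (mem_set Ix).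
have N1 : \forall y \near cmap c x, W (cinv c y).
  by apply: cix; rewrite cinvK//; exact: open_near.
have N2 := open_near oI Ix.
rewrite /interior; apply: filterS2 N1 N2 => y Wy Iy.
have [e1 e2] := cmapK ch Iy.
by exists (cinv c y).
Qed.

Lemma open_preimage_in (U : topologicalType) (f : T -> U) (D : set T) (B : set U) :
  open D -> {in D, continuous f} -> open B -> open [set x | D x /\ B (f x)].
Proof.
move=> oD cf oB; rewrite openE => x [Dx Bx].
have N1 : \forall y \near x, B (f y) by apply: (cf _ (mem_set Dx)); exact: open_near.
by rewrite /interior; apply: filterS2 (open_near oD Dx) N1 => y.
Qed.

End ChartImages.

Section Jets.
Context {R : realType} {n : nat} {M : topologicalType}.
Variable A : set (chart M 'rV[R]_n).
Hypothesis atlasA : is_atlas A.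
Implicit Types (c d : chart M 'rV[R]_n) (g h : curve A) (s t : R).

Lemma curve_chart_open g c : coord_system A c -> open (g @^-1` cdom c).
Proof. by move=> [[oD _ _ _ _] _]; apply: open_comp oD => x _; exact: curve_continuous. Qed.

Lemma transition_smooth c d : A c -> coord_system A d ->
  smooth_on (cmap c @` (cdom c `&` cdom d)) (cmap d \o cinv c).
Proof. by move=> Ac [_ /(_ c Ac)[_]]; rewrite setIC. Qed.

Lemma curve_velocity c g s : coord_system A c -> cdom c (g s) ->
  is_derive s 1 (cmap c \o g) (derive1n 1 (cmap c \o g) s).
Proof.
move=> cs cg; rewrite derive1n1 derive1E; apply: derivableP.
exact: Ck_derivable (curve_smooth g cs 1) cg.
Qed.

(** Velocities in two charts are related by the derivative of the transition map, so agreement of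
    velocities in one chart implies agreement in all. *)
Lemma velocity_transition c d g s : A c -> coord_system A d ->
  cdom c (g s) -> cdom d (g s) ->
  derive1n 1 (cmap d \o g) s =
  'D_(derive1n 1 (cmap c \o g) s) (cmap d \o cinv c) (cmap c (g s)).
Proof.
move=> Ac cd cg dg; have cc := atlas_coord_system atlasA Ac.
have ch := atlas_chart atlasA Ac; have dh : is_chart d by case: cd.
have oD : open (cmap c @` (cdom c `&` cdom d)).
  by apply: open_chart_image => //; case: dh.
have Dg : (cmap c @` (cdom c `&` cdom d)) ((cmap c \o g) s) by exists (g s).
have [_ <-] := is_derive_chainV (coords_rV n) (coords_rV n) oD Dg
  (transition_smooth Ac cd 1) (curve_velocity cc cg).
rewrite derive1n1 derive1E; apply: near_eq_derive.
apply: filterS (open_near (curve_chart_open (g := g) cc) cg) => t ct /=.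
by rewrite (cinvK ch ct).
Qed.

Lemma contact1_of_chart c g h s : A c -> g s = h s -> cdom c (g s) ->
  derive1n 1 (cmap c \o g) s = derive1n 1 (cmap c \o h) s -> contact 1 s g h.
Proof.
move=> Ac gh cg v; split; first exact: gh.
move=> d cd dg [_|[_|k kr]]; first by rewrite /= gh.
  2: by exfalso; move: kr; rewrite ltnS ltn0.
have E1 := velocity_transition Ac cd cg dg.
have ch : cdom c (h s) by rewrite -gh.
have dh : cdom d (h s) by rewrite -gh.
have E2 := velocity_transition Ac cd ch dh; rewrite -gh in E2.
have E3 := congr1 (fun w => 'D_w (cmap d \o cinv c) (cmap c (g s))) v.
exact: (etrans E1 (etrans E3 (esym E2))).
Qed.

Lemma contact_refl r s g : contact r s g g.
Proof. by split. Qed.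

Lemma contact_sym r s g h : contact r s g h -> contact r s h g.
Proof. by move=> [e H]; split=> // c cc ch k kr; rewrite H// e. Qed.

Lemma contact_trans r s g h k : contact r s g h -> contact r s h k -> contact r s g k.
Proof.
move=> [e H] [e' H']; split=> [|c cc cg i ir]; first by rewrite e.
by rewrite H// H'// -e.
Qed.

Lemma jet_class_eq r s g h : contact r s g h -> jet_class r (s, g) = jet_class r (s, h).
Proof.
move=> H; apply/seteqP; split=> -[t k] [/= -> K]; split=> //=.
  exact: contact_trans (contact_sym H) K.
exact: contact_trans H K.
Qed.

Lemma jet_ext r (xi eta : jet A r) : jet_set xi = jet_set eta -> xi = eta.
Proof.
case: xi => a Ha; case: eta => b Hb /= E; move: Ha; rewrite E => Ha.
by congr Jet; exact: Prop_irrelevance.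
Qed.

Lemma jet_repP r (xi : jet A r) : jet_set xi = jet_class r (jet_rep xi).
Proof. exact: projT2 (cid (jet_setP xi)). Qed.

Lemma jet_rep_of r s g : (jet_rep (jet_of r s g)).1 = s /\
  contact r s g (jet_rep (jet_of r s g)).2.
Proof.
have H := jet_repP (jet_of r s g); rewrite /= in H.
have : jet_class r (jet_rep (jet_of r s g)) (jet_rep (jet_of r s g)).
  by split=> //; exact: contact_refl.
by rewrite -[X in X _ -> _]H => -[].
Qed.

Lemma jet_of_rep r (xi : jet A r) : jet_of r (jet_rep xi).1 (jet_rep xi).2 = xi.
Proof. by apply: jet_ext; rewrite [RHS]jet_repP /=; case: (jet_rep xi). Qed.

Lemma sode_rep (sigma : sode A) xi : (jet_rep (sigma xi)).1 = (jet_rep xi).1 /\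
  contact 1 (jet_rep xi).1 (jet_rep (sigma xi)).2 (jet_rep xi).2.
Proof.
have [E1 C] := jet_rep_of 1 (jet_rep (sigma xi)).1 (jet_rep (sigma xi)).2.
have E : jet_of 1 (jet_rep (sigma xi)).1 (jet_rep (sigma xi)).2 = xi by exact: sode_section.
by move: E1 C; rewrite E => E1; rewrite E1.
Qed.

Lemma coord1E c (xi : jet A 1) : coord1 c xi =
  ((jet_rep xi).1, cmap c ((jet_rep xi).2 (jet_rep xi).1),
   derive1n 1 (cmap c \o (jet_rep xi).2) (jet_rep xi).1).
Proof. by []. Qed.

(** Position and velocity in a single chart determine the jet of order one. *)
Lemma coord1_inj c (xi eta : jet A 1) : A c -> jet_over c xi -> jet_over c eta ->
  coord1 c xi = coord1 c eta -> xi = eta.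
Proof.
move=> Ac xc ec; rewrite !coord1E => -[E1 E2 E3].
have ch := atlas_chart atlasA Ac.
rewrite -(jet_of_rep xi) -(jet_of_rep eta) -E1; apply: jet_ext; apply: jet_class_eq.
rewrite -E1 in E2 E3.
have E : (jet_rep xi).2 (jet_rep xi).1 = (jet_rep eta).2 (jet_rep xi).1.
  rewrite -(cinvK ch (_ : cdom c ((jet_rep xi).2 (jet_rep xi).1)))// E2 cinvK//.
  by rewrite E1.
exact: contact1_of_chart Ac E xc E3.
Qed.

(** By [coord1_inj] the jet selected in the definition of [local_F] is xi itself. *)
Lemma local_F_coord1 (sigma : sode A) c xi : A c -> jet_over c xi ->
  local_F sigma c (coord1 c xi) = jet_coord 2 (lift_chart c) (sigma xi).
Proof.
move=> Ac xc; rewrite /local_F; case: xgetP => [a _ [eta [ec E ->]]|/(_ _)].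
  by congr jet_coord; congr (sode_fun sigma); exact: coord1_inj Ac ec xc E.
by move=> /(_ (jet_coord 2 (lift_chart c) (sigma xi))); case; exists xi.
Qed.

Lemma coord1_jet_of c s g : coord_system A c -> cdom c (g s) ->
  coord1 c (jet_of 1 s g) = (s, cmap c (g s), derive1n 1 (cmap c \o g) s) /\
  jet_base (jet_of 1 s g) = (s, g s).
Proof.
move=> cc cg; have [E [E0 C]] := jet_rep_of 1 s g.
rewrite coord1E /jet_base E -E0; split=> //; congr (_, _, _).
by rewrite (C c cc cg 1%N).
Qed.

(** A straight line in the chart leaves its image; replacing time by a small multiple of a sine keeps
    the curve in a ball for all times and does not change the velocity at the initial time. *)
Lemma curve_through c z : A c -> cim c z.1.2 ->
  exists g : curve A, [/\ g z.1.1 = cinv c z.1.2 &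
    derive1n 1 (cmap c \o g) z.1.1 = z.2].
Proof.
case: z => [[s y] v] /= Ac Iy; have ch := atlas_chart atlasA Ac.
have [oD oI K cc ci] := ch.
have [r /= r0 Hr] : nbhs_ball y (cim c) by apply/nbhs_ballP; exact: (open_near oI Iy).
have v1 : 0 < `|v| + 1 by rewrite ltr_wpDl.
(* the displacement ep sin((t - s) / ep) v has norm less than r *)
pose ep := r / (`|v| + 1); have ep0 : 0 < ep by rewrite divr_gt0.
pose phi (t : R) := ep * sin ((t - s) / ep).
pose line (t : R) : 'rV[R]_n := y + phi t *: v.
have lineI t : cim c (line t).
  apply: Hr; rewrite -ball_normE /ball_/= /line opprD addNKr normrN normrZ.
  have h1 : `|phi t| <= ep.
    by rewrite /phi normrM (gtr0_norm ep0) ler_piMr ?(ltW ep0)//; exact: sin_max.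
  apply: le_lt_trans (_ : ep * `|v| < r); first by rewrite ler_wpM2r.
  by rewrite /ep mulrAC ltr_pdivrMr// ltr_pM2l// ltrDl.
have Cphi k : Ck k setT phi.
  apply: Ck_eq openT _ (Ck_scale ep openT (Ck_comp_scalar (@coordsR R) openT openT
    (f := fun t : R => (t - s) / ep) (g := sin) (fun _ _ => I) _ (Ck_sin_cos k openT).1)) => //.
  rewrite (_ : (fun t : R => _) = ep^-1 \*: (id + cst (- s))).
    apply: Ck_scale; first exact: openT.
    by apply: Ck_add; [exact: openT|exact: (Ck_clin (clinear_id _) _ _)|exact: Ck_cst].
  by apply/funext => t; rewrite /= /GRing.scale/= mulrC.
have Cline k : Ck k setT line.
  apply: (Ck_add openT (Ck_cst k setT y)).
  exact: (Ck_scalef (coords_rV n) openT (Cphi k) (Ck_cst k setT v)).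
pose g0 t := cinv c (line t).
have cg0 : continuous g0.
  move=> t; apply: continuous_comp; last by apply: ci; exact: mem_set.
  by apply: (Ck_cont (Cline 0%N)); rewrite inE.
have sg0 d : coord_system A d -> smooth_on (g0 @^-1` cdom d) (cmap d \o g0).
  move=> cd k; have dh : is_chart d by case: cd.
  have oD' : open (g0 @^-1` cdom d) by apply: open_comp => [t _|]; [exact: cg0|case: dh].
  have oD2 : open (cmap c @` (cdom c `&` cdom d)) by apply: open_chart_image => //; case: dh.
  apply: (Ck_comp (coords_rV n) (coords_rV n) oD' oD2 (f := line) (g := cmap d \o cinv c)).
  - move=> t dt; have [e1 e2] := cmapK ch (lineI t).
    by exists (g0 t) => //; split.
  - by apply: Ck_sub (Cline k) => t.
  - exact: transition_smooth.
pose g := Curve cg0 sg0.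
exists g; split=> /=.
  by rewrite /g0 /line /phi subrr mul0r sin0 mulr0 scale0r addr0.
have -> : cmap c \o g0 = line.
  by apply/funext => t /=; have [] := cmapK ch (lineI t).
rewrite derive1E.
have dphi : is_derive s 1 phi 1.
  have H1 : is_derive s 1 (fun t : R => (t - s) / ep) (ep^-1).
    have := is_derive_clin (clinear_scalel (ep^-1 : R))
      (is_deriveB (is_derive_id s 1) (is_derive_cst s s 1)).
    by rewrite subr0 scale1r.
  have H2 := is_derive_chain (@coordsR R) (f := fun t : R => (t - s) / ep) (x := s) openT
    (I : setT ((s - s) / ep)) (Ck_sin_cos 1 openT).1 H1.
  have H3 := is_deriveZ ep H2.
  apply: is_derive_eq H3 _.
  have [_ E] := is_derive_scale_dir ep^-1 (is_derive_sin ((s - s) / ep)).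
  rewrite [_%:A]mulr1 in E; rewrite E.
  by rewrite subrr mul0r cos0 /GRing.scale/= mulr1 divff ?gt_eqF.
have H4 := is_derive_clin (clinear_scalel v) dphi.
have H5 := is_deriveD (is_derive_cst y s 1) H4.
by have [_] := H5; rewrite add0r scale1r.
Qed.

End Jets.

(** * Fibred coordinate systems from local diffeomorphisms *)

Lemma Ck_pair {R : realType} {U E V : normedModType R} (b : coords E) (c : coords V) k
    (D : set U) (f : U -> E) (g : U -> V) : open D ->
  Ck k D f -> Ck k D g -> Ck k D (fun y => (f y, g y)).
Proof.
move=> oD Cf Cg; apply: (Ck_coords (b := coords_prod b c)) => // i /=.
case: (fintype.split i) => j /=.
  exact: (Ck_clin_comp (ccoord_lin b j) oD Cf).
exact: (Ck_clin_comp (ccoord_lin c j) oD Cg).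
Qed.

Lemma pair_continuous (T U V : topologicalType) (f : T -> U) (g : T -> V) x :
  {for x, continuous f} -> {for x, continuous g} ->
  {for x, continuous (fun y => (f y, g y))}.
Proof.
move=> cf cg.
exact: (@cvg_pair _ _ _ (nbhs x) (nbhs (f x)) (nbhs (g x)) _ _ _ f g cf cg).
Qed.

Section FibredChart.
Context {R : realType} {n : nat} {M : topologicalType}.
Local Notation E0 := (R * 'rV[R]_n)%type.
Implicit Types (c d : chart M 'rV[R]_n).

Lemma cim_lift c e : cim (lift_chart c) e <-> cim c e.2.
Proof.
split=> [[q cq <-]|[x cx ex]]; first exact: cimP.
by exists (e.1, x) => //=; rewrite ex; case: e {ex}.
Qed.

Lemma fst_continuous (T U : topologicalType) (x : T * U) : {for x, continuous (@fst T U)}.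
Proof. exact: cvg_fst. Qed.

Lemma snd_continuous (T U : topologicalType) (x : T * U) : {for x, continuous (@snd T U)}.
Proof. exact: cvg_snd. Qed.

Lemma lift_is_chart c : is_chart c -> is_chart (lift_chart c : chart0 R M n).
Proof.
move=> ch; have [oD oI K cc ci] := ch; split.
- apply: (open_comp (f := @snd R M) _ oD) => q _; exact: snd_continuous.
- rewrite (_ : cim _ = @snd R 'rV[R]_n @^-1` cim c).
    by apply: open_comp oI => q _; exact: snd_continuous.
  by apply/seteqP; split=> e /cim_lift.
- by move=> [t x]; rewrite inE /= => cx; rewrite (cinvK ch).
- move=> q; rewrite inE /= => cq; apply: pair_continuous; first exact: fst_continuous.
  apply: (@continuous_comp _ _ _ (@snd R M) (cmap c)); first exact: snd_continuous.
  by apply: cc; exact/mem_set.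
- move=> e; rewrite inE => /cim_lift ce; apply: pair_continuous; first exact: fst_continuous.
  apply: (@continuous_comp _ _ _ (@snd R 'rV[R]_n) (cinv c)); first exact: snd_continuous.
  by apply: ci; exact/mem_set.
Qed.

Variable A : set (chart M 'rV[R]_n).
Hypothesis atlasA : is_atlas A.
Variable c : chart M 'rV[R]_n.
Hypothesis Ac : A c.

Lemma lift_transition_smooth k d d' : A d -> A d' ->
  Ck k [set e : E0 | (cmap d @` (cdom d `&` cdom d')) e.2]
    (fun e => (e.1, (cmap d' \o cinv d) e.2)).
Proof.
move=> Ad Ad'; have dh := atlas_chart atlasA Ad; have [od' _ _ _ _] := atlas_chart atlasA Ad'.
have oD := open_chart_image dh od'.
have oD2 : open [set e : E0 | (cmap d @` (cdom d `&` cdom d')) e.2].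
  by apply: open_comp oD => e _; exact: snd_continuous.
apply: (Ck_pair (@coordsR R) (coords_rV n)) => //.
  exact: (Ck_clin (clinear_fst _ _)).
apply: (Ck_comp (coords_rV n) (coords_rV n) oD2 oD (f := snd)) => //.
  exact: (Ck_clin (clinear_snd _ _)).
exact: transition_smooth Ad (atlas_coord_system atlasA Ad') k.
Qed.

Variables (psi psii : E0 -> E0) (B : set E0).
Hypotheses (oB : open B) (BI : forall e, B e -> cim c e.2).
Hypotheses (Cpsi : forall k, Ck k B psi) (opsi : open (psi @` B)).
Hypothesis Cpsii : forall k, Ck k (psi @` B) psii.
Hypothesis psiiK : forall e, B e -> psii (psi e) = e.
Hypothesis psi1 : forall e, (psi e).1 = e.1.

(** The coordinates (t, x) of c are composed with the local diffeomorphism psi of its inverse psii. *)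
Definition new_chart : chart0 R M n :=
  Chart [set q | cdom c q.2 /\ B (q.1, cmap c q.2)]
        (fun q => psi (q.1, cmap c q.2))
        (fun e => ((psii e).1, cinv c (psii e).2)).

Let ch : is_chart c := atlas_chart atlasA Ac.

Lemma new_chart_is_chart : is_chart new_chart.
Proof.
have lch := lift_is_chart ch; have [oD oI K cc ci] := lch.
have oN : open (cdom new_chart).
  exact: (open_preimage_in oD cc oB).
have im : cim new_chart = psi @` B.
  apply/seteqP; split=> [_ [q [cq Bq] <-]|_ [e Be <-]]; first by exists (q.1, cmap c q.2).
  have [e1 e2] := cmapK ch (BI Be).
  by exists (e.1, cinv c e.2); rewrite /= e1; case: e Be {e1 e2} => //= t x Be; have [] := cmapK ch (BI Be).
split=> //.
- by rewrite im.
- move=> [t x]; rewrite inE => -[/= cx Bx]; rewrite psiiK//= (cinvK ch cx)//.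
- move=> q; rewrite inE => -[/= cq Bq].
  apply: (@continuous_comp _ _ _ (cmap (lift_chart c)) psi); first by apply: cc; exact/mem_set.
  by apply: (Ck_cont (Cpsi 0)); exact/mem_set.
- rewrite im => e; rewrite inE => Ie.
  apply: (@continuous_comp _ _ _ psii (cinv (lift_chart c))).
    by apply: (Ck_cont (Cpsii 0)); exact/mem_set.
  by apply: ci; apply/mem_set/cim_lift; case: Ie => e' Be' <-; rewrite psiiK//; exact: BI.
Qed.

(** Transitions to the other charts are composed of psi or psii and of transitions of M, which do
    not involve t. *)
Lemma new_chart_fibred : fibred_coord A new_chart.
Proof.
split; last by move=> q _; rewrite /= psi1.
split; first exact: new_chart_is_chart.
move=> _ [d Ad <-]; have dh := atlas_chart atlasA Ad.
have [od _ _ _ _] := lift_is_chart dh.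
have [on _ _ _ _] := new_chart_is_chart.
have o1 : open (cmap new_chart @` (cdom new_chart `&` cdom (lift_chart d))).
  exact: open_chart_image new_chart_is_chart od.
have o2 : open (cmap (lift_chart d) @` (cdom new_chart `&` cdom (lift_chart d))).
  by rewrite setIC; exact: open_chart_image (lift_is_chart dh) on.
have [odd' _ _ _ _] := dh; have [oc _ _ _ _] := ch.
split=> k.
  have oT : open [set e : E0 | (cmap c @` (cdom c `&` cdom d)) e.2].
    by apply: (open_comp _ (open_chart_image ch odd')) => e _; exact: snd_continuous.
  apply: (Ck_comp (coords0 (n := n)) (coords0 (n := n)) o1 oT (f := psii)
    (g := fun e => (e.1, (cmap d \o cinv c) e.2)) _ _ (lift_transition_smooth k Ac Ad)).
    move=> _ [q [[cq Bq] dq] <-] /=; rewrite psiiK//=; by exists q.2.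
  apply: Ck_sub (Cpsii k) => _ [q [[cq Bq] dq] <-]; by exists (q.1, cmap c q.2).
apply: (Ck_comp (coords0 (n := n)) (coords0 (n := n)) o2 oB
  (f := fun e => (e.1, (cmap c \o cinv d) e.2)) (g := psi)).
- by move=> _ [q [[cq Bq] dq] <-] /=; rewrite (cinvK dh dq).
- apply: Ck_sub (lift_transition_smooth k Ad Ac) => _ [q [[cq Bq] dq] <-]; by exists q.2.
- exact: Cpsi.
Qed.

Lemma smooth_fun_new_chart (f : E0 -> R) : (forall k, Ck k B f) ->
  smooth_fun (atlas0 A) (cdom new_chart) (fun q => f (q.1, cmap c q.2)).
Proof.
move=> Cf d [dh dc] k.
have lA : atlas0 A (lift_chart c) by exists c.
have [C _] := dc _ lA.
have [on _ _ _ _] := new_chart_is_chart.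
have o1 : open (cmap d @` (cdom d `&` cdom new_chart)) by exact: open_chart_image.
apply: (Ck_comp_scalar (coords0 (n := n)) o1 oB (f := cmap (lift_chart c) \o cinv d) (g := f)).
- by move=> _ [q [dq [cq Bq]] <-] /=; rewrite (cinvK dh dq).
- apply: Ck_sub (C k) => _ [q [dq [cq Bq]] <-]; by exists q.
- exact: Cf.
Qed.

End FibredChart.

(** * The equation in adapted coordinates *)

Section TotalDerivatives.
Context {R : realType} {n : nat}.
Local Notation E0 := (R * 'rV[R]_n)%type.
Local Notation dt := ((1, 0) : E0).
Variables (F : E1 R n -> 'rV[R]_n) (V : set 'rV[R]_n) (e0 : E0) (r : R).
Variables (u : E0 -> 'cV[R]_n) (p y : E0 -> 'M[R]_n).
Hypothesis ad : adapted F V e0 r u p y.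
Local Notation U := (ball e0 r).
Let oU : open U. Proof. exact: ball_open. Qed.

Lemma adapted_dM_unit e (v : 'rV[R]_n) : U e ->
  dM ((1, v) : E0) u e = dM dt u e + p e *m v^T.
Proof.
move=> Ue; rewrite [(1, v)]time_space_split (dM_lin (coords0 (n := n)) 1 _ _ oU Ue (adapted_u ad 1)).
by rewrite scale1r (mderive_dM (adapted_du ad v Ue)).
Qed.

Lemma adapted_dM_frame e (v : 'rV[R]_n) : U e ->
  dM ((1, v) : E0) p e = dM dt p e + p e *m Theta F e (0, v).
Proof.
move=> Ue; rewrite [(1, v)]time_space_split (dM_lin (coords0 (n := n)) 1 _ _ oU Ue (adapted_p ad 1)).
by rewrite scale1r (mderive_dM (adapted_dp ad v Ue)).
Qed.

(** By symmetry of second derivatives, the space derivative of u_t is the time derivative of p. *)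
Lemma adapted_dM_drift e (v : 'rV[R]_n) : U e ->
  dM ((1, v) : E0) (dM dt u) e = dM dt (dM dt u) e + dM dt p e *m v^T.
Proof.
move=> Ue; rewrite [(1, v)]time_space_split.
rewrite (dM_lin (coords0 (n := n)) 1 _ _ oU Ue (MCk_dM dt (adapted_u ad 2))) scale1r; congr (_ + _).
rewrite (Schwarz_mx _ _ oU Ue (adapted_u ad 2)); apply: mderive_dM.
have H := mderive_mul (MCk_mderive dt (adapted_p ad 1) Ue) (mderive_cst v^T e dt).
rewrite mulmx0 addr0 in H.
apply: (mderive_eq oU Ue _ H) => e' Ue'.
by rewrite (mderive_dM (adapted_du ad v Ue')).
Qed.

Variables (S : set R) (k : R -> 'rV[R]_n).
Hypotheses (kU : forall t, S t -> U (t, k t)).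
Variables (k1 : R -> 'rV[R]_n).
Hypothesis dk : forall t, S t -> is_derive t 1 k (k1 t).

Lemma total_derivative m1 m2 (P : E0 -> 'M[R]_(m1, m2)) t : S t -> MCk 1 U P ->
  mderive t 1 (fun t => P (t, k t)) (dM ((1, k1 t) : E0) P (t, k t)).
Proof.
move=> St CP; apply: (mderive_chain (coords0 (n := n)) (f := fun t => (t, k t)) oU) => //.
  exact: kU.
exact: (is_derive_pair (@coordsR R) (coords_rV n) (is_derive_id t 1) (dk St)).
Qed.

Lemma new_velocity t : S t ->
  mderive t 1 (fun t => u (t, k t)) (dM dt u (t, k t) + p (t, k t) *m (k1 t)^T).
Proof.
move=> St; rewrite -(adapted_dM_unit _ (kU St)); exact: total_derivative St (adapted_u ad 1).
Qed.

(** The derivative of p along (0, v) contributes p Theta (0, v) v, which cancels the quadratic part of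
    p k2. The term p_t v occurs twice, from p and from u_t. *)
Lemma new_acceleration t k2 : S t -> mderive t 1 k1 k2 ->
  k2^T = ccoef F (t, k t) - 2 *: (bcoef F (t, k t) *m (k1 t)^T)
     - Theta F (t, k t) (0, k1 t) *m (k1 t)^T ->
  mderive t 1 (fun t => dM dt u (t, k t) + p (t, k t) *m (k1 t)^T)
   (dM dt (dM dt u) (t, k t) + p (t, k t) *m ccoef F (t, k t)
    + 2 *: (dM dt p (t, k t) - p (t, k t) *m bcoef F (t, k t)) *m (k1 t)^T).
Proof.
move=> St dk1 k2E; have Ue := kU St.
have H := mderive_add (total_derivative St (MCk_dM dt (adapted_u ad 2)))
  (mderive_mul (total_derivative St (adapted_p ad 1)) (mderive_tr dk1)).
rewrite k2E adapted_dM_drift// adapted_dM_frame// in H.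
move: H; congr mderive.
move: (dM dt (dM dt u) _) (dM dt p _) => a1 a2.
rewrite !mulmxDr !mulmxDl -!mulmxA !mulmxN -!scalemxAr -!scalemxAl mulmxBl -!mulmxA.
move: (p _ *m ccoef _ _) (p _ *m (bcoef _ _ *m _)) (p _ *m (Theta _ _ _ *m _)) (a2 *m _) => b1 b2 b3 b4.
by apply/matrixP => i j; rewrite !mxE; ring.
Qed.

End TotalDerivatives.

Section AdaptedChart.
Context {R : realType} {n : nat}.
Local Notation E0 := (R * 'rV[R]_n)%type.
Local Notation dt := ((1, 0) : E0).
Variables (F : E1 R n -> 'rV[R]_n) (V : set 'rV[R]_n) (e0 : E0) (r : R).
Variables (u : E0 -> 'cV[R]_n) (p y : E0 -> 'M[R]_n).
Hypothesis ad : adapted F V e0 r u p y.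
Local Notation U := (ball e0 r).
Let oU : open U. Proof. exact: ball_open. Qed.
Let U0 : U e0. Proof. exact: ball_center0 (adapted_r ad). Qed.

Definition fibre_map (e : E0) : E0 := (e.1, (u e)^T).

Lemma Ck_time_row k (D : set E0) (a : R) (f : E0 -> 'cV[R]_n) : open D -> MCk k D f ->
  Ck k D (fun e => (a, (f e)^T)).
Proof.
move=> oD Cf; apply: (Ck_pair (@coordsR R) (coords_rV n)) => //; first exact: Ck_cst.
exact: Ck_row.
Qed.

Lemma fibre_map_smooth k : Ck k U fibre_map.
Proof.
apply: (Ck_pair (@coordsR R) (coords_rV n)) => //; last exact: Ck_row (adapted_u ad k).
exact: (Ck_clin (clinear_fst _ _)).
Qed.

Lemma fibre_map_derive e (w : E0) : U e ->
  'D_w fibre_map e = (w.1, (w.1 *: dM dt u e + p e *m w.2^T)^T).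
Proof.
move=> Ue.
have H := MCk_mderive w (adapted_u ad 1) Ue.
have Hd : dM w u e = w.1 *: dM dt u e + p e *m w.2^T.
  rewrite [in LHS](time_space_split w) (dM_lin (coords0 (n := n)) _ _ _ oU Ue (adapted_u ad 1)).
  by rewrite (mderive_dM (adapted_du ad w.2 Ue)).
rewrite Hd in H.
suff [_ <-] : is_derive e w fibre_map (w.1, (w.1 *: dM dt u e + p e *m w.2^T)^T) by [].
apply: (is_derive_pair (@coordsR R) (coords_rV n) (f := fst) (g := fun e => (u e)^T)).
  exact: (is_derive_clin_id (clinear_fst _ _)).
exact: is_derive_row.
Qed.

(** The inverse of the derivative of [fibre_map], obtained by solving w.2 = w.1 u_t + p x for x. *)
Definition fibre_map_dinv (e w : E0) : E0 := (w.1, (y e *m (w.2^T - w.1 *: dM dt u e))^T).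

Lemma fibre_map_invertible : exists q psii, [/\ 0 < q, ball e0 q `<=` U,
  open (fibre_map @` ball e0 q), forall k, Ck k (fibre_map @` ball e0 q) psii &
  forall e, ball e0 q e -> psii (fibre_map e) = e].
Proof.
have dpsi0 w : 'D_w fibre_map e0 = w.
  rewrite fibre_map_derive// (adapted_ut0 ad) (adapted_p0 ad) mul1mx scaler0 add0r trmxK.
  by case: w.
have [q q0 [qU lip]] := near_identity_of_derivative (coords0 (n := n)) oU U0 fibre_map_smooth dpsi0.
exists q, (near_identity_inv fibre_map e0 q); split=> //.
- exact: (near_identity_open (coords0 (n := n)) lip).
- apply: (near_identity_inv_smooth (coords0 (n := n)) oU fibre_map_smooth qU lip (L := fibre_map_dinv)).
    move=> k w; apply: Ck_time_row => //; apply: MCk_mul => //; first exact: (adapted_y ad).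
    apply: MCk_add => //; first exact: MCk_cst.
    by apply: MCk_opp => //; apply: MCk_scale => //; exact: MCk_dM (adapted_u ad _).
  move=> e w Ue; rewrite fibre_map_derive// trmxK mulmxA (adapted_py ad Ue) mul1mx.
  by rewrite addrC subrK trmxK; case: w.
- exact: (near_identity_invK lip).
Qed.

End AdaptedChart.

Section CoordinatesAlongCurves.
Context {R : realType} {n : nat} {M : topologicalType}.
Local Notation E0 := (R * 'rV[R]_n)%type.
Local Notation dt := ((1, 0) : E0).
Variable A : set (chart M 'rV[R]_n).
Hypothesis atlasA : is_atlas A.
Variable c : chart M 'rV[R]_n.
Hypothesis Ac : A c.
Variables (F : E1 R n -> 'rV[R]_n) (V : set 'rV[R]_n) (e0 : E0) (r : R).
Variables (u : E0 -> 'cV[R]_n) (p y : E0 -> 'M[R]_n).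
Hypothesis ad : adapted F V e0 r u p y.
Variables (B : set E0) (psii : E0 -> E0).
Hypotheses (oB : open B) (BU : B `<=` ball e0 r).
Local Notation phi := (new_chart c (fibre_map u) psii B).
Implicit Types (g : curve A) (s t : R).

Let dom g := [set t | cdom c (g t) /\ B (t, cmap c (g t))].
Let coords_of g t := cmap c (g t).
Let new_coords g t : 'rV[R]_n := (cmap phi (t, g t)).2.

Let cs : coord_system A c := atlas_coord_system atlasA Ac.

Lemma open_dom g : open (dom g).
Proof.
apply: (open_preimage_in (curve_chart_open (g := g) cs) (f := fun t => (t, coords_of g t)) _ oB).
move=> t tc; apply: pair_continuous; first exact: cvg_id.
exact: (Ck_cont (curve_smooth g cs 0) tc).
Qed.

Lemma coords_velocity g t : dom g t -> is_derive t 1 (coords_of g) (derive1n 1 (coords_of g) t).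
Proof. by move=> [ct _]; exact: curve_velocity cs ct. Qed.

Lemma coords_acceleration g t : dom g t ->
  mderive t 1 (derive1n 1 (coords_of g)) (derive1n 2 (coords_of g) t).
Proof.
move=> [ct _]; apply: mderive_of_row.
have E : derive1n 1 (coords_of g) = 'D_1 (coords_of g).
  by rewrite derive1n1; apply/funext => x; rewrite derive1E.
have -> : derive1n 2 (coords_of g) t = 'D_1 (derive1n 1 (coords_of g)) t.
  by rewrite derive1nS derive1E.
apply: derivableP; rewrite E.
exact: Ck_derivable (Ck_derive (1 : R) (curve_smooth g cs 2)) ct.
Qed.

Lemma dom_ball g t : dom g t -> ball e0 r (t, coords_of g t).
Proof. by move=> [_ /BU]. Qed.

Lemma new_coords_velocity g t e v : dom g t ->
  (t, coords_of g t) = e -> derive1n 1 (coords_of g) t = v ->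
  derive1n 1 (new_coords g) t = (dM dt u e + p e *m v^T)^T.
Proof.
move=> dt0 <- <-.
have H := is_derive_row (new_velocity ad (dom_ball (g := g)) (coords_velocity (g := g)) dt0).
by rewrite derive1n1 derive1E; case: H.
Qed.

Lemma new_coords_acceleration g t e v a : dom g t ->
  (t, coords_of g t) = e -> derive1n 1 (coords_of g) t = v ->
  derive1n 2 (coords_of g) t = a ->
  a^T = ccoef F e - 2 *: (bcoef F e *m v^T) - Theta F e (0, v) *m v^T ->
  derive1n 2 (new_coords g) t = (dM dt (dM dt u) e + p e *m ccoef F e
    + 2 *: (dM dt p e - p e *m bcoef F e) *m v^T)^T.
Proof.
move=> dt0 <- <- <- E.
have [_ <-] := is_derive_row (new_acceleration ad (dom_ball (g := g))
  (coords_velocity (g := g)) dt0 (coords_acceleration dt0) E).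
rewrite derive1nS derive1E; apply: near_eq_derive.
apply: filterS (open_near (open_dom (g := g)) dt0) => t' dt'.
exact: new_coords_velocity.
Qed.

End CoordinatesAlongCurves.

(** * Normal forms *)

Section NormalForms.
Context {R : realType} {n : nat} {M : topologicalType}.
Local Notation E0 := (R * 'rV[R]_n)%type.
Local Notation dt := ((1, 0) : E0).
Local Notation Tm := (@T_minus R n).
Local Notation Tp := (fun _ => @T_plus R n).
Variable A : set (chart M 'rV[R]_n).
Hypothesis atlasA : is_atlas A.
Variable sigma : sode A.

Lemma curvature_vanishes_swap (P Q : subspaces) (xi : jet A 1) :
  curvature_vanishes sigma P Q Tm xi <-> curvature_vanishes sigma P Q Tp xi.
Proof.
have H c : coord_system A c -> jet_over c xi -> forall X Y,
    (forall Z, T_minus (local_F sigma c) (coord1 c xi) Z ->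
       curvature_at (local_F sigma c) (coord1 c xi) X Y Z = 0) <->
    (forall Z, T_plus (coord1 c xi) Z ->
       curvature_at (local_F sigma c) (coord1 c xi) X Y Z = 0).
  move=> cc xc X Y.
  have [[_ oI _ _ _] _] := cc.
  have oW : open (over1 (cim c) : set (E1 R n)) by exact: open_over1.
  have Wz : over1 (cim c) (coord1 c xi) by rewrite coord1E; exact: cimP.
  have CF k := sode_smooth sigma cc k : Ck k (over1 (cim c)) (local_F sigma c).
  split=> K.
    by apply/(curvature_vanishes_plus oW CF X Y Wz)/(curvature_vanishes_minus oW CF X Y Wz).
  by apply/(curvature_vanishes_minus oW CF X Y Wz)/(curvature_vanishes_plus oW CF X Y Wz).
split=> K c cc xc F z X Y Z PX QY; have [mp pm] := H c cc xc X Y.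
  by apply: mp => Z'; exact: K.
by apply: pm => Z'; exact: K.
Qed.

Variables (x : M) (N : set M).
Hypothesis oN : open N.
Variable t0 : R.
Variable c : chart M 'rV[R]_n.
Hypotheses (Ac : A c) (cx : cdom c x).

Local Notation V := (cmap c @` (cdom c `&` N)).
Local Notation F := (local_F sigma c).
Local Notation e0 := ((t0, cmap c x) : E0).

Let ch : is_chart c := atlas_chart atlasA Ac.
Let cs : coord_system A c := atlas_coord_system atlasA Ac.

Let oV : open V. Proof. exact: open_chart_image. Qed.

Let VI w : V w -> cim c w. Proof. by move=> [q [cq _] <-]; exact: cimP. Qed.

Let CF k : Ck k (over1 V) F.
Proof. by apply: Ck_sub (sode_smooth sigma cs k) => z; exact: VI. Qed.

(** All points (t, x, v) over the chart are met, so conditions on jets become identities of functions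
    that can be differentiated. *)
Lemma jet_with_coords z : over1 V z ->
  exists xi : jet A 1, [/\ jet_over c xi, coord1 c xi = z & jets_in A N xi].
Proof.
case: z => -[s w] v Vz; have [q [cq Nq] qw] := Vz; rewrite /= in qw.
have [g [g1 g2]] := curve_through atlasA Ac (VI Vz : cim c ((s, w, v) : E1 R n).1.2).
rewrite /= -qw (cinvK ch cq) in g1 g2.
have cg : cdom c (g s) by rewrite g1.
have [E1 E2] := coord1_jet_of cs cg.
exists (jet_of 1 s g); split.
- suff H : jet_base (jet_of 1 s g) = (s, g s) by rewrite /jet_over H.
  exact: E2.
- apply: (etrans E1); rewrite g1 qw; congr pair; exact: g2.
- apply: (eq_ind_r (fun b => N b.2) _ E2); by rewrite /= g1.
Qed.

Lemma theta_curv_of_vanishes (P Q : subspaces) :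
  (forall xi, jets_in A N xi -> curvature_vanishes sigma P Q Tm xi) ->
  forall z X Y, over1 V z -> P F z X -> Q F z Y -> theta_curv F X Y z = 0.
Proof.
move=> H z X Y Vz PX QY; have [xi [xc xz xN]] := jet_with_coords Vz.
apply/(curvature_vanishes_minus (open_over1 oV) CF X Y Vz) => Z TZ.
have := H xi xN c cs xc; rewrite /= xz; exact.
Qed.

Lemma K_of_vanishes : (forall xi, jets_in A N xi -> K_vanishes sigma xi) ->
  forall z X Y, over1 V z -> K_at F z X Y = 0.
Proof.
move=> H z X Y Vz; have [xi [xc xz xN]] := jet_with_coords Vz.
by have := H xi xN c cs xc X Y; rewrite xz.
Qed.

Section Chart.
Hypothesis third0 : forall z i j k l, over1 V z -> pdot l (pdot i (dF F j k)) z = 0.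
Variables (r : R) (u : E0 -> 'cV[R]_n) (p y : E0 -> 'M[R]_n).
Hypothesis ad : adapted F V e0 r u p y.

(** The velocity v of the old chart is an auxiliary variable here: for the affine normal form it is
    expressed through the new velocity. *)
Lemma adapted_chart : exists phi : chart0 R M n, [/\ centred_coord A (t0, x) phi,
  forall f : E0 -> R, (forall k, Ck k (ball e0 r) f) ->
    smooth_fun (atlas0 A) (cdom phi) (fun q => f (q.1, cmap c q.2)) &
  forall xi : jet A 1, cdom phi (jet_base xi) ->
    exists e v, [/\ ((jet_base xi).1, cmap c (jet_base xi).2) = e, ball e0 r e,
      jet_coord 1 phi xi = (dM dt u e + p e *m v)^T &
      jet_coord 2 phi (sigma xi) = (dM dt (dM dt u) e + p e *m ccoef F e
         + 2 *: (dM dt p e - p e *m bcoef F e) *m v)^T]].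
Proof.
have [q [psii [q0 qU opsi Cpsii psiiK]]] := fibre_map_invertible ad.
have oB : open (ball e0 q) by exact: ball_open.
have BI e : ball e0 q e -> cim c e.2.
  by move=> /qU/(adapted_sub ad)/VI.
have Cpsi k : Ck k (ball e0 q) (fibre_map u) by exact: Ck_sub qU (fibre_map_smooth ad k).
have psi1 e : (fibre_map u e).1 = e.1 by [].
exists (new_chart c (fibre_map u) psii (ball e0 q)); split.
- split; first exact: (new_chart_fibred atlasA Ac oB BI Cpsi opsi Cpsii psiiK psi1).
    by split=> //=; exact: ballxx.
  by rewrite /= (adapted_u0 ad) trmx0.
- move=> f Cf; apply: (smooth_fun_new_chart atlasA Ac oB BI Cpsi opsi Cpsii psiiK) => k.
  exact: Ck_sub qU (Cf k).
- move=> xi; rewrite /jet_base /jet_coord.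
  have := local_F_coord1 atlasA sigma Ac (xi := xi); rewrite /jet_over /jet_base coord1E.
  rewrite /jet_coord; have [-> [E C]] := sode_rep sigma xi.
  move: (jet_rep xi) (jet_rep (sigma xi)) E C => [s g] [s2 g2] /= E C LF [cg Bg].
  have cg2 : cdom c (g2 s) by rewrite E.
  have v12 := C c cs cg2 1%N erefl.
  have D1 := conj cg Bg : cdom c (g s) /\ ball e0 q (s, cmap c (g s)).
  have D2 : cdom c (g2 s) /\ ball e0 q (s, cmap c (g2 s)) by rewrite E.
  have E2 : (s, cmap c (g2 s)) = (s, cmap c (g s)) by rewrite E.
  exists (s, cmap c (g s)), ((derive1n 1 (cmap c \o g) s)^T); split.
  + by [].
  + exact: qU.
  + exact: (new_coords_velocity atlasA Ac ad psii qU D1 erefl erefl).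
  + apply: (new_coords_acceleration atlasA Ac ad psii oB qU D2 E2 v12 (esym (LF cg))).
    apply: (fibre_zeroth oV CF third0).
    by apply: (adapted_sub ad); exact: qU.
Qed.

End Chart.

Local Notation smooth_near r P := (forall k, MCk k (ball e0 r) P).

(** Solving u' = u_t + p v for v turns the equation into an affine one in the new velocity. *)
Lemma affine_normal_form r u p y : adapted F V e0 r u p y ->
  (forall z i j k l, over1 V z -> pdot l (pdot i (dF F j k)) z = 0) ->
  exists2 phi, centred_coord A (t0, x) phi & affine_in sigma phi.
Proof.
move=> ad third0; have [phi [cphi sm H]] := adapted_chart third0 ad.
have oB : open (ball e0 r) by exact: ball_open.
have Cb k : MCk k (ball e0 r) (bcoef F) by exact: MCk_sub (adapted_sub ad) (smooth_bcoef oV CF k).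
have Cc k : MCk k (ball e0 r) (ccoef F) by exact: MCk_sub (adapted_sub ad) (smooth_ccoef oV CF k).
(* a is the matrix of the linear part in the new velocity, b the inhomogeneous part *)
pose a e := 2 *: (dM dt p e - p e *m bcoef F e) *m y e.
pose b e := dM dt (dM dt u) e + p e *m ccoef F e - a e *m dM dt u e.
have Ca k : MCk k (ball e0 r) a.
  apply: MCk_mul => //; last exact: (adapted_y ad).
  apply: MCk_scale => //; apply: MCk_add => //; first exact: MCk_dM (adapted_p ad _).
  by apply: MCk_opp => //; apply: MCk_mul => //; exact: (adapted_p ad).
have Cb' k : MCk k (ball e0 r) b.
  apply: MCk_add => //.
    apply: MCk_add => //; first exact: (MCk_dM _ (MCk_dM _ (adapted_u ad _))).
    by apply: MCk_mul => //; exact: (adapted_p ad).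
  by apply: MCk_opp => //; apply: MCk_mul => //; exact: MCk_dM (adapted_u ad _).
exists phi => //.
exists (fun i j q => a (q.1, cmap c q.2) i j), (fun i q => b (q.1, cmap c q.2) i 0).
split=> [i j|i|xi i xphi].
- by apply: (sm (fun e => a e i j)) => k; exact: Ca.
- by apply: (sm (fun e => b e i 0)) => k; exact: Cb'.
have [e [v [-> Be -> ->]]] := H xi xphi.
have -> : \sum_j a e i j * ((dM dt u e + p e *m v)^T) 0 j = (a e *m (dM dt u e + p e *m v)) i 0.
  by rewrite [RHS]mxE; apply: eq_bigr => j _; rewrite [X in _ * X]mxE.
have av : a e *m (p e *m v) = 2 *: (dM dt p e - p e *m bcoef F e) *m v.
  by rewrite /a -[LHS]mulmxA [y e *m _]mulmxA (adapted_yp ad Be) mul1mx.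
rewrite [LHS]mxE mulmxDr av /b.
move: (dM dt (dM dt u) e) (a e *m _) (p e *m _) (_ *m v) => m1 m2 m3 m4.
by rewrite !mxE; ring.
Qed.

(** If p_t = p B, the coefficient of the velocity vanishes; the formula for the remaining function is
    kept in the statement because it is zero when u_tt = - p C. *)
Lemma basic_normal_form r u p y : adapted F V e0 r u p y ->
  (forall z i j k l, over1 V z -> pdot l (pdot i (dF F j k)) z = 0) ->
  (forall e, ball e0 r e -> dM dt p e = p e *m bcoef F e) ->
  exists2 phi, centred_coord A (t0, x) phi & exists b : E0 -> 'cV[R]_n,
   [/\ forall e, ball e0 r e -> b e = dM dt (dM dt u) e + p e *m ccoef F e,
    forall i, smooth_fun (atlas0 A) (cdom phi) (fun q => b (q.1, cmap c q.2) i 0) &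
    forall (xi : jet A 1) i, cdom phi (jet_base xi) ->
      ball e0 r ((jet_base xi).1, cmap c (jet_base xi).2) /\
      jet_coord 2 phi (sigma xi) 0 i = b ((jet_base xi).1, cmap c (jet_base xi).2) i 0].
Proof.
move=> ad third0 pt; have [phi [cphi sm H]] := adapted_chart third0 ad.
have oB : open (ball e0 r) by exact: ball_open.
have Cc k : MCk k (ball e0 r) (ccoef F) by exact: MCk_sub (adapted_sub ad) (smooth_ccoef oV CF k).
pose b e := dM dt (dM dt u) e + p e *m ccoef F e.
have Cb k : MCk k (ball e0 r) b.
  apply: MCk_add => //; first exact: (MCk_dM _ (MCk_dM _ (adapted_u ad _))).
  by apply: MCk_mul => //; exact: (adapted_p ad).
exists phi => //; exists b; split=> [//|i|xi i xphi].
  by apply: (sm (fun e => b e i 0)) => k; exact: Cb.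
have [e [v [-> Be _ ->]]] := H xi xphi; split=> //.
by rewrite (pt e Be) subrr scaler0 mul0mx addr0 [LHS]mxE.
Qed.

End NormalForms.

Theorem theorem5p3 (R : realType) (n : nat) (M : topologicalType)
    (A : set (chart M 'rV[R]_n)) (mfdA : smooth_manifold A)
    (connM : connected [set: M]) (sigma : sode A) :
  (forall xi : jet A 1,
     [/\ cond_i sigma xi <-> cond_i' sigma xi,
         cond_ii sigma xi <-> cond_ii' sigma xi
       & cond_iii sigma xi <-> cond_iii' sigma xi]) /\
  (forall (x : M) (N : set M), open N -> N x -> forall t0 : R,
     [/\ (forall xi, jets_in A N xi -> cond_ii sigma xi /\ cond_iii sigma xi) ->
           exists2 phi, centred_coord A (t0, x) phi & affine_in sigma phi,
         (forall xi, jets_in A N xi -> cond_i sigma xi /\ cond_iii sigma xi) ->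
           exists2 phi, centred_coord A (t0, x) phi & basic_in sigma phi
       & (forall xi, jets_in A N xi -> cond_iii sigma xi /\
                                       K_vanishes sigma xi) ->
           exists2 phi, centred_coord A (t0, x) phi & zero_in sigma phi]).
Proof.
split; first by move=> xi; split; exact: curvature_vanishes_swap.
move=> x N oN Nx t0; have atlasA := manifold_atlas mfdA.
have [_ /(_ x)[c Ac cx] _] := atlasA.
have ch := atlas_chart atlasA Ac; have cs := atlas_coord_system atlasA Ac.
pose V := cmap c @` (cdom c `&` N); pose F := local_F sigma c.
have oV : open V by exact: open_chart_image.
have CF k : Ck k (over1 V) F.
  by apply: Ck_sub (sode_smooth sigma cs k) => z [q [cq _] /= qz]; exists q.
have e0V : over0 V (t0, cmap c x) by exists x.
have third0 : (forall xi, jets_in A N xi -> cond_iii sigma xi) ->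
    forall z i j k l, over1 V z -> pdot l (pdot i (dF F j k)) z = 0.
  by move=> H3; exact: (third_derivatives_vanish oV CF (theta_curv_of_vanishes atlasA oN Ac H3)).
split=> H.
- have th := third0 (fun xi xN => (H xi xN).2).
  have H2 := theta_curv_of_vanishes atlasA oN Ac (fun xi xN => (H xi xN).1).
  have [r [u [p [y ad]]]] := adapted_of_flat_fibres oV CF e0V (base_flat_fibres oV CF th H2).
  exact: affine_normal_form ad th.
- have th := third0 (fun xi xN => (H xi xN).2).
  have H1 := theta_curv_of_vanishes atlasA oN Ac (fun xi xN => (H xi xN).1).
  have [r [u [p [y [ad pt]]]]] := adapted_of_flat oV CF e0V (base_flat oV CF th H1).
  have [phi cphi [b [_ sb Hb]]] := basic_normal_form atlasA oN Ac cx ad th pt.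
  exists phi => //; exists (fun i q => b (q.1, cmap c q.2) i 0); split=> // xi i xphi.
  by have [] := Hb xi i xphi.
- have th := third0 (fun xi xN => (H xi xN).1).
  have HK := K_of_vanishes atlasA Ac (fun xi xN => (H xi xN).2).
  have [r [u [p [y [ad pt ut]]]]] := adapted_of_K_zero oV CF e0V (K_flat oV CF th HK).
  have [phi cphi [b [bE _ Hb]]] := basic_normal_form atlasA oN Ac cx ad th pt.
  exists phi => // xi i xphi; have [Be ->] := Hb xi i xphi.
  by rewrite bE// ut// addNr mxE.
Qed.
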